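(* Let $\mathbb{G}$ be a Carnot group with horizontal layer $V_1$ of dimension $m$, equipped with its Carnot–Carathéodory distance $d_c$. Let $D\subset\mathbb{G}$ be an open set and let $f:D\to\mathbb{R}$ be Pansu differentiable (at every point of $D$). Denote $g(x)=\nabla_Hf(x)\in\mathbb{R}^m$ for $x\in D$, and suppose $G\subset\mathbb{R}^m$ is an open set such that $g^{-1}(G)\neq\varnothing$. Then the following statements hold: \begin{enumerate} \item $g^{-1}(G)$ is porous (with respect to $d_c$) at none of its points. \item If $T\subset\mathbb{G}$ is open and $T\cap g^{-1}(G)\neq\varnothing$, then $L(T\cap g^{-1}(G))\subset\mathbb{R}$ has positive Lebesgue measure for every non-zero group linear map $L:\mathbb{G}\to\mathbb{R}$. In particular, the one-dimensional Hausdorff measure of $T\cap g^{-1}(G)$ with respect to $d_c$ is positive. \item If $T\subset\mathbb{G}$ is open and $T\cap g^{-1}(G)\neq\varnothing$, then $T\cap g^{-1}(G)$ is not $\sigma$-porous (with respect to $d_c$). \end{enumerate}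
   Context: A Carnot group of step $s$ is a simply connected finite-dimensional Lie group $\mathbb{G}$ whose Lie algebra decomposes as $\mathfrak{g}=V_1\oplus\cdots\oplus V_s$ with non-zero linear subspaces $V_i$, $[V_1,V_i]=V_{i+1}$ for $1\le i\le s-1$ and $[V_1,V_s]=\{0\}$, where $[V,W]=\mathrm{span}\{[X,Y]:X\in V,Y\in W\}$. Fix a basis $X_1,\dots,X_n$ of $\mathfrak{g}$ (left-invariant vector fields) adapted to the stratification, and let $m=\dim V_1$, so $X_1,\dots,X_m$ is a basis of $V_1$. The point $\exp(x_1X_1+\dots+x_nX_n)$ is identified with $(x_1,\dots,x_n)\in\mathbb{R}^n$; the identity is $0$. For $\lambda>0$ the dilation $\delta_\lambda$ is the linear map on $\mathfrak{g}$ with $\delta_\lambda(X)=\lambda^iX$ for $X\in V_i$, transferred to $\mathbb{G}$ via $\exp\circ\delta_\lambda=\delta_\lambda\circ\exp$. An absolutely continuous curve $\gamma:[a,b]\to\mathbb{G}$ is horizontal if there are $u_1,\dots,u_m\in L^1[a,b]$ with $\gamma'(t)=\sum_{i=1}^m u_i(t)X_i(\gamma(t))$ for a.e. $t$; its length is $L(\gamma)=\int_a^b|u(t)|\,dt$ (Euclidean norm of $u=(u_1,\dots,u_m)$). $d_c(x,y)$ is the infimum of lengths of horizontal curves joining $x$ to $y$; write $d_c(h)=d_c(h,0)$. A map $L:\mathbb{G}\to\mathbb{R}$ is group linear if $L(xy)=L(x)+L(y)$ and $L(\delta_r(x))=rL(x)$ for all $x,y\in\mathbb{G}$, $r>0$.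 A real-valued function $f$ defined on an open set containing $x_0$ is Pansu differentiable at $x_0$ if there is a group linear $L:\mathbb{G}\to\mathbb{R}$ with $\lim_{h\to0}\frac{f(x_0h)-f(x_0)-L(h)}{d_c(h)}=0$. For $X\in V_1$, $Xf(x)=\lim_{t\to0}\frac{f(x\exp(tX))-f(x)}{t}$ when the limit exists, and the horizontal gradient is $\nabla_Hf(x)=(X_1f(x),\dots,X_mf(x))\in\mathbb{R}^m$ when all these derivatives exist; it exists wherever $f$ is Pansu differentiable. Porosity: let $(M,d)$ be a metric space, $E\subset M$, $B(x,r)$ the open ball. For $\lambda\in(0,1)$ and $a\in E$, $E$ is $\lambda$-porous at $a$ if there is a sequence of points $x_k\in M\setminus\{a\}$ with $x_k\to a$ and $B(x_k,\lambda d(x_k,a))\cap E=\varnothing$ for every $k$. $E$ is porous at $a$ if it is $\lambda$-porous at $a$ for some $\lambda\in(0,1)$. $E$ is porous if there is $\lambda\in(0,1)$ (independent of the point) such that $E$ is $\lambda$-porous at every $a\in E$. A set is $\sigma$-porous if it is a countable union of porous sets. *)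

(* Defs.v *)
From HB Require Import structures.
From mathcomp Require Import all_boot all_order all_algebra.
From mathcomp Require Import all_classical all_reals all_analysis.
Set Implicit Arguments.
Unset Strict Implicit.
Unset Printing Implicit Defensive.
Import Order.TTheory GRing.Theory Num.Theory.
Import numFieldNormedType.Exports.
Local Open Scope classical_set_scope.
Local Open Scope ring_scope.

Section Smooth.
Context {R : realType} {V W : normedModType R}.

(* In finite dimension this is the usual class C^k. *)
Fixpoint class_C (k : nat) (f : V -> W) : Prop :=
  if k is k'.+1 then
    (forall x, differentiable f x) /\ (forall v, class_C k' (fun x => 'd f x v))
  else continuous f.

Definition smooth (f : V -> W) : Prop := forall k, class_C k f.

End Smooth.

Definition is_span (R : realType) (V : vectType R) (S : set V) (U : {vspace V})
  : Prop :=
  (forall v, S v -> v \in U) /\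
  (forall U' : {vspace V}, (forall v, S v -> v \in U') -> (U <= U')%VS).

Section LieGroupChart.
Context {R : realType} {n : nat}.
Local Notation E := 'rV[R]_n.

Definition vfield_bracket (X Y : E -> E) (x : E) : E :=
  'D_(X x) Y x - 'D_(Y x) X x.

(* Here [mul] is the product of a Lie group carried by R^n with identity 0. *)
Implicit Type mul : E -> E -> E.

Definition left_field mul (v : E) (x : E) : E := 'D_v (mul x) 0.

(* The Lie algebra of left-invariant vector fields is identified with the
   tangent space R^n at 0 through [left_field mul v] <-> [v]. *)
Definition lie_bracket mul (v w : E) : E :=
  vfield_bracket (left_field mul v) (left_field mul w) 0.

Definition bracket_set mul (V W : {vspace E}) : set E :=
  [set lie_bracket mul X Y | X in [set` V] & Y in [set` W]].

Definition layer (deg : 'I_n -> nat) (i : nat) : {vspace E} :=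
  <<[seq delta_mx 0%R j | j <- enum 'I_n & deg j == i]%SEQ>>%VS.

End LieGroupChart.

(* A Carnot group whose first layer has dimension m, in the exponential
   coordinates x <-> exp (x_1 X_1 + ... + x_n X_n) of a basis adapted to the
   stratification: the carrier is R^n (so the group is simply connected), the
   identity is 0 and X_j is the left-invariant vector field with X_j(0) = e_j.
   - [cg_exp] says that t |-> t x, whose velocity at t = 0 is x, is a
     one-parameter subgroup, i.e. that exp is the identity in these
     coordinates; in particular the inverse of x is - x.
   - [cg_deg j] is the index of the layer containing X_j, so that the direct sum
     decomposition of R^n into the layers holds by construction. *)
Record carnotGroup (R : realType) (m n : nat) := CarnotGroup {
  cg_mul : 'rV[R]_n -> 'rV[R]_n -> 'rV[R]_n ;
  cg_step : nat ;
  cg_deg : 'I_n -> nat ;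
  cg_mulA : associative cg_mul ;
  cg_mul0x : left_id 0 cg_mul ;
  cg_mulx0 : right_id 0 cg_mul ;
  cg_smooth : smooth (fun p : 'rV[R]_n * 'rV[R]_n => cg_mul p.1 p.2) ;
  cg_exp : forall (x : 'rV[R]_n) (s t : R),
    cg_mul (s *: x) (t *: x) = (s + t) *: x ;
  cg_step_gt0 : (0 < cg_step)%N ;
  cg_deg_bounds : forall j, (1 <= cg_deg j <= cg_step)%N ;
  cg_deg_homo : forall i j : 'I_n, (i <= j)%N -> (cg_deg i <= cg_deg j)%N ;
  cg_hdim_le : (m <= n)%N ;
  cg_hdim : forall j : 'I_n, (cg_deg j == 1%N) = (j < m)%N ;
  cg_layer_neq0 : forall i, (1 <= i <= cg_step)%N ->
    layer (R := R) cg_deg i != 0%VS ;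
  cg_bracket : forall i, (1 <= i < cg_step)%N ->
    is_span (bracket_set cg_mul (layer cg_deg 1) (layer cg_deg i))
            (layer cg_deg i.+1) ;
  cg_bracket_last :
    is_span (bracket_set cg_mul (layer cg_deg 1) (layer cg_deg cg_step)) 0%VS
}.

Section CarnotGeometry.
Context {R : realType} {m n : nat} (G : carnotGroup R m n).
Local Notation E := 'rV[R]_n.

Definition dilation (r : R) (x : E) : E := \row_j (r ^+ cg_deg G j * x 0 j).

(* the coordinates of X_i in the basis X_1, ..., X_n *)
Definition hbasis (i : 'I_m) : E := delta_mx 0 (widen_ord (cg_hdim_le G) i).

Definition hfield (i : 'I_m) : E -> E := left_field (cg_mul G) (hbasis i).

Definition abs_continuous (a b : R) (c : R -> E) : Prop :=
  forall e : R, 0 < e -> exists2 d : R, 0 < d &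
    forall (N : nat) (s t : 'I_N -> R),
      (forall k, a <= s k /\ s k <= t k /\ t k <= b) ->
      (forall k l, k != l -> t k <= s l \/ t l <= s k) ->
      \sum_k (t k - s k) < d -> \sum_k `|c (t k) - c (s k)| < e.

(* [u] is the control of the curve [c] on [a, b] *)
Definition horizontal (a b : R) (c : R -> E) (u : R -> 'rV[R]_m) : Prop :=
  [/\ abs_continuous a b c,
      forall i, (@lebesgue_measure R).-integrable `[a, b]
                  (fun t => (u t 0 i)%:E)
    & {ae (@lebesgue_measure R), forall t, t \in `[a, b] ->
         is_derive t (1 : R) c (\sum_i u t 0 i *: hfield i (c t))}].

Definition curve_length (a b : R) (u : R -> 'rV[R]_m) : R :=
  Rintegral (@lebesgue_measure R) `[a, b]
    (fun t => Num.sqrt (\sum_i u t 0 i ^+ 2)).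

(* The set below is nonempty by the Chow-Rashevskii theorem, so that the
   real-valued infimum carries no junk value. *)
Definition cc_dist (x y : E) : R :=
  inf [set l | exists a b c u,
    [/\ a < b, horizontal a b c u, c a = x, c b = y & l = curve_length a b u]].

Definition group_linear (L : E -> R) : Prop :=
  (forall x y, L (cg_mul G x y) = L x + L y) /\
  (forall r x, 0 < r -> L (dilation r x) = r * L x).

(* [f] is only relevant near [x0]. *)
Definition pansu_differentiable (f : E -> R) (x0 : E) : Prop :=
  exists2 L, group_linear L &
    (f (cg_mul G x0 h) - f x0 - L h) / cc_dist h 0 @[h --> (0 : E)^'] --> (0 : R).

(* Since exp is the identity in coordinates, x exp(t X) is [cg_mul G x (t *: X)].*)
Definition hderive (X : E) (f : E -> R) (x : E) : R :=
  derive1 (fun t : R => f (cg_mul G x (t *: X))) 0.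

Definition hgradient (f : E -> R) (x : E) : 'rV[R]_m :=
  \row_i hderive (hbasis i) f x.

End CarnotGeometry.

(* Notions attached to a distance function d on a type M. *)
Section MetricNotions.
Context {R : realType} {M : Type} (d : M -> M -> R).

Definition mball (x : M) (r : R) : set M := [set y | d x y < r].

Definition lporous_at (E : set M) (l : R) (a : M) : Prop :=
  exists x : nat -> M,
    [/\ forall k, x k <> a,
        d (x k) a @[k --> \oo] --> (0 : R)
      & forall k, mball (x k) (l * d (x k) a) `&` E = set0].

Definition porous_at (E : set M) (a : M) : Prop :=
  exists l : R, 0 < l < 1 /\ lporous_at E l a.

Definition porous (E : set M) : Prop :=
  exists l : R, 0 < l < 1 /\ forall a, E a -> lporous_at E l a.

Definition sigma_porous (E : set M) : Prop :=
  exists P : nat -> set M, (forall k, porous (P k)) /\ E = \bigcup_k P k.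

Local Open Scope ereal_scope.

(* 0 is added so that the diameter of the empty set is 0 *)
Definition mdiam (A : set M) : \bar R :=
  ereal_sup (0 |` [set (d x y)%:E | x in A & y in A]).

Definition hausdorff1_pre (delta : R) (A : set M) : \bar R :=
  ereal_inf [set s | exists C : nat -> set M,
    [/\ A `<=` \bigcup_k C k, forall k, mdiam (C k) <= delta%:E
      & s = \sum_(0 <= k <oo) mdiam (C k)]].

Definition hausdorff1 (A : set M) : \bar R :=
  ereal_sup [set hausdorff1_pre delta A | delta in [set e : R | (0 < e)%R]].

End MetricNotions.

(* Main.v *)
Require Import Defs.
From mathcomp Require Import all_boot all_order all_algebra.
From mathcomp Require Import all_classical all_reals all_analysis.
From mathcomp Require Import measurable_realfun ring lra.
Import Order.TTheory GRing.Theory Num.Theory.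
Import numFieldNormedType.Exports.
Local Open Scope classical_set_scope.
Local Open Scope ring_scope.

(** Every part of the theorem comes from one variational device. Let [a] be a
    point of the domain and [L] the Pansu differential of [f] at [a]. On a
    homogeneous ball of radius r around [a] the function f - L oscillates by
    o(r) only. Add to it the penalty th * r * pen (dil_(1/r) (c^-1 y)) with
    center c: it rises by th * r between the center and the boundary of its unit
    sublevel set, which beats o(r), while its horizontal derivatives are O(th) at
    every scale. So the sum has an interior minimum y; its horizontal derivatives
    vanish there, which says that the horizontal gradient of [f] at y differs from
    that at [a] by O(th) ([penalized_critical]).

    Not porous: the device is applied in a ball B(x, lam d(x,a)) with center x
    ([gradient_recurrence]), so the holes required by porosity at [a] contain
    points of the preimage.

    Image under a group linear map: the penalized function is minimized over each
    fibre of the map instead. The derivatives in the directions of its kernel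
    vanish at the minimizer, and only the derivative across the fibres, the slope,
    remains. What is left is a statement about the function h on the line whose
    values are the fibre minima: if h has an interior minimum, its slope is small on
    a set of positive measure ([denjoy]). Although h need not be differentiable, it
    is lower semicontinuous and is bounded above to first order at each point, and
    this suffices for a proof by Baire category, close to that of the Denjoy
    property of derivatives. Positive Hausdorff measure follows because horizontal
    coordinates are Lipschitz for the distance.

    Not sigma-porous: if a porous set were dense in the part of the preimage in some
    ball, that part would be porous at some of its points, which was excluded. So
    countably many porous sets can be avoided one after the other in nested balls
    ([nested_game]). As the gradient need not be continuous, the point obtained is
    kept in the preimage by controlling difference quotients, which are continuous.

    The distance enters through the comparison of its balls with the boxes
    |x_j| <= r ^ deg(j) only ([cc_dist_box], [box_cc_dist]). One half is Chow's
    theorem, proved by composing flows of horizontal fields; the other holds because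
    a short horizontal curve, once rescaled, cannot leave the unit ball. Both rely on
    the dilations being automorphisms of the group ([dilM]), whereas only the Lie
    algebra is graded by hypothesis. In exponential coordinates conjugation is linear
    and its derivative is the bracket; from this one deduces in turn that dilations
    commute with conjugation, with the Maurer-Cartan form and with the product. *)

Set Implicit Arguments.
Unset Strict Implicit.
Unset Printing Implicit Defensive.

(** * Curves and their derivatives *)

Section Curves.
Context {R : realType}.

Lemma is_derive_diff_comp (V W : normedModType R) (F : V -> W) (c : R -> V) (t : R) v :
  differentiable F (c t) -> is_derive t (1 : R) c v ->
  is_derive t (1 : R) (fun s => F (c s)) ('d F (c t) v).
Proof.
move=> dF dc.
have dc' : differentiable c t by apply/derivable1_diffP; case: dc.
have dFc : differentiable (F \o c) t by exact: differentiable_comp.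
apply: DeriveDef; first exact/derivable1_diffP.
have <- : 'd c t 1 = v by rewrite -deriveE// (@derive_val _ _ _ _ _ _ _ dc).
by rewrite (_ : (fun s => _) = F \o c)// deriveE// diff_comp.
Qed.

Lemma is_derive_pair (V W : normedModType R) (c : R -> V) (e : R -> W) (t : R) v w :
  is_derive t (1 : R) c v -> is_derive t (1 : R) e w ->
  is_derive t (1 : R) (fun s => (c s, e s)) (v, w).
Proof.
move=> dc de.
have dc' : differentiable c t by apply/derivable1_diffP; case: dc.
have de' : differentiable e t by apply/derivable1_diffP; case: de.
have dce : differentiable (fun s => (c s, e s)) t by exact: differentiable_pair.
apply: DeriveDef; first exact/derivable1_diffP.
have <- : 'd c t 1 = v by rewrite -deriveE// (@derive_val _ _ _ _ _ _ _ dc).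
have <- : 'd e t 1 = w by rewrite -deriveE// (@derive_val _ _ _ _ _ _ _ de).
by rewrite deriveE// diff_pair.
Qed.

Lemma is_derive_uniq (V : normedModType R) (c : R -> V) (t : R) v w :
  is_derive t (1 : R) c v -> is_derive t (1 : R) c w -> v = w.
Proof.
by move=> dc de; rewrite -(@derive_val _ _ _ _ _ _ _ dc) (@derive_val _ _ _ _ _ _ _ de).
Qed.

Lemma is_derive_ext (V : normedModType R) (c e : R -> V) (t : R) v :
  (forall s, c s = e s) -> is_derive t (1 : R) c v -> is_derive t (1 : R) e v.
Proof. by move=> ce; rewrite (_ : c = e)//; apply/funext. Qed.

Lemma is_derive_line (V : normedModType R) (x v : V) (t : R) :
  is_derive t (1 : R) (fun s : R => x + s *: v) v.
Proof.
have d1 : is_derive t (1 : R) (fun s : R => s *: v) v.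
  have H : is_diff t ( *:%R^~ v) ( *:%R^~ v) by exact: is_diff_scalel.
  apply: DeriveDef; first by apply/derivable1_diffP; exact: ex_diff.
  rewrite deriveE; last exact: ex_diff.
  by rewrite diff_val scale1r.
have d0 : is_derive t (1 : R) (fun _ : R => x) 0 by exact: is_derive_cst.
have := @is_deriveD _ _ _ _ _ _ _ _ _ d0 d1; rewrite add0r.
by apply: is_derive_ext => s.
Qed.

Lemma is_derive_scale (V : normedModType R) (v : V) (t : R) :
  is_derive t (1 : R) (fun s : R => s *: v) v.
Proof.
by have := is_derive_line 0 v t; apply: is_derive_ext => s; rewrite add0r.
Qed.

Lemma is_derive_affine (V : normedModType R) (c : R -> V) (a b t : R) v :
  is_derive (a + b * t) (1 : R) c v -> is_derive t (1 : R) (fun s => c (a + b * s)) (b *: v).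
Proof.
move=> dc.
have dl : is_derive t (1 : R) (fun s : R => a + b * s) b.
  have := is_derive_line a b t.
  by apply: is_derive_ext => s; rewrite /GRing.scale /= mulrC.
have dc' : differentiable c (a + b * t) by apply/derivable1_diffP; case: dc.
have := @is_derive_diff_comp _ _ c (fun s => a + b * s) t _ dc' dl.
suff -> : 'd c (a + b * t) b = b *: v by [].
have -> : 'd c (a + b * t) b = b *: 'd c (a + b * t) 1.
  by rewrite -linearZ /GRing.scale/= mulr1.
by rewrite -deriveE// (@derive_val _ _ _ _ _ _ _ dc).
Qed.

Lemma is_derive_coord n (c : R -> 'rV[R]_n) (t : R) (v : 'rV[R]_n) j :
  is_derive t (1 : R) c v -> is_derive t (1 : R) (fun s => c s 0 j) (v 0 j).
Proof.
move=> dc; have [dc1 dc2] := dc.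
have := derive_mx dc1; rewrite dc2 => ->; rewrite mxE.
by apply: derivableP; move/derivable_mxP : dc1; apply.
Qed.

Lemma coord_is_derive n (c : R -> 'rV[R]_n) (t : R) (v : 'rV[R]_n) :
  (forall j, is_derive t (1 : R) (fun s => c s 0 j) (v 0 j)) ->
  is_derive t (1 : R) c v.
Proof.
move=> dc.
have dc1 : derivable c t 1.
  by apply/derivable_mxP => i j; rewrite ord1; case: (dc j).
apply: DeriveDef => //; rewrite derive_mx//; apply/rowP => j; rewrite mxE.
exact: derive_val.
Qed.

Lemma zero_derive_cst n (c : R -> 'rV[R]_n) :
  (forall t, is_derive t (1 : R) c 0) -> forall s t, c s = c t.
Proof.
move=> dc s t; apply/rowP => j.
apply: (@is_derive_0_is_cst _ (fun s => c s 0 j)) => x.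
by have := is_derive_coord j (dc x); rewrite mxE.
Qed.

Lemma is_derive_cvg (V : normedModType R) (c : R -> V) (t : R) v :
  is_derive t (1 : R) c v ->
  (fun s : R => s^-1 *: (c (t + s) - c t)) @ (0 : R)^' --> v.
Proof.
move=> -[dc1 dc2]; rewrite -dc2.
have -> : (fun s : R => s^-1 *: (c (t + s) - c t)) = (fun h : R => h^-1 *: ((c \o shift t) (h *: (1 : R)) - c t)); last exact: dc1.
by apply/funext => h /=; rewrite [h%:A]mulr1 [t + h]addrC.
Qed.

End Curves.

(** * Linear maps between spaces of row vectors *)

Section LinearFunctions.
Context {R : realType} {V W : lmodType R} (f : V -> W) (lf : linear f).

Lemma linear_fun0 : f 0 = 0.
Proof. by have := lf (-1) 0 0; rewrite scaler0 addr0 scaleN1r addNr. Qed.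

Lemma linear_funD u v : f (u + v) = f u + f v.
Proof. by have := lf 1 u v; rewrite !scale1r. Qed.

Lemma linear_funZ a u : f (a *: u) = a *: f u.
Proof. by have := lf a u 0; rewrite linear_fun0 !addr0. Qed.

Lemma linear_funN u : f (- u) = - f u.
Proof. by rewrite -scaleN1r linear_funZ scaleN1r. Qed.

Lemma linear_funB u v : f (u - v) = f u - f v.
Proof. by rewrite linear_funD linear_funN. Qed.

Lemma linear_fun_sum (I : Type) (r : seq I) (P : pred I) (F : I -> V) :
  f (\sum_(i <- r | P i) F i) = \sum_(i <- r | P i) f (F i).
Proof. exact: (big_morph f linear_funD linear_fun0). Qed.

End LinearFunctions.

Section LinearCurves.
Context {R : realType} {n : nat}.
Local Notation E := 'rV[R]_n.

Lemma linear_row_sum k (f : E -> 'rV[R]_k) (v : E) : linear f ->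
  f v = \sum_j v 0 j *: f (delta_mx 0 j).
Proof.
move=> lf; rewrite {1}(row_sum_delta v) (linear_fun_sum lf).
by apply: eq_bigr => j _; rewrite (linear_funZ lf).
Qed.

Lemma linear_fun_continuous k (f : E -> 'rV[R]_k) : linear f -> continuous f.
Proof.
move=> lf x; apply: differentiable_continuous.
have -> : f = \sum_(j < n) (fun v : E => v 0 j *: f (delta_mx 0 j)).
  by apply/funext => v; rewrite (linear_row_sum v lf) fct_sumE.
apply: differentiable_sum => j; apply: differentiableZl.
exact: differentiable_coord.
Qed.

Lemma coord_le_norm (v : E) j : `|v 0 j| <= `|v|.
Proof.
rewrite [leRHS]/Num.norm/= mx_normrE.
exact: (le_bigmax _ (fun ij : 'I_1 * 'I_n => `|v ij.1 ij.2|) (0, j)).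
Qed.

Lemma norm_le_coord (v : E) M : 0 <= M -> (forall j, `|v 0 j| <= M) -> `|v| <= M.
Proof.
move=> M0 H; rewrite [leLHS]/Num.norm/= mx_normrE; apply: bigmax_le => // -[i j] _ /=.
by rewrite ord1.
Qed.

Lemma linear_fun_bound k (f : E -> 'rV[R]_k) v : linear f ->
  `|f v| <= (\sum_j `|f (delta_mx 0 j)|) * `|v|.
Proof.
move=> lf; rewrite {1}(linear_row_sum v lf) mulr_suml.
apply: le_trans (ler_norm_sum _ _ _) _; apply: ler_sum => j _.
by rewrite normrZ mulrC ler_wpM2l// coord_le_norm.
Qed.

Lemma open_norm_ball (V : normedModType R) (U : set V) a : open U -> U a ->
  exists2 e : R, 0 < e & forall v, `|v - a| < e -> U v.
Proof.
move=> oU Ua; have /nbhs_ballP[e e0 eP] := open_nbhs_nbhs (conj oU Ua).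
by exists e => // v ve; apply: eP; rewrite -ball_normE /ball_/= distrC.
Qed.

Lemma ge_cvg_seq (u : R^nat) (a l : R) : u @ \oo --> l -> (forall k, a <= u k) -> a <= l.
Proof.
move=> ul au; rewrite -(cvg_lim _ ul)//; apply: limr_ge.
  by apply/cvg_ex; exists l.
exact: nearW.
Qed.

(** The product rule for B_s (e_s) with B_s linear: derivability of s |-> B_s is
    only known vector by vector, so the formula is reduced to the finitely many
    scalar products of coordinates of e with images of the standard basis. *)
Lemma is_derive_lin (B : R -> E -> E) (b : E -> E) (e : R -> E) (t : R) (w : E) :
  (forall s, linear (B s)) ->
  (forall v, is_derive t (1 : R) (B^~ v) (b v)) ->
  is_derive t (1 : R) e w ->
  is_derive t (1 : R) (fun s => B s (e s)) (b (e t) + B t w).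
Proof.
move=> Blin dB de.
have gen (e1 : R -> E) (w1 : E) : is_derive t (1 : R) e1 w1 ->
  is_derive t (1 : R) (fun s => B s (e1 s))
    (\sum_j (e1 t 0 j *: b (delta_mx 0 j)) + B t w1).
  move=> de1; apply: coord_is_derive => i.
  have dS : is_derive t (1 : R)
     (\sum_(j < n) ((fun s => e1 s 0 j) * (fun s => B s (delta_mx 0 j) 0 i)))
     (\sum_(j < n) (e1 t 0 j *: (b (delta_mx 0 j) 0 i) +
                   B t (delta_mx 0 j) 0 i *: w1 0 j)).
    apply: is_derive_sum => j; apply: is_deriveM; first exact: is_derive_coord.
    by have := is_derive_coord i (dB (delta_mx 0 j)).
  have -> : (\sum_j e1 t 0 j *: b (delta_mx 0 j) + B t w1) 0 i =
     \sum_(j < n) (e1 t 0 j *: (b (delta_mx 0 j) 0 i) +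
                   B t (delta_mx 0 j) 0 i *: w1 0 j).
    rewrite mxE big_split/= !summxE; congr (_ + _).
      by apply: eq_bigr => j _; rewrite mxE.
    rewrite (linear_row_sum w1 (Blin t)) summxE.
    by apply: eq_bigr => j _; rewrite mxE mulrC.
  apply: is_derive_ext dS => s.
  rewrite fct_sumE (linear_row_sum (e1 s) (Blin s)) summxE.
  by apply: eq_bigr => j _; rewrite mxE.
have <- : \sum_j (e t 0 j *: b (delta_mx 0 j)) = b (e t).
  apply: is_derive_uniq (dB (e t)).
  have := gen (cst (e t)) 0 (is_derive_cst _ _ _).
  by rewrite (linear_fun0 (Blin t)) addr0.
exact: gen.
Qed.

Lemma is_derive_linear (f : E -> E) (e : R -> E) (t : R) (w : E) :
  linear f -> is_derive t (1 : R) e w ->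
  is_derive t (1 : R) (fun s => f (e s)) (f w).
Proof.
move=> lf de.
have := @is_derive_lin (fun=> f) (fun=> 0) e t w (fun=> lf).
rewrite add0r; apply => // v; exact: is_derive_cst.
Qed.

(** The velocity at 0 is a limit of k c(1/k). When k c(1/k) does not depend on k
    this identifies it, which is how additivity of a smooth map is turned into
    linearity below. *)
Lemma harmonic_cvg (V : normedModType R) (c : R -> V) (v : V) :
  c 0 = 0 -> is_derive (0 : R) (1 : R) c v ->
  (fun k : nat => k.+1%:R *: c (k.+1%:R^-1)) @ \oo --> v.
Proof.
move=> c0 /is_derive_cvg dc.
have H : (fun k : nat => (k.+1%:R^-1 : R)) @ \oo --> (0 : R)^'.
  move=> U /= [e /= e0 He]; have := @cvg_harmonic R.
  move/cvgrPdist_lt => /(_ _ e0); apply: filterS => k /= Hk.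
  by apply: He => //=; rewrite invr_eq0 pnatr_eq0.
have := cvg_comp _ _ H dc.
apply: cvg_trans; apply: near_eq_cvg; near=> k => /=.
by rewrite invrK add0r c0 subr0.
Unshelve. all: by end_near. Qed.

Lemma harmonic_eq (c : R -> E) (w v : E) :
  c 0 = 0 -> is_derive (0 : R) (1 : R) c v ->
  (forall k : nat, k.+1%:R *: c (k.+1%:R^-1) = w) -> w = v.
Proof.
move=> c0 dc cw; have := harmonic_cvg c0 dc.
under eq_fun do rewrite cw.
by move/cvg_lim => <- //; rewrite lim_cst.
Qed.

(** Turns a predicate stable under linear combinations into a subspace, so that
    inductions over spans can be run on arbitrary propositions. *)
Lemma linear_set_vspace (P : E -> Prop) : P 0 ->
  (forall a u v, P u -> P v -> P (a *: u + v)) ->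
  exists U : {vspace E}, forall v, v \in U <-> P v.
Proof.
move=> P0 PD.
pose good k := `[< exists U : {vspace E}, \dim U = k /\ forall v, v \in U -> P v >].
have g0 : exists k, good k.
  by exists 0%N; apply/asboolP; exists 0%VS; rewrite dimv0; split => // v;
    rewrite memv0 => /eqP ->.
have gb k : good k -> (k <= dim E)%N.
  by move=> /asboolP[U [<- _]]; rewrite -dimvf; apply: dimvS; exact: subvf.
case: (ex_maxnP g0 gb) => k /asboolP[U [Uk UP]] kmax.
exists U => v; split; first exact: UP.
move=> Pv; apply/negPn/negP => vU.
have : good (\dim (U + <[v]>)%VS).
  apply/asboolP; exists (U + <[v]>)%VS; split=> // w /memv_addP[u uU [x /vlineP[a ->] ->]].
  by rewrite addrC; apply: PD => //; exact: UP.
move/kmax; rewrite -Uk leqNgt => /negP; apply.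
rewrite (ltn_leqif (dimv_leqif_sup (addvSl U <[v]>))).
apply/negP => /subvP /(_ v) H; move/negP: vU; apply; apply: H.
by apply: (subvP (addvSr U <[v]>)); exact: memv_line.
Qed.

End LinearCurves.

(** * Calculus on the group in exponential coordinates *)

Section GroupCalculus.
Context {R : realType} {m n : nat} (G : carnotGroup R m n).
Local Notation E := 'rV[R]_n.
Local Notation "x ** y" := (cg_mul G x y) (at level 40, left associativity).

Fact dmul_key : unit. Proof. by []. Qed.
(** Locked, so that the differential is only handled through its equations and never
    unfolded by unification. *)
Definition dmul (x y u v : E) : E :=
  locked_with dmul_key
    (fun x y u v => 'd (fun p : E * E => p.1 ** p.2) (x, y) (u, v)) x y u v.

Lemma dmulE x y u v : dmul x y u v = 'd (fun p : E * E => p.1 ** p.2) (x, y) (u, v).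
Proof. by rewrite /dmul unlock. Qed.

(** The value at x of the left-invariant field equal to v at the identity. *)
Definition ltrans (x v : E) : E := dmul x 0 0 v.
Definition gconj (x v : E) : E := x ** v ** (- x).

Lemma mul_differentiable (p : E * E) : differentiable (fun p : E * E => p.1 ** p.2) p.
Proof. by have [H _] := @cg_smooth _ _ _ G 1%N; exact: H. Qed.

Lemma dmul_differentiable (u v : E) (p : E * E) :
  differentiable (fun p : E * E => dmul p.1 p.2 u v) p.
Proof.
have [_ H] := @cg_smooth _ _ _ G 2%N; have [H1 _] := H (u, v).
have -> : (fun p : E * E => dmul p.1 p.2 u v) =
  (fun x : E * E => 'd (fun p : E * E => p.1 ** p.2) x (u, v)).
  by apply/funext => -[x y]; rewrite dmulE.
exact: H1.
Qed.

Lemma is_derive_mul (c e : R -> E) (t : R) (v w : E) :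
  is_derive t (1 : R) c v -> is_derive t (1 : R) e w ->
  is_derive t (1 : R) (fun s => c s ** e s) (dmul (c t) (e t) v w).
Proof.
move=> dc de; have dce := is_derive_pair dc de.
by rewrite dmulE; have := is_derive_diff_comp (mul_differentiable (c t, e t)) dce.
Qed.

Lemma dmul_linear x y a u u' v v' :
  dmul x y (a *: u + u') (a *: v + v') = a *: dmul x y u v + dmul x y u' v'.
Proof. by rewrite !dmulE -linearP. Qed.

Lemma dmul_split x y u v : dmul x y u v = dmul x y u 0 + dmul x y 0 v.
Proof. by have := dmul_linear x y 1 u 0 0 v; rewrite !scale1r addr0 add0r. Qed.

Lemma gmulx0 x : x ** 0 = x. Proof. exact: cg_mulx0. Qed.
Lemma gmul0x x : 0 ** x = x. Proof. exact: cg_mul0x. Qed.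
Lemma gmulA x y z : x ** (y ** z) = x ** y ** z. Proof. exact: cg_mulA. Qed.

Lemma gmulxN x : x ** (- x) = 0.
Proof. by have := cg_exp G x 1 (-1); rewrite scale1r scaleN1r subrr scale0r. Qed.
Lemma gmulNx x : (- x) ** x = 0.
Proof. by rewrite -{2}(opprK x) gmulxN. Qed.
Lemma gmulxK x y : x ** ((- x) ** y) = y. Proof. by rewrite gmulA gmulxN gmul0x. Qed.
Lemma gmulKr x y : y ** x ** (- x) = y. Proof. by rewrite -gmulA gmulxN gmulx0. Qed.
Lemma gmulNr x y : y ** (- x) ** x = y. Proof. by rewrite -gmulA gmulNx gmulx0. Qed.

Lemma oppM x y : - (x ** y) = (- y) ** (- x).
Proof.
rewrite -[RHS]gmul0x -(gmulNx (x ** y)) -[in RHS]gmulA.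
by rewrite -(gmulA x) gmulxK gmulxN gmulx0.
Qed.

Lemma exp_add (x : E) (s t : R) : (s *: x) ** (t *: x) = (s + t) *: x.
Proof. exact: cg_exp. Qed.

(** The product being x on the slice y = 0, its partial differential there is the
    identity; together with [dmul0x] this makes the product tangent to the
    addition at the identity. *)
Lemma dmulx0 x u : dmul x 0 u 0 = u.
Proof.
have := is_derive_mul (is_derive_line x u 0) (is_derive_cst (0 : E) (0 : R) 1).
rewrite scale0r addr0 /cst => H; apply: is_derive_uniq H _.
by apply: is_derive_ext (is_derive_line x u 0) => s; rewrite gmulx0.
Qed.

Lemma dmul0x x u : dmul 0 x 0 u = u.
Proof.
have := is_derive_mul (is_derive_cst (0 : E) (0 : R) 1) (is_derive_line x u 0).
rewrite scale0r addr0 /cst => H; apply: is_derive_uniq H _.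
by apply: is_derive_ext (is_derive_line x u 0) => s; rewrite gmul0x.
Qed.

Lemma ltrans0 v : ltrans 0 v = v. Proof. exact: dmul0x. Qed.

Lemma dmul00 u v : dmul 0 0 u v = u + v.
Proof. by rewrite dmul_split dmulx0 dmul0x. Qed.

Lemma ltrans_linear x : linear (ltrans x).
Proof. by move=> a u v; rewrite /ltrans -dmul_linear scaler0 addr0. Qed.

Lemma is_derive_ltrans x v : is_derive (0 : R) (1 : R) (fun s : R => x ** (s *: v)) (ltrans x v).
Proof.
have := is_derive_mul (is_derive_cst x (0 : R) 1) (is_derive_scale v 0).
by rewrite scale0r.
Qed.

Lemma left_fieldE x v : left_field (cg_mul G) v x = ltrans x v.
Proof.
have /is_derive_cvg H := is_derive_ltrans x v.
rewrite /left_field /derive; apply/cvg_lim => //.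
apply: cvg_trans H; apply: near_eq_cvg; near=> s.
by rewrite /= add0r scale0r addr0.
Unshelve. all: by end_near. Qed.

(** Left-invariance, obtained by differentiating x (y exp(s v)) = (x y) exp(s v). *)
Lemma dmul_ltrans x y v : dmul x y 0 (ltrans y v) = ltrans (x ** y) v.
Proof.
have H := is_derive_mul (is_derive_cst x (0 : R) 1) (is_derive_ltrans y v).
rewrite scale0r gmulx0 /cst in H.
apply: is_derive_uniq H _.
by apply: is_derive_ext (is_derive_ltrans (x ** y) v) => s; rewrite gmulA.
Qed.

Lemma is_derive_exp x v t : is_derive t (1 : R) (fun s : R => x ** (s *: v)) (ltrans (x ** (t *: v)) v).
Proof.
have H := is_derive_ltrans (x ** (t *: v)) v.
have H' : is_derive (- t + 1 * t) (1 : R) (fun s : R => x ** (t *: v) ** (s *: v)) (ltrans (x ** (t *: v)) v).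
  by rewrite mul1r addNr.
have := is_derive_affine H'; rewrite scale1r.
by apply: is_derive_ext => s; rewrite -gmulA exp_add mul1r addrA subrr add0r.
Qed.

(** Left-invariant fields are radial along their own one-parameter subgroup. This
    makes the bilinear map [dltrans] alternating, see [dltrans_diag]. *)
Lemma ltrans_exp x (s : R) : ltrans (s *: x) x = x.
Proof.
apply: is_derive_uniq (is_derive_ltrans (s *: x) x) _.
by apply: is_derive_ext (is_derive_line (s *: x) x 0) => t; rewrite exp_add scalerDl.
Qed.

Lemma gconj1 v : gconj 0 v = v. Proof. by rewrite /gconj gmul0x oppr0 gmulx0. Qed.
Lemma gconj0 x : gconj x 0 = 0. Proof. by rewrite /gconj gmulx0 gmulxN. Qed.
Lemma gconjM x v w : gconj x (v ** w) = gconj x v ** gconj x w.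
Proof. by rewrite /gconj !gmulA gmulNr. Qed.
Lemma gconj_mul x y v : gconj (x ** y) v = gconj x (gconj y v).
Proof. by rewrite /gconj oppM !gmulA. Qed.
Lemma gconj_comm x v : x ** v = gconj x v ** x.
Proof. by rewrite /gconj gmulNr. Qed.

Lemma is_derive_gconj x (c : R -> E) (t : R) v : is_derive t (1 : R) c v ->
  is_derive t (1 : R) (fun s => gconj x (c s))
    (dmul (x ** c t) (- x) (dmul x (c t) 0 v) 0).
Proof.
move=> dc.
have := is_derive_mul (is_derive_mul (is_derive_cst x t 1) dc) (is_derive_cst (- x) t 1).
by [].
Qed.

Lemma gconj_natmul x v (k : nat) : gconj x (k%:R *: v) = k%:R *: gconj x v.
Proof.
elim: k => [|k IH]; first by rewrite !scale0r gconj0.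
by rewrite -natr1 -!exp_add gconjM IH !scale1r.
Qed.

(** Conjugation commutes with multiplication by integers, because k v is the k-th
    power of v in exponential coordinates; hence it coincides with its own
    differential at 0. In these coordinates conjugation by x is therefore the
    adjoint map Ad_x. *)
Lemma gconjE x v : gconj x v = dmul x (- x) (ltrans x v) 0.
Proof.
have := is_derive_gconj x (is_derive_scale v 0); rewrite scale0r gmulx0 => H.
apply: (harmonic_eq _ H); first by rewrite scale0r gconj0.
move=> k; rewrite -gconj_natmul scalerA divff ?scale1r// pnatr_eq0.
Qed.

Lemma gconj_linear x : linear (gconj x).
Proof.
move=> a u v; rewrite !gconjE (ltrans_linear x a u v).
have := dmul_linear x (- x) a (ltrans x u) (ltrans x v) 0 0.
by rewrite scaler0 addr0.
Qed.

Lemma gconjZ x a v : gconj x (a *: v) = a *: gconj x v.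
Proof. exact: (linear_funZ (gconj_linear x)). Qed.

(** Inverting y exp(s w) = exp(s Ad_y w) y, where inversion is y |-> - y, compares
    left-invariant fields at y and at - y. *)
Lemma ltrans_gconj y w : ltrans y w = ltrans (- y) (gconj y w).
Proof.
apply: is_derive_uniq (is_derive_ltrans y w) _.
have lN : linear (-%R : E -> E) by move=> a u v; rewrite opprD scalerN.
have := is_derive_linear lN (is_derive_ltrans (- y) (- gconj y w)).
rewrite (linear_funN (ltrans_linear (- y))) opprK.
apply: is_derive_ext => s.
by rewrite oppM opprK scalerN opprK -gconjZ -gconj_comm.
Qed.

End GroupCalculus.

(** * The Lie bracket and its grading *)

Section Bracket.
Context {R : realType} {m n : nat} (G : carnotGroup R m n).
Local Notation E := 'rV[R]_n.
Local Notation "x ** y" := (cg_mul G x y) (at level 40, left associativity).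
Local Notation ltrans := (ltrans G).
Local Notation gconj := (gconj G).
Local Notation dmul := (dmul G).

Lemma ltrans_differentiable (w x : E) : differentiable (ltrans^~ w) x.
Proof.
have -> : ltrans^~ w = (fun p : E * E => dmul p.1 p.2 0 w) \o (fun x => (x, 0)).
  by apply/funext.
apply: differentiable_comp; last exact: dmul_differentiable.
by apply: differentiable_pair.
Qed.

(** The mixed second derivative of the product at the identity. *)
Definition dltrans (v w : E) : E := 'd (ltrans^~ w) 0 v.

Lemma is_derive_dltrans v w :
  is_derive (0 : R) (1 : R) (fun s : R => ltrans (s *: v) w) (dltrans v w).
Proof.
have /= := @is_derive_diff_comp _ _ _ (ltrans^~ w) (fun s : R => s *: v) 0 v.
rewrite scale0r; apply; first exact: ltrans_differentiable.
exact: is_derive_scale.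
Qed.

Lemma dltrans_linl w : linear (dltrans^~ w).
Proof. by move=> a u v; rewrite /dltrans linearP. Qed.

Lemma dltrans_linr v : linear (dltrans v).
Proof.
move=> a u w; apply: is_derive_uniq (is_derive_dltrans v _) _.
have := @is_deriveD _ _ _ _ _ _ _ _ _ (@is_deriveZ _ _ _ _ a _ _ _ (is_derive_dltrans v u)) (is_derive_dltrans v w).
by apply: is_derive_ext => s; rewrite ltrans_linear.
Qed.

Lemma dltrans_diag x : dltrans x x = 0.
Proof.
apply: is_derive_uniq (is_derive_dltrans x x) _.
have := is_derive_cst x (0 : R) 1.
by apply: is_derive_ext => s; rewrite ltrans_exp.
Qed.

(** Polarization of [dltrans_diag]. *)
Lemma dltrans_anti v w : dltrans w v = - dltrans v w.
Proof.
have := dltrans_diag (v + w).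
rewrite (linear_funD (dltrans_linr _)) !(linear_funD (dltrans_linl _)).
rewrite !dltrans_diag add0r addr0 => /eqP; rewrite addr_eq0 => /eqP e.
exact: e.
Qed.

Fact br_key : unit. Proof. by []. Qed.
(** Locked for the same reason as [dmul]. *)
Definition br (v w : E) : E := locked_with br_key (lie_bracket (cg_mul G)) v w.

Lemma br_lie_bracket v w : br v w = lie_bracket (cg_mul G) v w.
Proof. by rewrite /br unlock. Qed.

Lemma brE v w : br v w = dltrans v w + dltrans v w.
Proof.
have dE (a b : E) : 'D_(left_field (cg_mul G) a 0) (left_field (cg_mul G) b) 0 = dltrans a b.
  rewrite (_ : left_field (cg_mul G) b = ltrans^~ b); last first.
    by apply/funext => x; exact: left_fieldE.
  by rewrite left_fieldE ltrans0 deriveE//; exact: ltrans_differentiable.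
by rewrite br_lie_bracket /lie_bracket /vfield_bracket !dE (dltrans_anti v w) opprK.
Qed.

Lemma br_linr v : linear (br v).
Proof.
move=> a u w; rewrite !brE (dltrans_linr v a u w) scalerDr.
by rewrite [LHS]addrACA.
Qed.

Lemma br_linl w : linear (br^~ w).
Proof.
move=> a u v; rewrite /= !brE (dltrans_linl w a u v) scalerDr.
by rewrite [LHS]addrACA.
Qed.

(** The bracket is the derivative of Ad. Writing B for [dltrans], the derivative at
    s = 0 of the identity [ltrans_gconj] along y = s v reads
    B(v, w) = - B(v, w) + d/ds Ad_(s v) w, and the bracket is 2 B(v, w). *)
Lemma is_derive_gconj0 v w :
  is_derive (0 : R) (1 : R) (fun s : R => gconj (s *: v) w) (br v w).
Proof.
have [z dz] : exists z, is_derive (0 : R) (1 : R) (fun s : R => gconj (s *: v) w) z.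
  have dN : is_derive (0 : R) (1 : R) (fun s : R => - (s *: v)) (- v).
    have := is_derive_scale (- v) 0.
    by apply: is_derive_ext => s; rewrite scalerN.
  have := is_derive_mul G (is_derive_mul G (is_derive_scale v 0) (is_derive_cst w (0:R) 1)) dN.
  by move=> H; eexists; exact: H.
suff -> : br v w = z by [].
have dA u : is_derive (0 : R) (1 : R) (fun s => ltrans (- (s *: v)) u) (- dltrans v u).
  have := is_derive_dltrans (- v) u.
  rewrite (linear_funN (dltrans_linl u)).
  by apply: is_derive_ext => s; rewrite scalerN.
have := is_derive_lin (fun s => ltrans_linear G _) dA dz.
rewrite scale0r oppr0 ltrans0 gconj1 => H.
have /(is_derive_uniq (is_derive_dltrans v w)) : is_derive (0 : R) (1 : R) (fun s : R => ltrans (s *: v) w) (- dltrans v w + z).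
  by apply: is_derive_ext H => s; rewrite -ltrans_gconj.
by move=> /eqP; rewrite eq_sym addrC subr_eq => /eqP ->; rewrite brE.
Qed.

Lemma is_derive_gconjl x w t :
  is_derive t (1 : R) (fun s : R => gconj (s *: x) w) (br x (gconj (t *: x) w)).
Proof.
have H' : is_derive (- t + 1 * t) (1 : R) (fun s : R => gconj (s *: x) (gconj (t *: x) w)) (br x (gconj (t *: x) w)).
  by rewrite mul1r addNr; exact: is_derive_gconj0.
have := is_derive_affine H'; rewrite scale1r.
by apply: is_derive_ext => s; rewrite -gconj_mul exp_add mul1r addrAC addNr add0r.
Qed.

Lemma is_derive_gconjr x w t :
  is_derive t (1 : R) (fun s : R => gconj (s *: x) w) (gconj (t *: x) (br x w)).
Proof.
have H' : is_derive (- t + 1 * t) (1 : R) (fun s : R => gconj (t *: x) (gconj (s *: x) w)) (gconj (t *: x) (br x w)).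
  rewrite mul1r addNr; apply: is_derive_linear; first exact: gconj_linear.
  exact: is_derive_gconj0.
have := is_derive_affine H'; rewrite scale1r.
by apply: is_derive_ext => s; rewrite -gconj_mul exp_add mul1r addrA subrr add0r.
Qed.

(** Ad_g is a homomorphism because Ad_g Ad_(s v) = Ad_(s Ad_g v) Ad_g. *)
Lemma gconj_br g v w : gconj g (br v w) = br (gconj g v) (gconj g w).
Proof.
have := is_derive_linear (gconj_linear G g) (is_derive_gconj0 v w).
move/is_derive_uniq; apply.
have := is_derive_gconj0 (gconj g v) (gconj g w).
by apply: is_derive_ext => s; rewrite -gconjZ -!gconj_mul -gconj_comm.
Qed.

(** The derivative at 0 of s |-> Ad_(s u) (br v w), computed in two ways by means of
    [gconj_br]. *)
Lemma jacobi u v w : br u (br v w) = br (br u v) w + br v (br u w).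
Proof.
apply: is_derive_uniq (is_derive_gconj0 u (br v w)) _.
have H w' : is_derive (0 : R) (1 : R) (fun s => br (gconj (s *: u) v) w') (br (br u v) w').
  exact: is_derive_linear (br_linl w') (is_derive_gconj0 u v).
have := is_derive_lin (fun s => br_linr (gconj (s *: u) v)) H (is_derive_gconj0 u w).
rewrite scale0r !gconj1.
by apply: is_derive_ext => s; rewrite gconj_br.
Qed.

End Bracket.

Section Grading.
Context {R : realType} {m n : nat} (G : carnotGroup R m n).
Local Notation E := 'rV[R]_n.
Local Notation "x ** y" := (cg_mul G x y) (at level 40, left associativity).
Local Notation br := (br G).
Local Notation dil := (dilation G).

Lemma dil_linear r : linear (dil r).
Proof. by move=> a u v; apply/rowP => j; rewrite !mxE; ring. Qed.

Lemma dil_comp r s x : dil r (dil s x) = dil (r * s) x.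
Proof. by apply/rowP => j; rewrite !mxE exprMn mulrA. Qed.

Lemma dil1 x : dil 1 x = x.
Proof. by apply/rowP => j; rewrite !mxE expr1n mul1r. Qed.

Lemma dilK r x : r != 0 -> dil r (dil r^-1 x) = x.
Proof. by move=> r0; rewrite dil_comp mulfV// dil1. Qed.

Lemma dilVK r x : r != 0 -> dil r^-1 (dil r x) = x.
Proof. by move=> r0; rewrite dil_comp mulVf// dil1. Qed.

Lemma layer_delta (j : 'I_n) : (delta_mx 0 j : E) \in layer (R := R) (cg_deg G) (cg_deg G j).
Proof.
rewrite /layer; apply: memv_span; apply/mapP; exists j => //.
by rewrite mem_filter eqxx mem_enum.
Qed.

Lemma layer_sub (U : {vspace E}) i :
  (forall j, cg_deg G j = i -> delta_mx 0 j \in U) -> (layer (R := R) (cg_deg G) i <= U)%VS.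
Proof.
move=> H; apply/span_subvP => v /mapP[j].
by rewrite mem_filter => /andP[/eqP ji _] ->; exact: H.
Qed.

Lemma dil_layer r i (v : E) : v \in layer (R := R) (cg_deg G) i -> dil r v = r ^+ i *: v.
Proof.
move=> vi.
have [|a u w Pu Pw|U HU] := @linear_set_vspace R n (fun v => dil r v = r ^+ i *: v).
- by rewrite scaler0 (linear_fun0 (dil_linear r)).
- by rewrite (dil_linear r a u w) Pu Pw scalerDr !scalerA mulrC.
apply/HU; apply: subvP vi; apply: layer_sub => j ji; apply/HU.
by apply/rowP => k; rewrite !mxE eqxx/=; have [->|] := eqVneq k j; rewrite ?ji ?mulr0//.
Qed.

(** The first layer generates the Lie algebra, as an induction principle for
    propositions stable under linear combinations. *)
Lemma stratified_ind (P : E -> Prop) : P 0 ->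
  (forall a u v, P u -> P v -> P (a *: u + v)) ->
  (forall v, v \in layer (R := R) (cg_deg G) 1 -> P v) ->
  (forall X v, X \in layer (R := R) (cg_deg G) 1 -> P v -> P (br X v)) ->
  forall v, P v.
Proof.
move=> P0 PD P1 Pbr v.
have [U HU] := linear_set_vspace P0 PD.
have Pl i : (1 <= i.+1 <= cg_step G)%N -> (layer (R := R) (cg_deg G) i.+1 <= U)%VS.
  elim: i => [_|i IH /andP[_ h]].
    by apply/subvP => w /P1 /HU.
  have [|_ Hs] := @cg_bracket _ _ _ G i.+1; first by rewrite h.
  apply: Hs => w [X XV [Y YV <-]]; apply/HU; rewrite -br_lie_bracket; apply: Pbr => //.
  by apply/HU; apply: subvP YV; apply: IH; apply/andP; split => //; exact: ltnW.
rewrite (row_sum_delta v); apply/HU; apply: memv_suml => j _; apply: memvZ.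
have /andP[h1 h2] := cg_deg_bounds G j.
apply: (subvP _ _ (layer_delta j)); rewrite -(prednK h1); apply: Pl.
by rewrite prednK // h1.
Qed.

(** On the layer V_i, the bracket with V_1 lands in V_(i+1), or is zero on the last
    layer. *)
Lemma dil_br_layer r X v : X \in layer (R := R) (cg_deg G) 1 ->
  dil r (br X v) = br (dil r X) (dil r v).
Proof.
move=> X1; rewrite (dil_layer r X1) expr1.
rewrite (row_sum_delta v) (linear_fun_sum (br_linr G X)) !(linear_fun_sum (dil_linear r)).
rewrite (linear_fun_sum (br_linr G _)); apply: eq_bigr => j _.
rewrite !(linear_funZ (br_linr G _)) !(linear_funZ (dil_linear r)) (dil_layer r (layer_delta j)).
rewrite !(linear_funZ (br_linr G _)) (linear_funZ (br_linl G _)); congr (_ *: _).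
rewrite scalerA -exprSr.
have /andP[h1 h2] := cg_deg_bounds G j.
have [lt|ge] := ltnP (cg_deg G j) (cg_step G).
  have [|Hb _] := @cg_bracket _ _ _ G (cg_deg G j); first by rewrite h1 lt.
  apply: dil_layer; apply: Hb; rewrite br_lie_bracket; exists X => //.
  by exists (delta_mx 0 j) => //; exact: layer_delta.
have e : cg_deg G j = cg_step G by apply/eqP; rewrite eqn_leq h2 ge.
have [Hb _] := @cg_bracket_last _ _ _ G.
suff -> : br X (delta_mx 0 j) = 0 by rewrite scaler0 (linear_fun0 (dil_linear r)).
apply/eqP; rewrite -memv0; apply: Hb; rewrite br_lie_bracket; exists X => //.
by exists (delta_mx 0 j) => //; rewrite -e; exact: layer_delta.
Qed.

(** By the Jacobi identity, the vectors v for which the dilation is compatible with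
    ad v form a subalgebra, and it contains V_1 by [dil_br_layer]. *)
Lemma dil_br r v w : dil r (br v w) = br (dil r v) (dil r w).
Proof.
move: v w; apply: stratified_ind.
- move=> w; rewrite (linear_fun0 (dil_linear r)).
  by rewrite !(linear_fun0 (br_linl G _)) (linear_fun0 (dil_linear r)).
- move=> a u v Hu Hv w.
  have e1 := br_linl G w a u v.
  have e2 := br_linl G (dil r w) a (dil r u) (dil r v).
  have e3 := dil_linear r a (br u w) (br v w).
  rewrite /= in e1 e2.
  by rewrite e1 e3 (Hu w) (Hv w) (dil_linear r a u v) e2.
- by move=> X X1 w; exact: dil_br_layer.
move=> X v X1 Hv w.
have HX w' := dil_br_layer r w' X1.
have jac a b c : br (br a b) c = br a (br b c) - br b (br a c).
  by rewrite jacobi addrK.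
have e2 := linear_funB (dil_linear r) (br X (br v w)) (br v (br X w)).
by rewrite (HX v) (jac X v w) e2 (HX (br v w)) (Hv (br X w)) (HX w) (Hv w) -jac.
Qed.

End Grading.

(** * Dilations are group automorphisms *)

Section Automorphism.
Context {R : realType} {m n : nat} (G : carnotGroup R m n).
Local Notation E := 'rV[R]_n.
Local Notation "x ** y" := (cg_mul G x y) (at level 40, left associativity).
Local Notation ltrans := (ltrans G).
Local Notation gconj := (gconj G).
Local Notation dmul := (dmul G).
Local Notation br := (br G).
Local Notation dil := (dilation G).

Lemma dil0 r : dil r 0 = 0.
Proof. exact: (linear_fun0 (dil_linear G r)). Qed.
Lemma dilD r x y : dil r (x + y) = dil r x + dil r y.
Proof. exact: (linear_funD (dil_linear G r)). Qed.
Lemma dilZ r a x : dil r (a *: x) = a *: dil r x.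
Proof. exact: (linear_funZ (dil_linear G r)). Qed.
Lemma dilN r x : dil r (- x) = - dil r x.
Proof. exact: (linear_funN (dil_linear G r)). Qed.
Lemma dilB r x y : dil r (x - y) = dil r x - dil r y.
Proof. exact: (linear_funB (dil_linear G r)). Qed.

Lemma expS (x : E) (k : nat) : k.+1%:R *: x = (k%:R *: x) ** x.
Proof. by rewrite -{3}(scale1r x) exp_add natr1. Qed.

(** Both t |-> Ad_(t x) w and t |-> dil^-1 Ad_(t dil x) dil w solve the linear
    equation z' = [x, z], because dilations preserve the bracket. The two curves
    have the same initial value; applying Ad_(- t x) to the second one gives a
    constant curve. *)
Lemma gconj_dil r x w : r != 0 -> gconj (dil r x) (dil r w) = dil r (gconj x w).
Proof.
move=> r0.
pose z (t : R) := dil r^-1 (gconj (t *: dil r x) (dil r w)).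
have dz t : is_derive t (1 : R) z (br x (z t)).
  have := is_derive_linear (dil_linear G r^-1) (is_derive_gconjl G (dil r x) (dil r w) t).
  by rewrite dil_br dilVK.
have dM t : is_derive t (1 : R) (fun s => gconj (- (s *: x)) (z s)) 0.
  have dB v : is_derive t (1 : R) (fun s => gconj (- (s *: x)) v) (- gconj (- (t *: x)) (br x v)).
    have H := is_derive_gconjr G (- x) v t.
    rewrite (linear_funN (br_linl G v) x) (linear_funN (gconj_linear G _)) scalerN in H.
    by apply: is_derive_ext H => s; rewrite scalerN.
  have := is_derive_lin (fun s => gconj_linear G (- (s *: x))) dB (dz t).
  by rewrite addNr.
have := zero_derive_cst dM 1 0.
rewrite /z !scale0r !scale1r oppr0 !gconj1 dilVK// => H.
have := congr1 (gconj x) H.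
rewrite -gconj_mul gmulxN gconj1 => /(congr1 (dil r)).
by rewrite dilK.
Qed.

(** The left Maurer-Cartan form, inverse to [ltrans]. *)
Definition mcform (x w : E) : E := dmul (- x) x 0 w.

Lemma mcform_ltrans x v : mcform x (ltrans x v) = v.
Proof. by rewrite /mcform dmul_ltrans gmulNx ltrans0. Qed.

Lemma is_derive_mcform x w :
  is_derive (0 : R) (1 : R) (fun s : R => (- x) ** (x + s *: w)) (mcform x w).
Proof.
have := is_derive_mul G (is_derive_cst (- x) (0 : R) 1) (is_derive_line x w 0).
by rewrite scale0r addr0 /cst.
Qed.

Lemma ltrans_mcform x w : ltrans x (mcform x w) = w.
Proof.
have H := is_derive_mul G (is_derive_cst x (0 : R) 1) (is_derive_mcform x w).
rewrite scale0r addr0 gmulNx /cst in H.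
apply: is_derive_uniq H _.
by apply: is_derive_ext (is_derive_line x w 0) => s; rewrite gmulxK.
Qed.

Lemma mcform_linear x : linear (mcform x).
Proof. by move=> a u v; rewrite /mcform -dmul_linear scaler0 addr0. Qed.

(** Differentiate (k + 1)(x + s w) = k (x + s w) ** (x + s w) at s = 0. *)
Lemma mcformS x w (k : nat) : k.+1%:R *: mcform (k.+1%:R *: x) w =
  gconj (- x) (k%:R *: mcform (k%:R *: x) w) + mcform x w.
Proof.
rewrite -!(linear_funZ (mcform_linear _)).
pose c (s : R) := (- (k%:R *: x)) ** (k%:R *: (x + s *: w)).
have dc : is_derive (0 : R) (1 : R) c (mcform (k%:R *: x) (k%:R *: w)).
  have := is_derive_mcform (k%:R *: x) (k%:R *: w).
  by apply: is_derive_ext => s; rewrite /c scalerDr scalerA mulrC -scalerA.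
have dcc := is_derive_linear (gconj_linear G (- x)) dc.
have H := is_derive_mul G dcc (is_derive_mcform x w).
rewrite /c scale0r addr0 !gmulNx gconj0 dmul00 in H.
apply: is_derive_uniq _ H.
have := is_derive_mcform (k.+1%:R *: x) (k.+1%:R *: w).
apply: is_derive_ext => s.
have -> : k.+1%:R *: x + s *: (k.+1%:R *: w) = (k%:R *: (x + s *: w)) ** (x + s *: w).
  rewrite -expS scalerDr; congr (_ + _).
  by rewrite !scalerA mulrC.
have -> : - (k.+1%:R *: x) = (- x) ** (- (k%:R *: x)).
  rewrite -oppM; congr (- _).
  exact: expS.
by rewrite /gconj opprK !gmulA gmulKr.
Qed.

Lemma mcform_sum x w (k : nat) : k%:R *: mcform (k%:R *: x) w =
  \sum_(i < k) gconj (- (i%:R *: x)) (mcform x w).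
Proof.
elim: k => [|k IH]; first by rewrite big_ord0 scale0r.
rewrite mcformS IH big_ord_recl/= scale0r oppr0 gconj1 addrC; congr (_ + _).
rewrite (linear_fun_sum (gconj_linear G _)); apply: eq_bigr => i _.
rewrite -gconj_mul; congr gconj.
rewrite /bump add1n -oppM; congr (- _).
by rewrite expS.
Qed.

Lemma mcform_continuous w : continuous (mcform^~ w).
Proof.
have -> : mcform^~ w = (fun p : E * E => dmul p.1 p.2 0 w) \o (fun x => (- x, x)).
  by apply/funext.
move=> x; apply: continuous_comp.
  apply: differentiable_continuous; apply: differentiable_pair => //.
by apply: differentiable_continuous; exact: dmul_differentiable.
Qed.

Lemma mcform0 w : mcform 0 w = w.
Proof. by rewrite /mcform oppr0 dmul00 add0r. Qed.

Lemma continuous_segment_bounded (f : R -> R) : continuous f ->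
  exists M, forall t, 0 <= t <= 1 -> `|f t| <= M.
Proof.
move=> cf.
have [c _ H] := @EVT_max R (fun t => `|f t|) 0 1 ler01 (continuous_subspaceT (fun t => @continuous_comp _ _ _ f (fun x => `|x|) t (cf t) (@norm_continuous _ _ _))).
by exists (`|f c|) => t t01; apply: H; rewrite in_itv.
Qed.

Lemma is_derive_continuous (V : normedModType R) (c : R -> V) (t : R) v :
  is_derive t (1 : R) c v -> {for t, continuous c}.
Proof. by case=> /derivable1_diffP dc _; exact: differentiable_continuous. Qed.

(** Each Ad_(- t y) is bounded, and the bound is uniform by compactness of [0, 1]. *)
Lemma gconj_bounded (y : E) : exists M, forall t, 0 <= t <= 1 ->
  forall z, `|gconj (- (t *: y)) z| <= M * `|z|.
Proof.
have H (j : 'I_n) : exists M, forall t : R, 0 <= t <= 1 ->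
    `| `|gconj (- (t *: y)) (delta_mx 0 j)| | <= M.
  apply: continuous_segment_bounded => t; apply: cvg_norm.
  rewrite (_ : (fun t : R => _) = (fun t : R => gconj (t *: - y) (delta_mx 0 j))).
    rewrite -scalerN; exact: is_derive_continuous (is_derive_gconjl G (- y) (delta_mx 0 j) t).
  by apply/funext => s; rewrite scalerN.
have [M HM] := choice H.
exists (\sum_j M j) => t t01 z.
apply: le_trans (linear_fun_bound z (gconj_linear G _)) _.
rewrite ler_wpM2r//; apply: ler_sum => j _.
by apply: le_trans (HM j t t01); rewrite normr_id.
Qed.

(** The difference Delta of the two sides satisfies the same relation [mcform_sum],
    so that |Delta x| <= M |Delta (x / k)| for all k, with M a bound of Ad along
    the segment from 0 to - x. As Delta is continuous and vanishes at 0, it is zero. *)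
Lemma mcform_dil r x w : r != 0 -> mcform (dil r x) (dil r w) = dil r (mcform x w).
Proof.
move=> r0.
pose Delta y := dil r^-1 (mcform (dil r y) (dil r w)) - mcform y w.
have Dsum y (k : nat) : k%:R *: Delta (k%:R *: y) =
    \sum_(i < k) gconj (- (i%:R *: y)) (Delta y).
  rewrite /Delta scalerBr mcform_sum -dilZ (dilZ r) mcform_sum.
  rewrite (linear_fun_sum (dil_linear G _)) -sumrB; apply: eq_bigr => i _.
  rewrite (linear_funB (gconj_linear G _)); congr (_ - _).
  by rewrite -dilZ -dilN -[X in gconj _ X](dilK G _ r0) gconj_dil// dilVK.
have D0 : Delta 0 = 0 by rewrite /Delta dil0 !mcform0 dilVK// subrr.
have cD : Delta y @[y --> (0 : E)] --> Delta 0.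
  apply: (@cvgB _ _ _ (nbhs (0 : E)) (nbhs_filter (0 : E)) (fun y => dil r^-1 (mcform (dil r y) (dil r w))) (mcform^~ w)); last exact: mcform_continuous.
  apply: (@continuous_cvg _ _ _ _ (nbhs_filter (0 : E)) (fun y => mcform (dil r y) (dil r w)) (dil r^-1)).
    exact/linear_fun_continuous/dil_linear.
  apply: (@continuous_cvg _ _ _ _ (nbhs_filter (0 : E)) (dil r) (mcform^~ (dil r w))).
    exact: mcform_continuous.
  exact/linear_fun_continuous/dil_linear.
have [M HM] := gconj_bounded x.
have bound (k : nat) : `|Delta x| <= M * `|Delta (k.+1%:R^-1 *: x)|.
  have k0 : (k.+1%:R : R) != 0 by rewrite pnatr_eq0.
  have kp : (0 : R) < k.+1%:R by rewrite ltr0n.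
  have := Dsum (k.+1%:R^-1 *: x) k.+1.
  rewrite scalerA mulfV// scale1r => /(congr1 (fun z => `|z|)).
  rewrite normrZ ger0_norm ?ler0n// => e.
  rewrite -(ler_pM2l kp) e.
  apply: le_trans (ler_norm_sum _ _ _) _.
  set X := M * _.
  have -> : k.+1%:R * X = \sum_(i < k.+1) X by rewrite sumr_const card_ord mulr_natl.
  apply: ler_sum => i _; rewrite scalerA; apply: HM.
  by rewrite divr_ge0//= ler_pdivrMr// mul1r ler_nat ltnW.
suff : Delta x = 0 by move/eqP; rewrite subr_eq0 => /eqP <-; rewrite dilK.
apply/eqP; rewrite -normr_le0; apply: (ge_cvg_seq _ bound).
rewrite -[X in _ --> X](mulr0 M); apply: cvgMl_tmp.
have : Delta (k.+1%:R^-1 *: x) @[k --> \oo] --> Delta 0.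
  apply: (@continuous_cvg _ _ _ _ _ (fun k : nat => k.+1%:R^-1 *: x) Delta 0) => //.
  rewrite -[X in _ --> X](scale0r x).
  by apply: (@cvgZr_tmp _ _ _ _ _ (fun k : nat => k.+1%:R^-1 : R)); exact: cvg_harmonic.
by rewrite D0 => /cvg_norm; rewrite normr0.
Qed.

Lemma ltrans_dil r x v : r != 0 -> ltrans (dil r x) (dil r v) = dil r (ltrans x v).
Proof.
move=> r0; rewrite -{1}(mcform_ltrans x v) -mcform_dil//.
exact: ltrans_mcform.
Qed.

(** The grading of the Lie algebra integrates to the group: along t |-> x ** t y the
    quantity dil (x ** t y) ** (- t dil y) has zero derivative by [ltrans_dil]. *)
Lemma dilM r x y : r != 0 -> dil r (x ** y) = dil r x ** dil r y.
Proof.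
move=> r0.
pose c (t : R) := dil r (x ** (t *: y)) ** (- (t *: dil r y)).
have dc t : is_derive t (1 : R) c 0.
  set p := dil r (x ** (t *: y)); set v := dil r y.
  have d1 : is_derive t (1 : R) (fun s : R => dil r (x ** (s *: y))) (ltrans p v).
    have := is_derive_linear (dil_linear G r) (is_derive_exp G x y t).
    by rewrite -ltrans_dil.
  have dN (z : E) u : is_derive u (1 : R) (fun s : R => - (z + s *: v)) (- v).
    have := is_derive_line (- z) (- v) u.
    by apply: is_derive_ext => s; rewrite opprD scalerN.
  have d2 : is_derive t (1 : R) (fun s : R => - (s *: v)) (- v).
    by have := dN 0 t; apply: is_derive_ext => s; rewrite add0r.
  have := is_derive_mul G d1 d2.
  suff -> : dmul p (- (t *: v)) (ltrans p v) (- v) = 0 by [].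
  have H := is_derive_mul G (is_derive_ltrans G p v) (dN (t *: v) 0).
  rewrite scale0r gmulx0 addr0 in H.
  apply: is_derive_uniq H _.
  apply: is_derive_ext (is_derive_cst (p ** (- (t *: v))) (0 : R) 1) => s.
  have -> : - (t *: v + s *: v) = (- (t + s)) *: v by rewrite scaleNr scalerDl.
  by rewrite -gmulA exp_add -scaleNr opprD addrCA subrr addr0.
have := zero_derive_cst dc 1 0.
rewrite /c !scale1r !scale0r oppr0 !gmulx0 => /(congr1 (fun z => z ** dil r y)).
by rewrite gmulNr.
Qed.

End Automorphism.

(** * Strict differentiability and local surjectivity *)

Section MeanValue.
Context {R : realType} {n : nat}.
Local Notation E := 'rV[R]_n.

Lemma mean_value_ineq (c d : R -> E) (M : R) :
  (forall t, is_derive t (1 : R) c (d t)) ->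
  (forall t, 0 <= t <= 1 -> `|d t| <= M) -> `|c 1 - c 0| <= M.
Proof.
move=> dc dM.
have M0 : 0 <= M by apply: le_trans (dM 0 _) => //; rewrite lexx ler01.
apply: norm_le_coord => // j.
have [x x01 e] := @MVT_segment R (fun t => c t 0 j) (fun t => d t 0 j) 0 1 ler01
  (fun x _ => is_derive_coord j (dc x))
  (continuous_subspaceT (fun x => is_derive_continuous (is_derive_coord j (dc x)))).
rewrite !mxE e subr0 mulr1; apply: le_trans (coord_le_norm _ _) _.
by apply: dM; move: x01; rewrite in_itv.
Qed.

Definition cball (r : R) : set E := [set x | `|x| <= r].

Lemma cball_compact r : compact (cball r).
Proof.
apply: bounded_closed_compact.
  exists r; split; first exact: num_real.
  by move=> x rx y /= yr; apply: le_trans yr (ltW rx).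
rewrite (_ : cball r = (fun x => `|x|) @^-1` [set t | t <= r]) //.
apply: preimage_closed; last exact: closed_le.
by move=> x _; exact: norm_continuous.
Qed.

(** Used for partial differentials of the product, which are continuous in the base
    point for fixed directions. *)
Lemma closedball_bounded (f : E * E -> R) r : continuous f ->
  exists M, forall x y, `|x| <= r -> `|y| <= r -> `|f (x, y)| <= M.
Proof.
move=> cf.
have : compact (f @` (cball r `*` cball r)).
  apply: continuous_compact; first exact: continuous_subspaceT.
  by apply: compact_setX; exact: cball_compact.
move/compact_bounded => [M [_ HM]]; exists (M + 1) => x y xr yr.
by apply: (HM (M + 1)); rewrite ?ltrDl//; exists (x, y).
Qed.

Lemma lipschitz_within_continuous (A : set E) (f : E -> R) K : 0 < K ->
  (forall z z', A z -> A z' -> `|f z - f z'| <= K * `|z - z'|) ->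
  {within A, continuous f}.
Proof.
move=> K0 H; apply/subspace_continuousP => x Ax; apply/cvgrPdist_lt => e e0.
have eK : 0 < e / K by rewrite divr_gt0.
rewrite near_withinE; near=> t => At.
apply: le_lt_trans (H _ _ Ax At) _; rewrite -ltr_pdivlMl// mulrC.
by near: t; apply: cvgr_dist_lt.
Unshelve. all: by end_near. Qed.

(** Strict differentiability at 0, with differential L: the hypothesis of the inverse
    function theorem that survives products of several factors without any
    control of second derivatives. *)
Definition strict_at0 (P L : E -> E) := forall e : R, 0 < e ->
  exists2 d : R, 0 < d & forall z z', `|z| < d -> `|z'| < d ->
    `|P z - P z' - L (z - z')| <= e * `|z - z'|.

(** A minimizer of |z - g z| over a ball stable under the contraction
    g z = z - P z + x is a fixed point of g, hence a solution of P z = x. *)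
Lemma strict_local_surj (P : E -> E) : P 0 = 0 -> strict_at0 P id ->
  exists r k : R, [/\ 0 < r, 0 < k & forall x, `|x| <= k -> exists2 z, `|z| <= r & P z = x].
Proof.
move=> P0 sP; have [d d0 Hd] := sP 2^-1 (ltac:(by rewrite invr_gt0)).
have r0 : 0 < d / 2 by rewrite divr_gt0.
exists (d / 2), (d / 4); split; [by []| by rewrite divr_gt0|].
move=> x xk.
have H z z' : `|z| <= d / 2 -> `|z'| <= d / 2 -> `|P z - P z' - (z - z')| <= 2^-1 * `|z - z'|.
  by move=> h h'; apply: Hd; [apply: le_lt_trans h _|apply: le_lt_trans h' _]; lra.
pose g z := z - P z + x.
have gH z z' : `|z| <= d / 2 -> `|z'| <= d / 2 -> `|g z - g z'| <= 2^-1 * `|z - z'|.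
  move=> h h'; apply: le_trans (H _ _ h h').
  suff -> : g z - g z' = - (P z - P z' - (z - z')) by rewrite normrN.
  by apply/rowP => j; rewrite /g !mxE; ring.
have gB z : `|z| <= d / 2 -> `|g z| <= d / 2.
  move=> h; have h0 : `|0 : E| <= d / 2 by rewrite normr0 ltW.
  have := gH _ _ h h0; rewrite subr0 /g P0 subr0 add0r => h1.
  rewrite -[X in `|X|](subrK x); apply: le_trans (ler_normD _ _) _.
  by apply: le_trans (lerD h1 xk) _; lra.
have [z /set_mem zb zmin] : exists2 c, c \in cball (d / 2) &
    forall t, t \in cball (d / 2) -> `|c - g c| <= `|t - g t|.
  apply: EVT_min_rV; first by exists 0; rewrite /cball/= normr0 ltW.
    exact: cball_compact.
  apply: (@lipschitz_within_continuous _ _ 2) => // z z' zb zb'.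
  apply: le_trans (ler_dist_dist _ _) _.
  have -> : z - g z - (z' - g z') = (z - z') - (g z - g z').
    by apply/rowP => j; rewrite !mxE; ring.
  apply: le_trans (ler_normB _ _) _.
  by move: (gH _ _ zb zb'); have := normr_ge0 (z - z'); lra.
exists z => //.
have h1 := zmin _ (mem_set (gB z zb)).
have h2 := gH _ _ zb (gB _ zb).
have : `|z - g z| = 0.
  apply/eqP; rewrite eq_le normr_ge0 andbT; move: (le_trans h1 h2); lra.
move/normr0_eq0/rowP => e; apply/rowP => j; move: (e j).
by rewrite /g !mxE; lra.
Qed.

End MeanValue.

Section StrictProduct.
Context {R : realType} {m n : nat} (G : carnotGroup R m n).
Local Notation E := 'rV[R]_n.
Local Notation "x ** y" := (cg_mul G x y) (at level 40, left associativity).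
Local Notation dmul := (dmul G).

Lemma dmul_continuous u v : continuous (fun p : E * E => dmul p.1 p.2 u v).
Proof. by move=> p; apply: differentiable_continuous; exact: dmul_differentiable. Qed.

Lemma dmul_linl x y : linear (fun u => dmul x y u 0).
Proof. by move=> a u v; rewrite -dmul_linear scaler0 addr0. Qed.

Lemma dmul_linr x y : linear (dmul x y 0).
Proof. by move=> a u v; rewrite -dmul_linear scaler0 addr0. Qed.

Lemma is_derive_mul_segment x u y v t :
  is_derive t (1 : R) (fun s : R => (x + s *: u) ** (y + s *: v))
    (dmul (x + t *: u) (y + t *: v) u v).
Proof. exact: is_derive_mul (is_derive_line x u t) (is_derive_line y v t). Qed.

Lemma segment_norm (x x' : E) (r t : R) : 0 <= t <= 1 -> `|x| <= r -> `|x'| <= r ->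
  `|x' + t *: (x - x')| <= r.
Proof.
move=> /andP[t0 t1] xr xr'.
have -> : x' + t *: (x - x') = (1 - t) *: x' + t *: x.
  by apply/rowP => j; rewrite !mxE; ring.
apply: le_trans (ler_normD _ _) _; rewrite !normrZ (ger0_norm t0) ger0_norm ?subr_ge0//.
have := ler_wpM2l t0 xr; have := ler_wpM2l (_ : 0 <= 1 - t) xr'.
by rewrite subr_ge0 => /(_ t1); lra.
Qed.

(** Mean value inequality along the segment from (x', y') to (x, y). *)
Lemma mul_lipschitz (r : R) : exists2 K : R, 0 < K & forall x y x' y',
  `|x| <= r -> `|y| <= r -> `|x'| <= r -> `|y'| <= r ->
  `|x ** y - x' ** y'| <= K * (`|x - x'| + `|y - y'|).
Proof.
have HB (j : 'I_n) (b : bool) : exists M, forall x y : E, `|x| <= r -> `|y| <= r ->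
    `| `|dmul x y (if b then delta_mx 0 j else 0) (if b then 0 else delta_mx 0 j)| | <= M.
  apply: (closedball_bounded (f := fun p => `|dmul p.1 p.2 _ _|)) => p.
  by apply: cvg_norm; exact: dmul_continuous.
have [M1 H1] := choice (fun j => HB j true).
have [M2 H2] := choice (fun j => HB j false).
set S := \sum_j (`|M1 j| + `|M2 j|).
have S0 : 0 <= S by apply: sumr_ge0 => j _; rewrite addr_ge0.
exists (S + 1); first by rewrite ltr_wpDl.
move=> x y x' y' xr yr xr' yr'.
have := @mean_value_ineq R n (fun s => (x' + s *: (x - x')) ** (y' + s *: (y - y'))) _
  ((S + 1) * (`|x - x'| + `|y - y'|)) (is_derive_mul_segment x' (x - x') y' (y - y')).
rewrite !scale1r !scale0r !addr0 !(addrC x') !(addrC y') !subrK; apply => t t01.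
have pr := segment_norm t01 xr xr'; have qr := segment_norm t01 yr yr'.
rewrite dmul_split; apply: le_trans (ler_normD _ _) _.
rewrite mulrDr; apply: lerD.
  apply: le_trans (linear_fun_bound _ (dmul_linl _ _)) _; rewrite ler_wpM2r//.
  rewrite ler_wpDr//; apply: ler_sum => j _; rewrite ler_wpDr//.
  by apply: le_trans (ler_norm _); have := H1 j _ _ pr qr; rewrite normr_id.
apply: le_trans (linear_fun_bound _ (dmul_linr _ _)) _; rewrite ler_wpM2r//.
rewrite ler_wpDr//; apply: ler_sum => j _; rewrite ler_wpDl//.
by apply: le_trans (ler_norm _); have := H2 j _ _ pr qr; rewrite normr_id.
Qed.

(** The product is strictly differentiable at the identity, with differential the
    addition. *)
Lemma mul_strict (e : R) : 0 < e -> exists2 d : R, 0 < d & forall x y x' y',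
  `|x| < d -> `|y| < d -> `|x'| < d -> `|y'| < d ->
  `|x ** y - x' ** y' - (x - x' + (y - y'))| <= e * (`|x - x'| + `|y - y'|).
Proof.
move=> e0; have n0 : (0 : R) < n%:R + 1 by rewrite ltr_wpDl.
pose e' := e / (n%:R + 1).
have e'0 : 0 < e' by rewrite divr_gt0.
have HB (u v : E) : exists d : R, 0 < d /\ forall x y : E, `|x| < d -> `|y| < d ->
    `|dmul x y u v - (u + v)| <= e'.
  have := @dmul_continuous u v (0, 0) => /cvgrPdist_lt /(_ _ e'0) /=.
  rewrite dmul00 => /nbhs_normP [d d0 Hd]; exists d; split => // x y xd yd.
  rewrite distrC; apply/ltW/(Hd (x, y)).
  rewrite /= /ball_/= sub0r normrN.
  by rewrite prod_normE gt_max xd yd.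
have [d1 H1] := choice (fun j : 'I_n => HB (delta_mx 0 j) 0).
have [d2 H2] := choice (fun j : 'I_n => HB 0 (delta_mx 0 j)).
exists (\big[Num.min/1]_j Num.min (d1 j) (d2 j)).
  rewrite lt_bigmin// => j _.
  by rewrite lt_min (H1 j).1 (H2 j).1.
set d := \big[_/_]_j _ => x y x' y' xd yd xd' yd'.
have [dd1 dd2] : (forall j, d <= d1 j) /\ (forall j, d <= d2 j).
  by split=> j; apply: le_trans (bigmin_le _ j (fun j => Num.min (d1 j) (d2 j))) _;
    rewrite ge_min lexx ?orbT.
pose c (s : R) := (x' + s *: (x - x')) ** (y' + s *: (y - y')) - s *: (x - x' + (y - y')).
have dc t : is_derive t (1 : R) c
    (dmul (x' + t *: (x - x')) (y' + t *: (y - y')) (x - x') (y - y') - (x - x' + (y - y'))).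
  by apply: is_deriveB; [exact: is_derive_mul_segment|exact: is_derive_scale].
have <- : c 1 - c 0 = x ** y - x' ** y' - (x - x' + (y - y')).
  rewrite /c !scale1r !scale0r !addr0 subr0 !(addrC x') !(addrC y') !subrK.
  by rewrite addrAC.
apply: (mean_value_ineq dc) => t t01.
have seg (z z' : E) : `|z| < d -> `|z'| < d -> `|z' + t *: (z - z')| < d.
  move=> zd zd'; apply: le_lt_trans (_ : Num.max `|z| `|z'| < d); last by rewrite gt_max zd.
  by apply: segment_norm; rewrite // le_max lexx ?orbT.
have pd := seg _ _ xd xd'; have qd := seg _ _ yd yd'.
set p := x' + _ in pd *; set q := y' + _ in qd *; set u := x - x'; set v := y - y'.
have lsub (f : E -> E) : linear f -> linear (fun z => f z - z).
  by move=> lf a z z'; rewrite (lf a z z') scalerBr addrACA -opprD.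
have bnd (f : E -> E) w : linear f ->
    (forall j, `|f (delta_mx 0 j) - delta_mx 0 j| <= e') -> `|f w - w| <= e * `|w|.
  move=> lf fe; apply: le_trans (linear_fun_bound w (lsub f lf)) _.
  rewrite ler_wpM2r//; apply: le_trans (_ : \sum_(j < n) e' <= _).
    exact: ler_sum.
  rewrite sumr_const card_ord -[_ *+ n]mulr_natr /e' mulrAC ler_pdivrMr//.
  by rewrite ler_wpM2l ?(ltW e0)// lerDl.
have -> : dmul p q u v - (u + v) = (dmul p q u 0 - u) + (dmul p q 0 v - v).
  by rewrite dmul_split opprD addrACA.
apply: le_trans (ler_normD _ _) _; rewrite mulrDr; apply: lerD.
  apply: (bnd _ u (dmul_linl p q)) => j.
  rewrite -{2}[delta_mx 0 j]addr0; apply: (H1 j).2; exact: lt_le_trans (dd1 j).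
apply: (bnd _ v (dmul_linr p q)) => j.
rewrite -{2}[delta_mx 0 j]add0r; apply: (H2 j).2; exact: lt_le_trans (dd2 j).
Qed.

Lemma strict_mul (P L f : E -> E) : P 0 = 0 -> linear L -> strict_at0 P L -> linear f ->
  strict_at0 (fun z => f z ** P z) (fun z => f z + L z).
Proof.
move=> P0 lL sP lf e e0.
pose CL := \sum_j `|L (delta_mx 0 j)|; pose Cf := \sum_j `|f (delta_mx 0 j)|.
have CL0 : 0 <= CL by apply: sumr_ge0.
have Cf0 : 0 <= Cf by apply: sumr_ge0.
have HL z : `|L z| <= CL * `|z| by exact: linear_fun_bound.
have Hf z : `|f z| <= Cf * `|z| by exact: linear_fun_bound.
pose K := CL + Cf + 1 + 1.
have K0 : 0 < K by rewrite /K; lra.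
have [d1 d10 H1] := sP (Num.min 1 (e / 2)) (ltac:(rewrite lt_min ltr01/=; lra)).
have [d2 d20 H2] := @mul_strict (e / 2 / K) (ltac:(rewrite divr_gt0//; lra)).
have lipP z z' : `|z| < d1 -> `|z'| < d1 -> `|P z - P z'| <= (CL + 1) * `|z - z'|.
  move=> zd zd'; rewrite -[P z - P z'](subrK (L (z - z'))).
  apply: le_trans (ler_normD _ _) _; rewrite mulrDl mul1r addrC; apply: lerD => //.
  apply: le_trans (H1 _ _ zd zd') _; rewrite -[leRHS]mul1r ler_wpM2r//.
  by rewrite ge_min lexx.
exists (Num.min d1 (d2 / K)); first by rewrite lt_min d10 divr_gt0.
move=> z z'; rewrite !lt_min => /andP[zd1 zd2] /andP[zd1' zd2'].
have fz w : `|w| < d2 / K -> `|f w| < d2.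
  move=> wd; apply: le_lt_trans (Hf w) _; move: wd; rewrite ltr_pdivlMr// => wd.
  apply: le_lt_trans wd; rewrite mulrC ler_wpM2l// /K; lra.
have Pz w : `|w| < d1 -> `|w| < d2 / K -> `|P w| < d2.
  move=> wd1 wd; have := lipP w 0 wd1; rewrite normr0 P0 !subr0 => /(_ d10) h.
  apply: le_lt_trans h _; move: wd; rewrite ltr_pdivlMr// => wd.
  apply: le_lt_trans wd; rewrite mulrC ler_wpM2l// /K; lra.
have := H2 (f z) (P z) (f z') (P z') (fz _ zd2) (Pz _ zd1 zd2) (fz _ zd2') (Pz _ zd1' zd2').
set D := `|z - z'|; move=> h2.
have -> : f z ** P z - f z' ** P z' - (f (z - z') + L (z - z')) =
  (f z ** P z - f z' ** P z' - (f z - f z' + (P z - P z'))) + (P z - P z' - L (z - z')).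
  rewrite (linear_funB lf); apply/rowP => j; rewrite !mxE; ring.
apply: le_trans (ler_normD _ _) _.
have -> : e * D = e / 2 * D + e / 2 * D by field.
apply: lerD; last first.
  apply: le_trans (H1 _ _ zd1 zd1') _; rewrite ler_wpM2r//.
  by rewrite ge_min lexx orbT.
apply: le_trans h2 _; rewrite -mulrA ler_wpM2l//; first lra.
rewrite ler_pdivrMl//.
have h3 := lipP z z' zd1 zd1'; have h4 := Hf (z - z').
rewrite (linear_funB lf) -/D in h3 h4.
have D0 : 0 <= D by exact: normr_ge0.
by rewrite /K !mulrDl !mul1r in h3 h4 *; lra.
Qed.

End StrictProduct.

(** * Chow's theorem in quantitative form *)

Section Chow.
Context {R : realType} {m n : nat} (G : carnotGroup R m n).
Local Notation E := 'rV[R]_n.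
Local Notation "x ** y" := (cg_mul G x y) (at level 40, left associativity).
Local Notation gconj := (gconj G).
Local Notation br := (br G).
Local Notation dil := (dilation G).
Local Notation hb := (hbasis G).

(** The word [:: (i_1, t_1); ...] stands for exp (t_1 X_{i_1}) exp (t_2 X_{i_2}) ...,
    the end point of the curve from 0 that follows the field X_{i_1} for the time
    t_1, then X_{i_2} for the time t_2, and so on. *)
Definition wprod (w : seq ('I_m * R)) : E :=
  foldr (fun p x => (p.2 *: hb p.1) ** x) 0 w.

Definition wlen (w : seq ('I_m * R)) : R := \sum_(p <- w) `|p.2|.

Lemma wprod_cat w1 w2 : wprod (w1 ++ w2) = wprod w1 ** wprod w2.
Proof. by elim: w1 => [|p w1 IH] /=; rewrite ?gmul0x// IH gmulA. Qed.

Lemma wlen_cat w1 w2 : wlen (w1 ++ w2) = wlen w1 + wlen w2.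
Proof. by rewrite /wlen big_cat. Qed.

Lemma wlen_ge0 w : 0 <= wlen w. Proof. by apply: sumr_ge0. Qed.

Lemma wprod1 i t : wprod [:: (i, t)] = t *: hb i.
Proof. by rewrite /= gmulx0. Qed.

Lemma wlen1 i t : wlen [:: (i, t)] = `|t|.
Proof. by rewrite /wlen big_seq1. Qed.

Definition winv (w : seq ('I_m * R)) := rev [seq (p.1, - p.2) | p <- w].

Lemma wprod_inv w : wprod (winv w) = - wprod w.
Proof.
elim: w => [|p w IH]; first by rewrite /= oppr0.
by rewrite /winv /= rev_cons -cats1 wprod_cat wprod1 oppM -/(winv w) IH /= scaleNr.
Qed.

Lemma wlen_inv w : wlen (winv w) = wlen w.
Proof.
rewrite /wlen (perm_big [seq (p.1, - p.2) | p <- w]); last by rewrite perm_rev.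
by rewrite big_map; apply: eq_bigr => p _; rewrite normrN.
Qed.

Definition wdil (r : R) (w : seq ('I_m * R)) := [seq (p.1, r * p.2) | p <- w].

Lemma dil_hbasis r i : dil r (hb i) = r *: hb i.
Proof.
have := @cg_hdim _ _ _ G (widen_ord (cg_hdim_le G) i); rewrite /= ltn_ord => /eqP d1.
by have := dil_layer r (layer_delta (R := R) G (widen_ord (cg_hdim_le G) i)); rewrite d1 expr1.
Qed.

Lemma wprod_dil r w : r != 0 -> wprod (wdil r w) = dil r (wprod w).
Proof.
move=> r0; elim: w => [|p w IH] /=; first by rewrite dil0.
by rewrite IH dilM// dilZ dil_hbasis scalerA mulrC.
Qed.

Lemma wlen_dil r w : wlen (wdil r w) = `|r| * wlen w.
Proof.
by rewrite /wlen big_map mulr_sumr; apply: eq_bigr => p _; rewrite normrM.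
Qed.

Lemma layer1_sub (U : {vspace E}) : (forall i, hb i \in U) -> (layer (R := R) (cg_deg G) 1 <= U)%VS.
Proof.
move=> H; apply: layer_sub => j /eqP; rewrite cg_hdim => jm.
have := H (Ordinal jm); rewrite /hbasis.
by rewrite (_ : widen_ord _ _ = j)//; apply: val_inj.
Qed.

(** The span of the Ad_h X_i, h a word, is stable under Ad_(t X_i), hence under
    ad X_i by differentiation; as V_1 generates the Lie algebra, the span is
    everything. *)
Lemma adjoint_span (U : {vspace E}) : (forall w i, gconj (wprod w) (hb i) \in U) -> U = fullv.
Proof.
move=> HU.
pose P v := forall U : {vspace E}, (forall w i, gconj (wprod w) (hb i) \in U) -> v \in U.
have P0 : P 0 by move=> V _; exact: mem0v.
have PD a u v : P u -> P v -> P (a *: u + v).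
  by move=> Pu Pv V HV; apply: memvD; [apply: memvZ; exact: Pu|exact: Pv].
have [U0 HU0] := linear_set_vspace P0 PD.
suff allP v0 : P v0 by apply/vspaceP => v; rewrite memvf; exact: allP.
have gen w i : P (gconj (wprod w) (hb i)) by move=> V HV; exact: HV.
have Phb i : P (hb i).
  by have := gen [::] i; rewrite /= gconj1.
have Pconj t i v : P v -> P (gconj (t *: hb i) v).
  move=> Pv.
  have [|a u u' h h'|V HV] := @linear_set_vspace R n (fun v => P (gconj (t *: hb i) v)).
  - by rewrite gconj0.
  - by rewrite (gconj_linear G _ a u u'); exact: PD.
  apply/HV; apply: Pv => w k; apply/HV; rewrite -gconj_mul -wprod1 -wprod_cat.
  exact: gen.
(* g vanishes exactly on U0, so that U0 is closed under derivatives of curves *)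
pose g v := v - projv U0 v.
have lg : linear g.
  by move=> a u v; rewrite /g linearP scalerBr opprD addrACA.
have gP v : P v -> g v = 0.
  by move=> /HU0 vU; rewrite /g projv_id// subrr.
have Pbr i v : P v -> P (br (hb i) v).
  move=> Pv; apply/HU0.
  have : g (br (hb i) v) = 0.
    apply: is_derive_uniq (is_derive_linear lg (is_derive_gconj0 G (hb i) v)) _.
    have := is_derive_cst (0 : E) (0 : R) 1.
    by apply: is_derive_ext => s; rewrite gP//; exact: Pconj.
  by move/eqP; rewrite subr_eq0 => /eqP ->; exact: memv_proj.
apply: (stratified_ind P0 PD _ _ v0).
- move=> v /(subvP (layer1_sub (U := U0) _)) H; apply/HU0; apply: H => i; exact/HU0.
- move=> X v XV Pv.
  have [|a u u' h h'|V HV] := @linear_set_vspace R n (fun X => P (br X v)).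
  + by have := linear_fun0 (br_linl G v) => /= ->.
  + by have := br_linl G v a u u' => /= ->; exact: PD.
  by apply/HV; apply: (subvP (layer1_sub (U := V) _)) XV => i; apply/HV; exact: Pbr.
Qed.

(** A maximal free family of elements of a spanning set is a basis. *)
Lemma generators_basis (S : E -> Prop) :
  (forall U : {vspace E}, (forall v, S v -> v \in U) -> U = fullv) ->
  exists X : seq E, (forall v, v \in X -> S v) /\ basis_of fullv X.
Proof.
move=> HS.
pose good k := `[< exists X : seq E, [/\ free X, forall v, v \in X -> S v & size X = k] >].
have g0 : exists k, good k.
  by exists 0%N; apply/asboolP; exists [::]; split => //; exact: nil_free.
have gb k : good k -> (k <= dim E)%N.
  move=> /asboolP[X [fX _ <-]]; rewrite -dimvf -(eqP fX); apply: dimvS.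
  exact: subvf.
case: (ex_maxnP g0 gb) => k /asboolP[X [fX XS sX]] kmax.
exists X; split => //; rewrite basisEfree fX subvf/=.
suff e : <<X>>%VS = fullv by rewrite -e (eqP fX).
apply: HS => v Sv; apply/negPn/negP => vX.
have /kmax : good k.+1.
  apply/asboolP; exists (v :: X); split; [|move=> u|by rewrite /= sX].
    by rewrite free_cons vX.
  by rewrite inE => /orP[/eqP ->//|]; exact: XS.
by rewrite ltnn.
Qed.

Definition foldmul (fs : seq (E -> E)) (z : E) : E := foldr (fun f x => f z ** x) 0 fs.

Lemma foldmul_strict (fs : seq (E -> E)) : (forall i, (i < size fs)%N -> linear (nth id fs i)) ->
  [/\ foldmul fs 0 = 0, linear (fun z => \sum_(f <- fs) f z)
    & strict_at0 (foldmul fs) (fun z => \sum_(f <- fs) f z)].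
Proof.
elim: fs => [|f fs IH] lfs.
  split => //=; first by move=> a u v; rewrite !big_nil scaler0 addr0.
  move=> e e0; exists 1 => // z z' _ _; rewrite big_nil !subr0 normr0.
  by rewrite mulr_ge0// ltW.
have lf : linear f by exact: (lfs 0%N).
have [|h0 hl hs] := IH; first by move=> i ifs; exact: (lfs i.+1).
have e : (fun z => \sum_(g <- f :: fs) g z) = (fun z => f z + \sum_(g <- fs) g z).
  by apply/funext => z; rewrite big_cons.
split; first by rewrite /= h0 (linear_fun0 lf) gmulx0.
- rewrite e => a u v; rewrite (lf a u v) (hl a u v) scalerDr.
  by rewrite addrACA.
- by rewrite e; exact: strict_mul.
Qed.

(** By [adjoint_span] there is a basis of vectors Ad_{h_j} X_{i_j} with words h_j.
    The map z |-> prod_j h_j exp (z_j X_{i_j}) h_j^-1 then has the identity as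
    strict differential at 0, hence covers a neighborhood of 0. *)
Lemma chow_local : exists k C : R, 0 < k /\ forall x, `|x| <= k ->
  exists2 w, wprod w = x & wlen w <= C.
Proof.
have [X [XS bX]] := @generators_basis (fun v => exists w i, v = gconj (wprod w) (hb i))
  (fun U HU => adjoint_span (fun w i => HU _ (ex_intro _ w (ex_intro _ i erefl)))).
pose c (j : 'I_(size X)) z := coord (in_tuple X) j z.
pose F (j : 'I_(size X)) z := c j z *: X`_j.
pose fs := [seq F j | j <- enum 'I_(size X)].
have lF j : linear (F j) by move=> a u v; rewrite /F /c linearP scalerDl scalerA.
have [|P0 _ sP] := @foldmul_strict fs.
  move=> i; rewrite size_map => ifs.
  have j0 : 'I_(size X) by move: ifs; rewrite size_enum_ord => ifs; exact: (Ordinal ifs).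
  by rewrite (nth_map j0)//; exact: lF.
have sid : strict_at0 (foldmul fs) id.
  move: sP; rewrite (_ : (fun z => \sum_(f <- fs) f z) = id)//; apply/funext => z.
  rewrite /fs big_map big_enum/= [RHS](coord_basis (X := in_tuple X) bX (memvf z)).
  exact: eq_bigr.
have [r [k [r0 k0 Hk]]] := strict_local_surj P0 sid.
have cB j : exists C, forall z, `|z| <= r -> `|c j z| <= C.
  have lr : linear (fun z => \row_(_ < 1) c j z).
    by move=> a u v; apply/rowP => i; rewrite !mxE /c linearP.
  exists ((\sum_j0 `|\row_(_ < 1) c j (delta_mx 0 j0)|) * r) => z zr.
  have := linear_fun_bound z lr; have := coord_le_norm (\row_(_ < 1) c j z) 0.
  rewrite mxE => h1 h2; apply: le_trans h1 (le_trans h2 _).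
  by rewrite ler_wpM2l//; exact: sumr_ge0.
have [C HC] : exists C, forall z, `|z| <= r -> exists2 w, wprod w = foldmul fs z & wlen w <= C.
  rewrite /fs; elim: (enum _) => [|j js [C HC]].
    by exists 0 => z _; exists [::] => //; rewrite /wlen big_nil.
  have [Cj HCj] := cB j.
  have [|w [i Xw]] := XS X`_j; first exact: mem_nth.
  exists (wlen w + (Cj + wlen w) + C) => z zr.
  have [w' e' l'] := HC z zr.
  exists ((w ++ ([:: (i, c j z)] ++ winv w)) ++ w').
    by rewrite !wprod_cat e' wprod1 wprod_inv gmulA /F /= Xw -gconjZ.
  by rewrite !wlen_cat wlen1 wlen_inv !lerD// HCj.
exists k, C; split => // x xk.
have [z zr zx] := Hk x xk.
by have [w e l] := HC z zr; exists w => //; rewrite e.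
Qed.

(** The ball of radius r of a homogeneous quasi-norm. All estimates of the distance
    are comparisons with these sets, on which dilations act by scaling the
    radius. *)
Definition box (r : R) (x : E) := forall j, `|x 0 j| <= r ^+ cg_deg G j.

Lemma box_dil r s x : 0 <= s -> box r x -> box (s * r) (dil s x).
Proof.
move=> s0 bx j; rewrite mxE normrM exprMn normrX (ger0_norm s0).
by rewrite ler_wpM2l ?exprn_ge0.
Qed.

Lemma box_norm r x : 0 <= r <= 1 -> box r x -> `|x| <= r.
Proof.
move=> /andP[r0 r1] bx; apply: norm_le_coord => // j; apply: le_trans (bx j) _.
have /andP[d1 _] := cg_deg_bounds G j.
by rewrite -(prednK d1) exprS ler_piMr// exprn_ile1.
Qed.

Lemma norm_box x : `|x| <= 1 -> box 1 x.
Proof. by move=> x1 j; rewrite expr1n; exact: le_trans (coord_le_norm _ _) x1. Qed.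

(** The scale-invariant form of [chow_local], obtained by dilation. *)
Lemma chow : exists2 C : R, 0 < C & forall r x, 0 < r -> box r x ->
  exists2 w, wprod w = x & wlen w <= C * r.
Proof.
have [k0 [C [k00 H]]] := chow_local.
pose k := Num.min k0 1.
have kk0 : 0 < k by rewrite lt_min k00 ltr01.
have k1 : k <= 1 by rewrite ge_min lexx orbT.
have kk : k <= k0 by rewrite ge_min lexx.
exists ((`|C| + 1) / k); first by rewrite divr_gt0// ltr_wpDl.
move=> r x r0 bx.
have s0 : 0 < k / r by rewrite divr_gt0.
have bk : box k (dil (k / r) x).
  by have := box_dil (ltW s0) bx; rewrite divfK// gt_eqF.
have [|w e l] := H (dil (k / r) x).
  by apply: le_trans (box_norm _ bk) kk; rewrite (ltW kk0).
exists (wdil (r / k) w).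
  rewrite wprod_dil ?gt_eqF ?divr_gt0// e dil_comp.
  by rewrite mulrA divfK ?divff ?dil1// gt_eqF.
have rk0 : 0 <= r / k by apply: ltW; rewrite divr_gt0.
rewrite wlen_dil ger0_norm//.
have -> : (`|C| + 1) / k * r = r / k * (`|C| + 1) by ring.
rewrite ler_wpM2l//.
by apply: le_trans l _; apply: le_trans (ler_norm _) _; rewrite lerDl.
Qed.

End Chow.

(** * Horizontal curves along words and the upper bound for the distance *)

Section WordCurves.
Context {R : realType} {m n : nat} (G : carnotGroup R m n).
Local Notation E := 'rV[R]_n.
Local Notation "x ** y" := (cg_mul G x y) (at level 40, left associativity).
Local Notation hb := (hbasis G).
Local Notation wprod := (wprod G).
Local Notation mu := (@lebesgue_measure R).

(** The projection of the line onto [0, b]; it stops the motion along a field after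
    the time b. *)
Definition clamp (b t : R) : R := if t <= 0 then 0 else if b <= t then b else t.

Lemma clamp_le0 b t : t <= 0 -> clamp b t = 0.
Proof. by rewrite /clamp => ->. Qed.

Lemma clamp_ge b t : 0 <= b -> b <= t -> clamp b t = b.
Proof. by rewrite /clamp => b0 bt; rewrite bt; case: leP => // t0; lra. Qed.

Lemma clamp_id b t : 0 < t -> t < b -> clamp b t = t.
Proof. by rewrite /clamp => /lt_geF -> /lt_geF ->. Qed.

Lemma clamp_lipschitz b s t : 0 <= b -> `|clamp b s - clamp b t| <= `|s - t|.
Proof.
move=> b0; have h1 := ler_norm (s - t); have h2 := ler_norm (t - s).
rewrite distrC in h2; rewrite ler_norml /clamp.
by case: (leP s 0) => ?; case: (leP t 0) => ?; case: (leP b s) => ?;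
  case: (leP b t) => ?; apply/andP; split; lra.
Qed.

Lemma clamp_bound b t : 0 <= b -> `|clamp b t| <= b.
Proof.
move=> b0; rewrite /clamp; case: (leP t 0) => ?; first by rewrite normr0.
by case: (leP b t) => ?; rewrite ger0_norm//; lra.
Qed.

(** Each letter of a word is followed at unit speed, in the direction given by the
    sign of its exponent. *)
Lemma unit_sign (r : R) : exists s : R, [/\ `|s| = 1, s ^+ 2 = 1 & `|r| * s = r].
Proof.
have [r0|r0] := leP 0 r.
  by exists 1; rewrite normr1 expr1n mulr1 ger0_norm.
by exists (-1); rewrite normrN1 sqrrN expr1n mulrN1 ltr0_norm ?opprK.
Qed.

Definition hvec (i : 'I_m) (s : R) : 'rV[R]_m := s *: delta_mx 0 i.

Lemma hfieldE i x : hfield G i x = ltrans G x (hb i).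
Proof. exact: left_fieldE. Qed.

Lemma hvec_hfield i s x : \sum_k hvec i s 0 k *: hfield G k x = ltrans G x (s *: hb i).
Proof.
rewrite (bigD1 i)//= big1 ?addr0; last first.
  by move=> k ki; rewrite !mxE/= (negbTE ki) mulr0 scale0r.
by rewrite !mxE !eqxx mulr1 hfieldE (linear_funZ (ltrans_linear G x)).
Qed.

Lemma hvec_norm i s : \sum_k hvec i s 0 k ^+ 2 = s ^+ 2.
Proof.
rewrite (bigD1 i)//= big1 ?addr0; last first.
  by move=> k ki; rewrite !mxE/= (negbTE ki) mulr0 expr0n.
by rewrite !mxE !eqxx mulr1.
Qed.

(** A unit-speed curve following the word w, constant outside [0, wlen w]. It is
    defined on the whole line so that appending a letter amounts to multiplying by
    a curve that is constant up to time wlen w. The corners form the finite set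
    F. *)
Lemma word_curve (i0 : 'I_m) x w : exists (c : R -> E) (u : R -> 'rV[R]_m) (F : seq R),
  [/\ (forall t, t <= 0 -> c t = x) /\ (forall t, wlen w <= t -> c t = x ** wprod w),
      exists2 K, 0 < K & forall s t, `|c s - c t| <= K * `|s - t|,
      (exists B, forall t, `|c t| <= B),
      (forall t, 0 < t < wlen w -> t \notin F ->
        is_derive t (1 : R) c (\sum_i u t 0 i *: hfield G i (c t)))
    & (forall t, \sum_i u t 0 i ^+ 2 = 1) /\
      forall i, measurable_fun setT (fun t => u t 0 i)].
Proof.
elim/last_ind: w => [|w [i r]].
  exists (fun=> x), (fun=> hvec i0 1), [::]; rewrite /wlen big_nil gmulx0; split => //.
  - by exists 1 => // s t; rewrite subrr normr0 mul1r.
  - by exists `|x|.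
  - by move=> t /andP[t0 t1]; move: (lt_trans t0 t1); rewrite ltxx.
  - by split=> [t|k]; [rewrite hvec_norm expr1n|exact: measurable_cst].
move=> [c [u [F [[c0 cw] [K K0 cK] [B cB] dc [u1 mu_]]]]].
set b := wlen w in cw dc.
have b0 : 0 <= b := wlen_ge0 w.
have bE : wlen (rcons w (i, r)) = b + `|r| by rewrite -cats1 wlen_cat wlen1.
have wE : wprod (rcons w (i, r)) = wprod w ** (r *: hb i) by rewrite -cats1 wprod_cat wprod1.
rewrite bE wE.
have [sg [sg1 sg2 rsg]] := unit_sign r.
pose e t := (clamp `|r| (t - b) * sg) *: hb i.
have e0 t : t <= b -> e t = 0.
  by move=> tb; rewrite /e clamp_le0 ?mul0r ?scale0r// subr_le0.
have e1 t : b + `|r| <= t -> e t = r *: hb i.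
  by move=> tb; rewrite /e clamp_ge ?lerBrDl// rsg.
have eB t : `|e t| <= `|r| * `|hb i|.
  rewrite normrZ ler_wpM2r// normrM; apply: le_trans (_ : `|r| * 1 <= _); last by rewrite mulr1.
  by rewrite ler_pM// ?clamp_bound// sg1.
have eK s t : `|e s - e t| <= `|hb i| * `|s - t|.
  rewrite -scalerBl normrZ mulrC ler_wpM2l// -mulrBl normrM.
  apply: le_trans (_ : `|s - t| * 1 <= _); last by rewrite mulr1.
  rewrite ler_pM//; last by rewrite sg1.
  by apply: le_trans (clamp_lipschitz _ _ _) _ => //; rewrite opprB addrA subrK.
have [K' K'0 HK'] := mul_lipschitz G (Num.max B (`|r| * `|hb i|)).
have cB' t : `|c t| <= Num.max B (`|r| * `|hb i|) by rewrite le_max cB.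
have eB' t : `|e t| <= Num.max B (`|r| * `|hb i|) by rewrite le_max eB orbT.
exists (fun t => c t ** e t), (fun t => if t < b then u t else hvec i sg), (b :: F); split.
- split=> t ht.
    by rewrite c0// e0 ?gmulx0//; exact: le_trans ht b0.
  by rewrite cw ?e1 -?gmulA//; apply: le_trans ht; rewrite lerDl.
- exists (K' * (K + `|hb i|)) => [|s t]; first by rewrite mulr_gt0// ltr_wpDr.
  apply: le_trans (HK' _ _ _ _ (cB' s) (eB' s) (cB' t) (eB' t)) _.
  by rewrite -mulrA (ler_pM2l K'0) mulrDl lerD.
- exists (K' * (Num.max B (`|r| * `|hb i|) + Num.max B (`|r| * `|hb i|))) => t.
  have M0 : 0 <= Num.max B (`|r| * `|hb i|) by exact: le_trans (cB' t).
  have := HK' (c t) (e t) 0 0 (cB' t) (eB' t); rewrite !normr0 gmulx0 !subr0 => /(_ M0 M0) h.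
  by apply: le_trans h _; rewrite (ler_pM2l K'0) lerD.
- move=> t /andP[t0 tb]; rewrite inE negb_or => /andP[tnb tF].
  have [lt_tb|le_bt] := ltP t b.
    have := dc t; rewrite t0 lt_tb => /(_ isT tF).
    rewrite (e0 t (ltW lt_tb)) gmulx0; apply: near_eq_is_derive.
    near=> s; rewrite e0 ?gmulx0//; apply: ltW; near: s; exact: lt_nbhsl.
  have lt_bt : b < t by rewrite lt_neqAle eq_sym tnb.
  rewrite hvec_hfield.
  pose y := x ** wprod w.
  have H' : is_derive (- b + 1 * t) (1 : R) (fun s : R => y ** (s *: (sg *: hb i)))
      (ltrans G (y ** ((t - b) *: (sg *: hb i))) (sg *: hb i)).
    by rewrite mul1r addrC; exact: is_derive_exp.
  have := is_derive_affine H'; rewrite scale1r.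
  have et : forall s, b < s < b + `|r| -> c s ** e s = y ** ((s - b) *: (sg *: hb i)).
    move=> s /andP[bs sr]; rewrite cw ?(ltW bs)// /e clamp_id ?scalerA//; lra.
  rewrite -et ?lt_bt//; apply: near_eq_is_derive.
  near=> s; rewrite mul1r addrC -et//.
  apply/andP; split; near: s; [exact: lt_nbhsr|exact: lt_nbhsl].
- split=> [t|k].
    by case: ifP => _; rewrite ?u1// hvec_norm.
  rewrite (_ : (fun t => _) = (fun t => if t < b then u t 0 k else hvec i sg 0 k)); last first.
    by apply/funext => t; case: ifP.
  apply: measurable_fun_ifT => //; exact: measurable_realfun.measurable_fun_ltr.
Unshelve. all: by end_near. Qed.

Definition cc_lengths (x y : E) : set R := [set l | exists a b c u,
  [/\ a < b, horizontal G a b c u, c a = x, c b = y & l = curve_length a b u]].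

Lemma cc_distE x y : cc_dist G x y = inf (cc_lengths x y). Proof. by []. Qed.

Lemma curve_length_ge0 a b (u : R -> 'rV[R]_m) : 0 <= curve_length a b u.
Proof. by apply: Rintegral_ge0 => t _; exact: sqrtr_ge0. Qed.

Lemma lipschitz_abs_continuous (c : R -> E) K a b : 0 < K ->
  (forall s t, `|c s - c t| <= K * `|s - t|) -> abs_continuous a b c.
Proof.
move=> K0 cK e e0; exists (e / K); first by rewrite divr_gt0.
move=> N s t st _; rewrite ltr_pdivlMr// mulrC => h.
apply: le_lt_trans h; rewrite mulr_sumr; apply: ler_sum => k _.
have [_ [st1 _]] := st k.
by apply: le_trans (cK _ _) _; rewrite ger0_norm ?subr_ge0.
Qed.

Lemma lebesgue_measure_segment (a b : R) : a <= b ->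
  lebesgue_measure (`[a, b]%classic : set R) = (b - a)%:E.
Proof.
move=> ab; rewrite lebesgue_measure_itv/= lte_fin.
by case: ltgtP ab => //= -> _; rewrite subrr.
Qed.

Lemma integral_unit_itv (a b : R) : a <= b -> Rintegral mu `[a, b] (fun=> 1) = b - a.
Proof.
move=> ab; rewrite Rintegral_cst// mul1r.
exact: (congr1 fine (lebesgue_measure_segment ab)).
Qed.

(** A word of length zero represents the identity and is realized by a constant
    curve on [0, 1], since horizontal curves live on nondegenerate intervals. *)
Lemma word_length x w : exists2 l, cc_lengths x (x ** wprod w) l & l <= wlen w.
Proof.
have [w0|w0] := eqVneq (wlen w) 0.
  exists 0 => //; last by rewrite w0.
  have -> : wprod w = 0.
    elim: w w0 => //= p w IH; rewrite /wlen big_cons => /eqP.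
    rewrite paddr_eq0//; last exact: wlen_ge0.
    by move=> /andP[/eqP/normr0_eq0 -> /eqP/IH ->]; rewrite scale0r gmulx0.
  rewrite gmulx0; exists 0, 1, (fun=> x), (fun=> 0); split => //; last first.
    rewrite /curve_length; under eq_Rintegral do
      (rewrite big1 ?sqrtr0; last by move=> i _; rewrite mxE expr0n).
    by rewrite Rintegral_cst// mul0r.
  split.
  - by apply: (@lipschitz_abs_continuous _ 1) => // s t; rewrite subrr normr0 mul1r.
  - move=> i; rewrite (_ : (fun t => _) = cst 0%E); first exact: integrable0.
    by apply/funext => t; rewrite mxE.
  - apply: aeW => t _; rewrite big1; first exact: is_derive_cst.
    by move=> i _; rewrite mxE scale0r.
have i0 : 'I_m by case: w w0 => [|[i r] w _]; [rewrite /wlen big_nil eqxx|exact: i].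
have [c [u [F [[c0 cw] [K K0 cK] _ dc [u1 mu_u]]]]] := word_curve i0 x w.
have wp : 0 < wlen w by rewrite lt_neqAle eq_sym w0 wlen_ge0.
exists (wlen w) => //; exists 0, (wlen w), c, u; split => //.
- split; first exact: lipschitz_abs_continuous K0 cK.
  + move=> i; apply: measurable_bounded_integrable => //.
    * by apply: (@le_lt_trans _ _ (wlen w - 0)%:E); [rewrite -(lebesgue_measure_segment (ltW wp))|exact: ltry].
    * exact: measurable_funS (mu_u i).
    * exists 1; split => // M M1 t _ /=; apply: le_trans (ltW M1).
      rewrite -(@ler_sqr _ _ 1) ?nnegrE// expr1n -normrX ger0_norm ?sqr_ge0//.
      by rewrite -(u1 t) (bigD1 i)//= lerDl; apply: sumr_ge0 => k _; exact: sqr_ge0.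
  + exists [set` 0 :: wlen w :: F]; split => //=.
    * by apply: countable_measurable => //; apply: finite_set_countable; exact: finite_seq.
    * by apply: countable_lebesgue_measure0; apply: finite_set_countable; exact: finite_seq.
    move=> t /= /not_implyP[tw]; apply: contra_notP => /negP.
    rewrite !inE !negb_or => /and3P[t0 tb tF].
    move: tw; rewrite in_itv/= => /andP[h0 hb].
    by apply: dc => //; rewrite !lt_neqAle eq_sym t0 h0 tb hb.
- exact: c0.
- exact: cw.
- rewrite /curve_length; under eq_Rintegral do rewrite u1 sqrtr1.
  by rewrite integral_unit_itv ?subr0// ltW.
Qed.

Lemma cc_lengths_lbound x y : lbound (cc_lengths x y) 0.
Proof. by move=> l [a [b [c [u [_ _ _ _ ->]]]]]; exact: curve_length_ge0. Qed.

Lemma cc_dist_word x w : cc_dist G x (x ** wprod w) <= wlen w.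
Proof.
have [l hl lw] := word_length x w; apply: le_trans lw.
by apply: ge_inf => //; exists 0; exact: cc_lengths_lbound.
Qed.

(** Without this, the infimum defining the distance could be that of the empty
    set. *)
Lemma cc_lengths_neq0 x y : cc_lengths x y !=set0.
Proof.
have [C C0 H] := chow G; pose r := 1 + `|(- x) ** y|.
have r0 : 0 < r by rewrite ltr_pwDl.
have bxy : box G r ((- x) ** y).
  move=> j; apply: le_trans (coord_le_norm _ _) _.
  have /andP[d1 _] := cg_deg_bounds G j; rewrite -(prednK d1) exprS.
  have := normr_ge0 ((- x) ** y); rewrite /r; set a := `|_| => a0.
  apply: le_trans (_ : (1 + a) * 1 <= _); first by lra.
  by rewrite ler_wpM2l ?exprn_ege1//; lra.
have [w e _] := H r _ r0 bxy.
have [l hl _] := word_length x w; exists l.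
by rewrite -(gmulxK G x y) -e.
Qed.

Lemma cc_dist_ge0 x y : 0 <= cc_dist G x y.
Proof. by apply: lb_le_inf; [exact: cc_lengths_neq0|exact: cc_lengths_lbound]. Qed.

Lemma cc_dist_box : exists2 C : R, 0 < C & forall r x h, 0 < r -> box G r h ->
  cc_dist G x (x ** h) <= C * r.
Proof.
have [C C0 H] := chow G; exists C => // r x h r0 bh.
by have [w <- l] := H r h r0 bh; exact: le_trans (cc_dist_word x w) l.
Qed.

End WordCurves.

(** * Lebesgue outer measure and absolutely continuous functions *)

Section RealLineTools.
Context {R : realType}.
Local Notation mu := (@lebesgue_measure R).

Lemma lebesgue_outer_open (A : set R) (e : R) : 0 < e ->
  exists U, [/\ open U, A `<=` U & (lebesgue_measure U <= lebesgue_measure A + e%:E)%E].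
Proof. exact: outer_measure_open_le. Qed.

Lemma lebesgue_outer_le (A B : set R) : A `<=` B ->
  (lebesgue_measure A <= lebesgue_measure B)%E.
Proof.
move=> AB; rewrite /lebesgue_measure /lebesgue_stieltjes_measure /measure_extension.
exact: (@le_mu_ext _ _ _ (wlength idfun)).
Qed.

Lemma null_open_cover (A : set R) (e : R) : 0 < e -> lebesgue_measure A = 0%E ->
  exists U, [/\ open U, A `<=` U & (lebesgue_measure U <= e%:E)%E].
Proof.
move=> e0 A0; have [U [oU AU Ue]] := lebesgue_outer_open A e0.
by exists U; split => //; move: Ue; rewrite A0 add0e.
Qed.

(** The measure of the part of U between a and s. With U a small open cover of an
    exceptional set, this is a function of small total variation that grows with
    slope 1 on U: adding it to a function neutralizes the exceptional set. *)
Definition cover_length (U : set R) (a s : R) : R :=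
  fine (lebesgue_measure (U `&` `]a, s]%classic)).

Section CoverLength.
Variables (U : set R) (a e : R).
Hypotheses (oU : open U) (Ue : (lebesgue_measure U <= e%:E)%E).

Let mUI (s : R) : measurable (U `&` `]a, s]%classic).
Proof. by apply: measurableI => //; exact: measurable_realfun.open_measurable. Qed.

Let UI_fin s : lebesgue_measure (U `&` `]a, s]%classic) \is a fin_num.
Proof.
rewrite ge0_fin_numE ?measure_ge0//; apply: le_lt_trans (ltry e).
apply: le_trans Ue; apply: lebesgue_outer_le.
by apply: subIset; left.
Qed.

Lemma cover_length_ge0 s : 0 <= cover_length U a s.
Proof. by apply: fine_ge0; exact: measure_ge0. Qed.

Lemma cover_length_bound s : cover_length U a s <= e.
Proof.
rewrite -lee_fin fineK//; apply: le_trans Ue; apply: lebesgue_outer_le.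
by apply: subIset; left.
Qed.

Lemma cover_length_le s t : s <= t -> cover_length U a s <= cover_length U a t.
Proof.
move=> st; rewrite -lee_fin !fineK//; apply: lebesgue_outer_le.
apply: setIS => x /=; rewrite !in_itv/= => /andP[-> /=] xs; exact: le_trans st.
Qed.

Lemma cover_length_step s t : a <= s -> s <= t -> `]s, t]%classic `<=` U ->
  cover_length U a t = cover_length U a s + (t - s).
Proof.
move=> as_ st stU.
have e1 : U `&` `]a, t]%classic = (U `&` `]a, s]%classic) `|` `]s, t]%classic.
  apply/seteqP; split => x /=; rewrite !in_itv/=.
    move=> [Ux /andP[ax xt]]; case: (leP x s) => xs; first by left; rewrite ax.
    by right; rewrite xt.
  move=> [[Ux /andP[ax xs]]|/andP[sx xt]]; first by rewrite ax (le_trans xs).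
  split; first by apply: stU; rewrite /= in_itv/= sx.
  by rewrite (le_lt_trans as_ sx).
have m2 : lebesgue_measure (`]s, t]%classic : set R) = (t - s)%:E.
  rewrite lebesgue_measure_itv/= lte_fin; case: ltgtP st => //= -> _.
  by rewrite subrr.
have e2 : lebesgue_measure (U `&` `]a, t]%classic) =
    (lebesgue_measure (U `&` `]a, s]%classic) + lebesgue_measure (`]s, t]%classic : set R))%E.
  rewrite e1; apply: (@measureU _ _ _ mu); [exact: mUI|exact: measurable_itv|].
  apply/seteqP; split => x //= -[[_]]; rewrite !in_itv/= => /andP[_ h1] /andP[h2 _].
  by move: (lt_le_trans h2 h1); rewrite ltxx.
by rewrite /cover_length e2 m2 fineD.
Qed.

Lemma cover_length_lip s t : a <= s -> s <= t ->
  cover_length U a t <= cover_length U a s + (t - s).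
Proof.
move=> as_ st; rewrite -lee_fin EFinD !fineK// -(lebesgue_measure_segment st).
apply: le_trans (@measureU2 _ _ _ mu _ _ (mUI s) (measurable_itv _)).
apply: lebesgue_outer_le => x /=; rewrite !in_itv/= => -[Ux /andP[ax xt]].
by case: (leP x s) => xs; [left; rewrite ax|right; rewrite xt ltW].
Qed.

End CoverLength.

(** Continuous induction: if every point s has a neighborhood in which the property
    Q passes from the points on its left to those on its right, then Q passes from
    a to b. *)
Lemma creeping (a b : R) (Q : R -> Prop) : a <= b -> Q a ->
  (forall s, a <= s <= b -> exists2 d, 0 < d & forall x y,
     a <= x -> x <= s -> s <= y -> y <= b -> s - d < x -> y < s + d -> Q x -> Q y) ->
  Q b.
Proof.
move=> ab Qa H; pose A := [set x | a <= x <= b /\ Q x].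
have Aa : A a by rewrite /A/= lexx.
have ubA : ubound A b by move=> x [/andP[]].
have sA : has_sup A by split; [exists a|exists b].
have as_ : a <= sup A by exact: (ub_le_sup sA.2).
have sb : sup A <= b by apply: ge_sup => //; exists a.
have [|d d0 Hd] := H (sup A); first by rewrite as_ sb.
have [x [/andP[ax xb] Qx] xs] := sup_adherent d0 sA.
have xsA : x <= sup A by apply: (ub_le_sup sA.2); split=> //; rewrite ax.
have Qs y : sup A <= y -> y <= b -> y < sup A + d -> Q y.
  by move=> h1 h2 h3; apply: (Hd x).
have [sAb|sAb] := leP b (sup A).
  by apply: Qs; rewrite // ?sb//; apply: le_lt_trans sAb _; rewrite ltrDl.
pose y := Num.min b (sup A + d / 2).
have sy : sup A < y by rewrite lt_min sAb ltrDl divr_gt0.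
suff : A y by move=> /(ub_le_sup sA.2); rewrite leNgt sy.
have yb : y <= b by rewrite ge_min lexx.
split; first by rewrite (le_trans as_ (ltW sy)).
apply: Qs => //; first exact: ltW.
by rewrite gt_min; apply/orP; right; lra.
Qed.

Lemma is_derive_approx (g : R -> R) (s d : R) : is_derive s (1 : R) g d ->
  forall e, 0 < e -> exists2 r, 0 < r &
    forall t, `|t - s| < r -> `|g t - g s - d * (t - s)| <= e * `|t - s|.
Proof.
move=> /is_derive_cvg dg e e0; move/cvgrPdist_le : dg => /(_ e e0) /= [r /= r0 Hr].
exists r => // t ts; have [->|tns] := eqVneq t s.
  by rewrite !subrr mulr0 subrr normr0 mulr0.
have ts0 : t - s != 0 by rewrite subr_eq0.
have := Hr (t - s); rewrite /ball_/= sub0r normrN => /(_ ts ts0).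
rewrite subrKC -(ler_pM2r (_ : 0 < `|t - s|)) ?normr_gt0// -normrM.
rewrite mulrBl -[_ *: _]/(_ * _) mulrAC mulVf// mul1r.
by rewrite distrC.
Qed.

Definition real_abs_continuous (a b : R) (c : R -> R) : Prop :=
  forall e : R, 0 < e -> exists2 d : R, 0 < d &
    forall (N : nat) (s t : 'I_N -> R),
      (forall k, a <= s k /\ s k <= t k /\ t k <= b) ->
      (forall k l, k != l -> t k <= s l \/ t l <= s k) ->
      \sum_k (t k - s k) < d -> \sum_k `|c (t k) - c (s k)| < e.

(** At good points the increments of c are controlled by those of the indefinite
    integral F of v, up to e per unit length. The bad points form a null set; they
    are covered by an open set U of measure less than the modulus d of absolute
    continuity, and intervals inside U are collected in a list l. Induction along
    the segment by [creeping] bounds the total increment; the intervals of l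
    contribute at most e. *)
Lemma ac_increment_le (a b : R) (c v : R -> R) : a <= b -> real_abs_continuous a b c ->
  (forall t, 0 <= v t) -> mu.-integrable `[a, b] (EFin \o v) ->
  {ae mu, forall t, t \in `[a, b] -> exists2 d, is_derive t (1 : R) c d & d <= v t} ->
  c b - c a <= Rintegral mu `[a, b] v.
Proof.
move=> ab acc v0 iv [Z1 [mZ1 Z10 HZ1]].
pose f := v \_ `[a, b].
have f0 t : 0 <= f t by rewrite /f patchE; case: ifP.
have itf : mu.-integrable setT (EFin \o f).
  rewrite (_ : EFin \o f = (EFin \o v) \_ `[a, b]); last by rewrite restrict_EFin.
  by apply/(integrable_mkcond _ _).1.
have itfS (i : interval R) : mu.-integrable [set` i] (EFin \o f).
  by apply: integrableS itf.
pose F y := Rintegral mu `]-oo, y] f.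
have FB x y : x <= y -> F y - F x = Rintegral mu `]x, y] f.
  by move=> xy; rewrite /F; apply: Rintegral_itvB => //; rewrite bnd_simp.
have Fle x y : x <= y -> F x <= F y.
  by move=> xy; rewrite -subr_ge0 FB//; apply: Rintegral_ge0 => t _; exact: f0.
have FE : F b - F a = Rintegral mu `[a, b] v.
  rewrite FB// (Rintegral_itv_obnd_cbnd (b := BRight b)) //.
  by apply: eq_Rintegral => t tab; rewrite tab.
have [Z2 [mZ2 Z20 HZ2]] : {ae mu, forall x, derivable F x 1 /\ derive1 F x = f x}.
  apply: FTC1Ny => [y|]; first exact: itfS.
  by apply: open_integrable_locally => //; exact: openT.
have Z0 : lebesgue_measure (Z1 `|` Z2) = 0%E.
  by have := null_set_setU mZ1 mZ2 Z10 Z20.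
have good s : a <= s <= b -> ~ (Z1 `|` Z2) s -> exists2 d, 0 <= d & is_derive s (1 : R) (F - c) d.
  move=> sab /not_orP[n1 n2].
  have [dF1 dF2] : derivable F s 1 /\ derive1 F s = f s.
    by apply: contrapT => H; apply: n2; exact: HZ2.
  have [d dc dv] : exists2 d, is_derive s (1 : R) c d & d <= v s.
    apply: contrapT => H; apply: n1; apply: HZ1 => /= h; apply: H; apply: h.
    by rewrite in_itv.
  exists (v s - d); first by rewrite subr_ge0.
  have fs : f s = v s by rewrite /f patchE mem_set//= in_itv.
  rewrite -fs; apply: is_deriveB; apply: DeriveDef => //.
  by rewrite -derive1E.
rewrite -FE; clear HZ2 FB FE itfS; clearbody F.
suff key e : 0 < e -> c b - c a <= F b - F a + e * (b - a) + e.
  apply/ler_addgt0Pr => e e0; have ba : 0 < b - a + 1 by lra.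
  have := key (e / (b - a + 1)) (divr_gt0 e0 ba).
  suff -> : F b - F a + e / (b - a + 1) * (b - a) + e / (b - a + 1) = F b - F a + e by [].
  by field; rewrite gt_eqF.
move=> e0; have [d d0 Hd] := acc e e0.
have [U [oU ZU Ud]] := null_open_cover (divr_gt0 d0 (ltr0n _ 2) : 0 < d / 2) Z0.
pose W := cover_length U a.
pose Q y := exists l : seq (R * R),
  [/\ all (fun p => [&& a <= p.1, p.1 <= p.2 & p.2 <= y]) l,
      pairwise (fun p q => p.2 <= q.1) l,
      \sum_(p <- l) (p.2 - p.1) <= W y
    & c y - c a <= F y - F a + e * (y - a) + \sum_(p <- l) `|c p.2 - c p.1| ].
have [l [lab lpw lW lc]] : Q b.
  apply: (@creeping a b Q ab).
    exists [::]; rewrite !big_nil; split => //; first exact: cover_length_ge0.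
    by rewrite !subrr mulr0 !addr0.
  move=> s sab; have [Zs|nZs] := pselect ((Z1 `|` Z2) s).
    have /nbhs_ballP[r /= r0 Hr] : nbhs s U by apply: open_nbhs_nbhs; split => //; exact: ZU.
    exists r => // x y ax xs sy yb xr yr [l [lab lpw lW lc]].
    have xy : x <= y by exact: le_trans sy.
    exists (rcons l (x, y)); split.
    - rewrite all_rcons /= ax xy lexx/=; apply: sub_all lab => p /and3P[-> -> /= h].
      exact: le_trans xy.
    - rewrite pairwise_rcons lpw andbT; apply: sub_all lab => p /and3P[_ _ h] //.
    - rewrite big_rcons/= /W (cover_length_step oU Ud ax xy); first by move: lW; rewrite /W; lra.
      move=> z /=; rewrite in_itv/= => /andP[xz zy]; apply: Hr.
      by rewrite /ball/= ltr_distlC; apply/andP; split; lra.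
    - rewrite big_rcons/=; have := Fle _ _ xy; have := ler_norm (c y - c x).
      have : e * (x - a) <= e * (y - a) by rewrite ler_wpM2l ?(ltW e0)// lerB.
      by move: lc; set S := \sum_(p <- l) _; lra.
  have [D D0 dG] := good s sab nZs.
  have [r r0 Hr] := is_derive_approx dG e0.
  exists r => // x y ax xs sy yb xr yr [l [lab lpw lW lc]].
  have xy : x <= y by exact: le_trans sy.
  exists l; split => //.
  - by apply: sub_all lab => p /and3P[-> -> /= h]; exact: le_trans xy.
  - by apply: le_trans lW _; exact: (cover_length_le a Ud xy).
  have hx := Hr x; have hy := Hr y.
  rewrite ler0_norm ?subr_le0// in hx; rewrite ger0_norm ?subr_ge0// in hy.
  have {}hx := hx (ltac:(by rewrite opprB ltrBlDr addrC -ltrBlDr)).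
  have {}hy := hy (ltac:(by rewrite ltrBlDr addrC)).
  rewrite ler_norml in hx; rewrite ler_norml in hy; rewrite /= in hx hy.
  move/andP: hx => [_ hx]; move/andP: hy => [hy _].
  have Dx : 0 <= D * (s - x) by rewrite mulr_ge0// subr_ge0.
  have Dy : 0 <= D * (y - s) by rewrite mulr_ge0// subr_ge0.
  have eE : e * (y - a) = e * (x - a) + e * (s - x) + e * (y - s) by ring.
  rewrite (opprB x s) -(opprB s x) mulrN in hx.
  have {}hx : F x - c x - (F s - c s) + D * (s - x) <= e * (s - x) by move: hx; rewrite (opprK (D * (s - x))).
  have {}hy : - (e * (y - s)) <= F y - c y - (F s - c s) - D * (y - s) by exact: hy.
  rewrite eE; move: lc hx hy Dx Dy.
  move: (\sum_(p <- l) _) (D * (s - x)) (D * (y - s)) (e * (s - x)) (e * (y - s)) (e * (x - a)).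
  move: (F x) (F y) (F s) (F a) (c x) (c y) (c s) (c a).
  clear; move=> *; lra.
apply: le_trans lc _; rewrite lerD2l; apply: ltW.
pose N := size l; pose p0 : R * R := (a, a).
have sumE (g : R * R -> R) : \sum_(p <- l) g p = \sum_(k < N) g (nth p0 l k).
  by rewrite (big_nth p0) big_mkord.
rewrite sumE; apply: Hd.
- move=> k; move/(all_nthP p0): lab => /(_ k (ltn_ord k)) /and3P[h1 h2 h3].
  by [].
- move=> k k' kk'; move/(pairwiseP p0): lpw => H.
  have [lt|gt|e'] := ltngtP k k'.
  + by left; apply: H; rewrite ?inE.
  + by right; apply: H; rewrite ?inE.
  + by move/eqP: kk'; case; exact: val_inj.
- rewrite -(sumE (fun p => p.2 - p.1)); apply: le_lt_trans lW _.
  by apply: le_lt_trans (cover_length_bound a Ud b) _; lra.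
Qed.

End RealLineTools.

(** * The lower bound for the distance *)

Section LowerBound.
Context {R : realType} {m n : nat} (G : carnotGroup R m n).
Local Notation E := 'rV[R]_n.
Local Notation "x ** y" := (cg_mul G x y) (at level 40, left associativity).
Local Notation hb := (hbasis G).
Local Notation ltrans := (ltrans G).
Local Notation dil := (dilation G).
Local Notation mu := (@lebesgue_measure R).

(** The Euclidean norm of the control, which is integrated in the length; the norm of
    row vectors is the supremum norm. *)
Definition unorm (u : 'rV[R]_m) : R := Num.sqrt (\sum_i u 0 i ^+ 2).

Lemma unorm_ge0 u : 0 <= unorm u. Proof. exact: sqrtr_ge0. Qed.

Lemma coord_le_unorm (u : 'rV[R]_m) i : `|u 0 i| <= unorm u.
Proof.
rewrite -sqrtr_sqr; apply: ler_wsqrtr; rewrite (bigD1 i)//= lerDl.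
by apply: sumr_ge0 => k _; exact: sqr_ge0.
Qed.

Lemma unorm_le_sum (u : 'rV[R]_m) : unorm u <= \sum_i `|u 0 i|.
Proof.
have S0 : 0 <= \sum_i `|u 0 i| by apply: sumr_ge0.
rewrite -(ger0_norm S0) -sqrtr_sqr; apply: ler_wsqrtr.
rewrite expr2 mulr_suml; apply: ler_sum => i _.
rewrite -real_normK ?num_real// expr2 ler_wpM2l// (bigD1 i)//= lerDl.
by apply: sumr_ge0.
Qed.

Lemma hfields_bounded : exists2 K : R, 0 < K & forall (y : E) (u : 'rV[R]_m), `|y| <= 1 ->
  `|\sum_i u 0 i *: ltrans y (hb i)| <= K * unorm u.
Proof.
have H (i : 'I_m) : exists M, forall x y : E, `|x| <= 1 -> `|y| <= 1 ->
    `| `|dmul G x y 0 (hb i)| | <= M.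
  apply: (closedball_bounded (f := fun p => `|dmul G p.1 p.2 0 (hb i)|)) => p.
  by apply: cvg_norm; exact: dmul_continuous.
have [M HM] := choice H.
exists (\sum_i `|M i| + 1); first by rewrite ltr_wpDl//; exact: sumr_ge0.
move=> y u y1; apply: le_trans (ler_norm_sum _ _ _) _.
rewrite mulrDl mul1r ler_wpDr ?unorm_ge0// mulr_suml; apply: ler_sum => i _.
rewrite normrZ mulrC ler_pM ?coord_le_unorm//.
apply: le_trans (ler_norm _).
by have := HM i y 0 y1; rewrite normr0 normr_id; apply.
Qed.

Lemma abs_continuous_lip (a b K : R) (c : R -> E) (g : R -> R) : 0 < K ->
  abs_continuous a b c ->
  (forall s t, a <= s <= b -> a <= t <= b -> `|g t - g s| <= K * `|c t - c s|) ->
  real_abs_continuous a b g.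
Proof.
move=> K0 ac gK e e0; have [d d0 Hd] := ac (e / K) (divr_gt0 e0 K0).
exists d => // N s t st disj sm; have := Hd N s t st disj sm.
rewrite ltr_pdivlMr// mulrC mulr_sumr; apply: le_lt_trans; apply: ler_sum => k _.
have [h1 [h2 h3]] := st k.
apply: gK; first by rewrite h1 (le_trans h2).
by rewrite h3 (le_trans h1).
Qed.

Lemma abs_continuous_unif (a b : R) (c : R -> E) : abs_continuous a b c ->
  forall e, 0 < e -> exists2 d, 0 < d & forall s t, a <= s <= b -> a <= t <= b ->
    `|t - s| < d -> `|c t - c s| < e.
Proof.
move=> ac e e0; have [d d0 Hd] := ac e e0; exists d => // s t sab tab.
wlog st : s t sab tab / s <= t => [H|].
  have [st|ts] := leP s t; first exact: H.
  by rewrite distrC (distrC (c t)); apply: H => //; exact: ltW.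
rewrite ger0_norm ?subr_ge0// => ts.
have := Hd 1%N (fun=> s) (fun=> t); rewrite !big_ord1; apply => //.
- by move=> k; move/andP: sab => [-> _]; move/andP: tab => [_ ->].
- by move=> k l; rewrite (ord1 k) (ord1 l) eqxx.
Qed.

Lemma abs_continuous_bounded (a b : R) (c : R -> E) : abs_continuous a b c ->
  exists B, forall t, a <= t <= b -> `|c t| <= B.
Proof.
move=> ac.
have : compact (c @` `[a, b]).
  apply: continuous_compact; last exact: segment_compact.
  apply/subspace_continuousP => x xab; apply/cvgrPdist_lt => e e0.
  have [d d0 Hd] := abs_continuous_unif ac e0.
  rewrite near_withinE; near=> t => tab; apply: Hd.
  - by move: tab; rewrite /= in_itv.
  - by move: xab; rewrite /= in_itv.
  - by near: t; apply: cvgr_dist_lt.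
move/compact_bounded => [M [_ HM]]; exists (M + 1) => t tab.
by apply: (HM (M + 1)); rewrite ?ltrDl//; exists t => //=; rewrite in_itv.
Unshelve. all: by end_near. Qed.

Lemma horizontal_unorm_integrable a b c u : horizontal G a b c u ->
  mu.-integrable `[a, b] (EFin \o (unorm \o u)).
Proof.
move=> [_ iu _].
have iS : mu.-integrable `[a, b] (EFin \o (fun t => \sum_i `|u t 0 i|)).
  rewrite (_ : EFin \o _ = fun t => (\sum_(i < m) `|(u t 0 i)%:E|)%E); last first.
    by apply/funext => t /=; rewrite sumEFin.
  by apply: integrable_sum => // i _; exact: (integrable_abse (iu i)).
apply: le_integrable iS => //.
  apply/measurable_EFinP; apply: measurableT_comp => //; first exact: continuous_measurable_fun (@sqrt_continuous R).
  apply: measurable_sum => i; apply: measurable_funX.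
  by have /measurable_int/measurable_EFinP := iu i.
move=> t _; rewrite lee_fin /= ger0_norm ?unorm_ge0//.
by apply: le_trans (ler_norm _); exact: unorm_le_sum.
Qed.

(** Translated to start at 0 and rescaled by r = 1 / (2 K rho), a horizontal curve of
    length less than rho has speed at most r K |u| as long as it stays in the unit
    ball. The integral of this bound is at most 1/2, so the curve cannot leave the
    unit ball. Undoing the dilation gives the box. *)
Lemma horizontal_curve_box : exists2 C : R, 0 < C & forall a b c u rho,
  a < b -> horizontal G a b c u -> curve_length a b u < rho ->
  box G (C * rho) ((- c a) ** c b).
Proof.
have [K K0 HK] := hfields_bounded.
exists (2 * K); first by rewrite mulr_gt0.
move=> a b c u rho ab hc len.
have [ac iu dc] := hc.
set L := curve_length a b u in len.
have L0 : 0 <= L := curve_length_ge0 _ _ _.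
have rho0 : 0 < rho by exact: le_lt_trans len.
pose r := (2 * K * rho)^-1.
have r0 : 0 < r by rewrite invr_gt0 !mulr_gt0.
pose g t := dil r ((- c a) ** c t).
have ga : g a = 0 by rewrite /g gmulNx dil0.
have [B HB] := abs_continuous_bounded ac.
have aab : a <= a <= b by rewrite lexx ltW.
have B0 : 0 <= B by exact: le_trans (HB a aab).
have [K1 K10 HK1] := mul_lipschitz G B.
pose Cd := \sum_j `|dil r (delta_mx 0 j)|.
have Cd0 : 0 <= Cd by exact: sumr_ge0.
have gK s t : a <= s <= b -> a <= t <= b -> `|g t - g s| <= (Cd + 1) * K1 * `|c t - c s|.
  move=> sab tab; rewrite /g -dilB.
  apply: le_trans (linear_fun_bound _ (dil_linear G r)) _.
  have := HK1 (- c a) (c t) (- c a) (c s).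
  rewrite !normrN subrr normr0 add0r => /(_ (HB a aab) (HB t tab) (HB a aab) (HB s sab)) h.
  rewrite -mulrA; apply: ler_pM => //; first by rewrite lerDl.
have CK0 : 0 < (Cd + 1) * K1 by rewrite mulr_gt0// ltr_wpDl.
have gac (j : 'I_n) (sg : R) : `|sg| = 1 -> real_abs_continuous a b (fun t => sg * g t 0 j).
  move=> sg1; apply: (abs_continuous_lip CK0 ac) => s t sab tab.
  apply: le_trans (gK s t sab tab).
  rewrite -mulrBr normrM sg1 mul1r; have := coord_le_norm (g t - g s) j.
  by rewrite !mxE.
have gunif e : 0 < e -> exists2 d, 0 < d & forall s t, a <= s <= b -> a <= t <= b ->
    `|t - s| < d -> `|g t - g s| < e.
  move=> e0; have eCK : 0 < e / ((Cd + 1) * K1) by rewrite divr_gt0.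
  have [d d0 Hd] := abs_continuous_unif ac eCK; exists d => // s t sab tab ts.
  apply: le_lt_trans (gK s t sab tab) _.
  by have := Hd s t sab tab ts; rewrite ltr_pdivlMr// mulrC.
have dg : {ae mu, forall t, t \in `[a, b] ->
    is_derive t (1 : R) g (r *: \sum_i u t 0 i *: ltrans (g t) (hb i))}.
  apply: filterS dc; first exact: (ae_filter_ringOfSetsType mu).
  move=> t H /H dct.
  have dct' := is_derive_mul G (is_derive_cst (- c a) t 1) dct.
  have := is_derive_linear (dil_linear G r) dct'.
  suff -> : dil r (dmul G (- c a) (c t) 0 (\sum_i u t 0 i *: hfield G i (c t))) =
     r *: \sum_i u t 0 i *: ltrans (g t) (hb i) by [].
  rewrite (linear_fun_sum (dmul_linr G _ _)) (linear_fun_sum (dil_linear G r)) scaler_sumr.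
  apply: eq_bigr => i _.
  rewrite (linear_funZ (dmul_linr G _ _)) dilZ hfieldE dmul_ltrans -ltrans_dil ?gt_eqF//.
  rewrite dil_hbasis (linear_funZ (ltrans_linear G _)) !scalerA mulrC.
  by [].
have iU := horizontal_unorm_integrable hc.
have UL : Rintegral mu `[a, b] (unorm \o u) = L by [].
pose v t := r * K * unorm (u t).
have v0 t : 0 <= v t by rewrite !mulr_ge0// ?unorm_ge0// ltW.
(* up to an exit time t1 of the unit ball the curve has moved by at most 1/2 *)
have incr t1 : a <= t1 <= b -> (forall t, a <= t -> t < t1 -> `|g t| < 1) -> `|g t1| <= 2^-1.
  move=> /andP[at1 t1b] Hlt.
  have iv : mu.-integrable `[a, t1] (EFin \o v).
    rewrite (_ : EFin \o v = fun t => ((r * K)%:E * (EFin \o (unorm \o u)) t)%E); last first.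
      by apply/funext => t /=; rewrite -EFinM.
    apply: integrableZl => //; apply: integrableS iU => //.
    by apply: subset_itvl; rewrite bnd_simp.
  have vint : Rintegral mu `[a, t1] v <= 2^-1.
    rewrite RintegralZl//; last first.
      by apply: integrableS iU => //; apply: subset_itvl; rewrite bnd_simp.
    have : Rintegral mu `[a, t1] (unorm \o u) <= L.
      rewrite -UL -subr_ge0 Rintegral_itvB ?bnd_simp//.
      by apply: Rintegral_ge0 => t _; exact: unorm_ge0.
    have rK : r * K = 2^-1 / rho.
      by rewrite /r; field; rewrite !gt_eqF.
    rewrite rK => h; apply: le_trans (_ : 2^-1 / rho * rho <= _); last by rewrite divfK ?gt_eqF.
    by rewrite ler_wpM2l ?(ltW (divr_gt0 _ _))// (le_trans h)// ltW.
  apply: norm_le_coord; first by rewrite invr_ge0.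
  move=> j; rewrite ler_norml.
  suff key (sg : R) : `|sg| = 1 -> sg * g t1 0 j <= 2^-1.
    have := key 1; have := key (-1); rewrite normrN1 normr1 mul1r mulN1r.
    by move=> /(_ erefl) h1 /(_ erefl) ->; rewrite andbT lerNl.
  move=> sg1.
  have acj : real_abs_continuous a t1 (fun t => sg * g t 0 j).
    move=> e e0; have [d d0 Hd] := gac j sg sg1 e e0; exists d => // N s t st.
    apply: Hd => k; have [h1 [h2 h3]] := st k; split => //; split => //.
    exact: le_trans t1b.
  have := ac_increment_le at1 acj v0 iv.
  have z0 : (0 : E) 0 j = 0 by rewrite mxE.
  rewrite /= ga z0 mulr0 subr0 => H; apply: le_trans (H _) vint => {H}.
  have nt1 : {ae mu, forall t, t != t1}.
    exists [set t1]; split => //; first exact: lebesgue_measure_set1.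
    by move=> t /= /negP; rewrite negbK => /eqP.
  apply: filterS2 dg nt1; first exact: (ae_filter_ringOfSetsType mu).
  move=> t H tt1; rewrite in_itv/= => /andP[at_ tt].
  have tab : t \in `[a, b] by rewrite in_itv/= at_ (le_trans tt).
  have lt1 : t < t1 by rewrite lt_neqAle tt1.
  exists (sg * (r *: \sum_i u t 0 i *: ltrans (g t) (hb i)) 0 j).
    have := @is_deriveZ _ _ _ _ sg _ _ _ (is_derive_coord j (H tab)).
    by apply: is_derive_ext.
  apply: le_trans (ler_norm _) _; rewrite normrM sg1 mul1r.
  apply: le_trans (coord_le_norm _ _) _.
  rewrite normrZ (gtr0_norm r0) /v -mulrA ler_wpM2l ?(ltW r0)//.
  by apply: HK; apply/ltW/Hlt.
(* so the first time at which the norm would reach 1 does not exist *)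
have lt1 t : a <= t <= b -> `|g t| < 1.
  move=> tab; apply: contrapT => /negP; rewrite -leNgt => gt1.
  pose A := [set s | a <= s <= b /\ 1 <= `|g s|].
  have iA : has_inf A by split; [exists t|exists a => s [/andP[]]].
  set t1 := inf A.
  have at1 : a <= t1 by apply: lb_le_inf; [exists t|move=> s [/andP[]]].
  have t1b : t1 <= b.
    apply: le_trans (_ : t <= _); last by case/andP: tab.
    by apply: ge_inf => //; case: iA.
  have t1ab : a <= t1 <= b by rewrite at1.
  have h1 : `|g t1| <= 2^-1.
    apply: incr => // s as_ st1; apply: contrapT => /negP; rewrite -leNgt => gs.
    have : t1 <= s by apply: ge_inf; [case: iA|split => //; rewrite as_ (le_trans (ltW st1))].
    by rewrite leNgt st1.
  have [d d0 Hd] := gunif 2^-1 (ltac:(by rewrite invr_gt0)).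
  have [s [sab gs] st1] := inf_adherent d0 iA.
  have t1s : t1 <= s by apply: ge_inf; [case: iA|].
  have := Hd t1 s t1ab sab; rewrite ger0_norm ?subr_ge0// ltrBlDr addrC => /(_ st1).
  have := ler_normD (g s - g t1) (g t1); rewrite subrK.
  by move: gs h1; lra.
have gb : `|g b| <= 1 by apply/ltW/lt1; rewrite lexx ltW.
have := box_dil (ltW (_ : 0 < r^-1)) (norm_box G gb); rewrite invr_gt0 => /(_ r0).
by rewrite mulr1 /g dilVK ?gt_eqF// /r invrK.
Qed.

Lemma box_cc_dist : exists2 C : R, 0 < C & forall x y rho,
  cc_dist G x y < rho -> box G (C * rho) ((- x) ** y).
Proof.
have [C C0 H] := horizontal_curve_box; exists C => // x y rho.
move=> h; have iL : has_inf (cc_lengths G x y).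
  by split; [exact: cc_lengths_neq0|exists 0; exact: cc_lengths_lbound].
have e0 : 0 < rho - cc_dist G x y by rewrite subr_gt0.
have [l [a [b [c [u [ab hc <- <- ->]]]]] lr] := inf_adherent e0 iL.
by apply: (H a b c u) => //; move: lr; rewrite -cc_distE subrKC.
Qed.

End LowerBound.

(** * A Denjoy property for minimal functions on the line *)

(** The Baire category argument as a game: each move replaces a position by another
    one whose compact set lies in the open set of the previous one, and the
    countably many moves meet countably many requirements. The common point of
    the compact sets satisfies all of them. *)
Lemma nested_game (X : topologicalType) (Pos : Type) (K O : Pos -> set X)
    (step : nat -> Pos -> Pos -> Prop) (a0 : Pos) : hausdorff_space X ->
  (forall a, O a `<=` K a) -> (forall a, O a !=set0) -> (forall a, compact (K a)) ->
  (forall j a b, step j a b -> K b `<=` O a) ->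
  (forall j a, exists b, step j a b) ->
  exists a : nat -> Pos, [/\ a 0%N = a0, forall j, step j (a j) (a j.+1)
    & exists x, forall j, O (a j) x].
Proof.
move=> hX OK O0 cK sK ex.
have [F HF] := choice (fun ja : nat * Pos => ex ja.1 ja.2).
pose a := fix a (j : nat) : Pos := if j is i.+1 then F (i, a i) else a0.
have sa j : step j (a j) (a j.+1) by exact: (HF (j, a j)).
have Kmono i j : (i <= j)%N -> K (a j) `<=` K (a i).
  move=> /subnK <-; elim: (j - i)%N => [|k IH] //; rewrite addSn.
  by apply: subset_trans IH; apply: subset_trans (OK _); exact: sK (sa _).
have [x Hx] := choice (fun j => O0 (a j)).
have [|y [_ cy]] := cK a0 (x @ \oo) _.
  exists 0%N => // j _ /=; apply: (Kmono 0%N j) => //; exact: OK.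
exists a; split => //; exists y => j.
apply: (sK _ _ _ (sa j)).
have /closure_id -> : closed (K (a j.+1)) by apply: compact_closed.
move=> B By; apply: cy => //.
by exists j.+1 => // k /= jk; apply: (Kmono j.+1 k) => //; exact: OK.
Qed.

Section Denjoy.
Context {R : realType}.

(** N is null, in the form in which it is used: increasing 1-Lipschitz functions of
    arbitrarily small variation that have slope 1 near N. Unlike a formulation by
    primitives from a base point, this one is invariant under reflection, see
    [thin_opp]. *)
Definition thin (p q : R) (N : set R) := forall eps, 0 < eps -> exists (W : R -> R) (U : set R),
  [/\ open U, N `<=` U, forall s, 0 <= W s <= eps,
      forall s t, s <= t -> W s <= W t <= W s + (t - s)
    & forall s t, p < s -> s <= t -> t < q -> `[s, t]%classic `<=` U -> W t = W s + (t - s)].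

Lemma null_thin p q N : lebesgue_measure N = 0%E -> thin p q N.
Proof.
move=> N0 eps eps0; have [U [oU NU Ue]] := null_open_cover eps0 N0.
pose V s := cover_length U p (Num.max p s).
have V0 s : 0 <= V s by exact: cover_length_ge0.
have Ve s : V s <= eps by exact: (cover_length_bound p Ue).
have Vle s t : s <= t -> V s <= V t.
  by move=> st; apply: (cover_length_le p Ue); rewrite ge_max le_max lexx/= le_max st orbT.
have Vl s t : s <= t -> V t <= V s + (t - s).
  move=> st; have pm u : p <= Num.max p u by rewrite le_max lexx.
  have mst : Num.max p s <= Num.max p t by rewrite ge_max le_max lexx/= le_max st orbT.
  apply: le_trans (cover_length_lip oU Ue (pm s) mst) _; rewrite lerD2l.
  by rewrite /Num.max; case: ltP => ?; case: ltP => ?; lra.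
have Vs s t : p < s -> s <= t -> `[s, t]%classic `<=` U -> V t = V s + (t - s).
  move=> ps st stU; rewrite /V !max_r ?(ltW ps)//; last exact: le_trans (ltW ps) st.
  apply: (cover_length_step oU Ue) => //; first exact: ltW.
  by apply: subset_trans stU; apply: subset_itvr; rewrite bnd_simp.
exists V, U; split => //.
- by move=> s; rewrite V0 Ve.
- by move=> s t st; rewrite Vle// Vl.
- by move=> s t ps st _; exact: Vs.
Qed.

Lemma thin_opp p q N : thin p q N -> thin (- q) (- p) [set s | N (- s)].
Proof.
move=> tN eps eps0; have [W [U [oU NU Wb Wl Ws]]] := tN eps eps0.
exists (fun s => eps - W (- s)), (-%R @^-1` U); split.
- by apply: open_comp oU => x _; exact: oppr_continuous.
- by move=> s /= /NU.
- by move=> s; have /andP[h1 h2] := Wb (- s); apply/andP; split; lra.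
- move=> s t st; have := Wl (- t) (- s); rewrite lerN2 => /(_ st)/andP[h1 h2].
  by apply/andP; split; lra.
- move=> s t ps st tq stU.
  have tq' : p < - t by rewrite ltrNr.
  have ps' : - s < q by rewrite ltrNl.
  rewrite (Ws (- t) (- s) tq' _ ps'); [by lra|by rewrite lerN2|].
  move=> u /=; rewrite in_itv/= => /andP[u1 u2]; rewrite -(opprK u); apply: stU.
  by rewrite /= in_itv/= lerNr u2 lerNl.
Qed.

(** Minimal functions over fibres are only known to be lower semicontinuous and to
    have, at each point, an upper first order approximation; these two properties
    are the hypotheses of [denjoy]. *)
Definition lsc_on (h : R -> R) p q := forall s, p < s < q ->
  forall w, w < h s -> \forall t \near s, w < h t.

Definition upper_slope (h slope : R -> R) p q := forall s, p < s < q ->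
  forall eta, 0 < eta ->
  exists2 d, 0 < d & forall t, `|t| < d -> h (s + t) <= h s + slope s * t + eta * `|t|.

Section SupportedPoints.
Variables (h slope : R -> R) (p q e : R).
Hypothesis e0 : 0 < e.
Hypothesis h_lsc : lsc_on h p q.
Hypothesis h_upper : upper_slope h slope p q.

(** The upper approximation gives upper semicontinuity. *)
Lemma upper_continuous s : p < s < q -> {for s, continuous h}.
Proof.
move=> spq; apply/cvgrPdist_lt => eps eps0.
have hl : h s - eps < h s by rewrite ltrBlDr ltrDl.
have [d d0 Hd] := h_upper spq ltr01.
pose d' := Num.min d (eps / (`|slope s| + 1)).
have s1 : 0 < `|slope s| + 1 by rewrite ltr_wpDl.
have d'0 : 0 < d' by rewrite lt_min d0 divr_gt0.
near=> t.
have h1 : h s - eps < h t by near: t; exact: h_lsc.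
have : `|t - s| < d' by rewrite distrC; near: t; exact: cvgr_dist_lt.
rewrite lt_min => /andP[td]; rewrite ltr_pdivlMr// => te.
have := Hd (t - s) td; rewrite subrKC => h2.
have h3 : slope s * (t - s) <= `|t - s| * `|slope s|.
  by apply: le_trans (ler_norm _) _; rewrite normrM mulrC.
rewrite ltr_norml; apply/andP; split; first by rewrite mulrDr mulr1 in te; lra.
by lra.
Unshelve. all: by end_near. Qed.

Lemma segment_min (g : R -> R) x y : p < x -> x <= y -> y < q ->
  (forall s, p < s < q -> {for s, continuous g}) ->
  exists2 s, x <= s <= y & forall t, x <= t <= y -> g s <= g t.
Proof.
move=> px xy yq cg.
have gc : {within `[x, y], continuous g}.
  apply/subspace_continuousP => s; rewrite /= in_itv/= => /andP[xs sy].
  apply: cvg_within_filter; apply: cg.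
  by rewrite (lt_le_trans px)//= (le_lt_trans sy).
have [s + H] := EVT_min xy gc.
by rewrite in_itv/= => sxy; exists s.
Qed.

(** At such a point the slope of h is that of the supporting line. *)
Definition supported (s : R) := p < s < q /\ exists c, `|c| < e /\
  exists2 r, 0 < r & forall t, `|t - s| < r -> h s - c * s <= h t - c * t.

Definition null_slopes := thin p q [set s | p < s < q /\ `|slope s| < e].

Lemma slope_ge s c : p < s < q ->
  (exists2 r, 0 < r & forall t, 0 < t < r -> h s + c * t <= h (s + t)) -> c <= slope s.
Proof.
move=> spq [r r0 H]; apply/ler_addgt0Pr => eta eta0.
have [d d0 Hd] := h_upper spq eta0.
pose t := Num.min d r / 2.
have m0 : 0 < Num.min d r by rewrite lt_min d0.
have t0 : 0 < t by rewrite divr_gt0.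
have td : t < d by apply: lt_le_trans (_ : Num.min d r <= _); rewrite ?ge_min ?lexx// /t; lra.
have tr : t < r by apply: lt_le_trans (_ : Num.min d r <= _); rewrite ?ge_min ?lexx ?orbT// /t; lra.
have := Hd t; rewrite gtr0_norm// => /(_ td) h1.
have h2 := H t; rewrite t0 tr in h2; have {}h2 := h2 isT.
rewrite -(ler_pM2r t0) mulrDl; lra.
Qed.

(** Suppose that at supported points h has left slopes at least - e/2, uniformly. Then
    k1 = h + (3e/4) s increases on the left of z, because a minimum of k1 in the
    interior of [x, z] would be a supported point with left slopes at most - 3e/4.
    Hence slope > - e on the left of z, and slope >= e there outside a null set.
    Neutralizing the null set by W, the function k2 = h - e2 s + 3 e W increases
    for c < e2 < e, so h grows by at least e2 (z - x) up to an arbitrarily small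
    error. This contradicts a supporting line of slope c at z. *)
Lemma left_monotone_absurd a b z : null_slopes -> p <= a -> b <= q -> a < z < b ->
  supported z ->
  (forall s, a < s < b -> supported s -> forall t, 0 < t -> a < s - t ->
     h (s - t) <= h s + e / 2 * t) -> False.
Proof.
have e0' : 0 < e := e0.
move=> Nnull pa bq /andP[az zb] Zz HA.
have [zpq [c [ce [rz rz0 Hz]]]] := Zz.
pose e' := e * 3 / 4.
pose k1 s := h s + e' * s.
have k1c s : p < s < q -> {for s, continuous k1}.
  move=> spq; apply: cvgD; first exact: upper_continuous.
  by apply: cvgMl_tmp; exact: cvg_id.
have k1mono x y : a < x -> x <= y -> y <= z -> k1 x <= k1 y.
  move=> ax xy yz; have xz : x <= z by exact: le_trans yz.
  have px : p < x by exact: le_lt_trans ax.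
  have zq : z < q by exact: lt_le_trans bq.
  have [s /andP[xs sz] Hs] := segment_min px xz zq k1c.
  have k1x := Hs x; rewrite lexx xz in k1x; have {}k1x := k1x isT.
  have bad : supported s -> x < s -> False.
    move=> Zs xs'; have sx0 : 0 < s - x by rewrite subr_gt0.
    have sab : a < s < b by rewrite (lt_trans ax) ?(le_lt_trans sz).
    have := HA s sab Zs (s - x) sx0; rewrite subKr => /(_ ax).
    by have := mulr_gt0 e0 sx0; move: k1x; rewrite /k1 /e'; lra.
  have [sx|xs'] := leP s x.
    have -> : x = s by apply: le_anti; rewrite xs.
    by apply: Hs; rewrite xy.
  exfalso; apply: bad => //.
  have [zs|sz'] := leP z s; first by have -> : s = z by apply: le_anti; rewrite sz.
  split; first by rewrite (lt_trans px) ?(lt_trans sz').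
  exists (- e'); split; first by rewrite normrN /e' ger0_norm; lra.
  exists (Num.min (s - x) (z - s)); first by rewrite lt_min !subr_gt0 xs'.
  move=> t; rewrite lt_min !ltr_norml => /andP[/andP[t1 _] /andP[_ t2]].
  have := Hs t; rewrite /k1 => H.
  have xtz : x <= t <= z by apply/andP; split; lra.
  by have := H xtz; lra.
have slope_gt s : a < s -> s <= z -> - e < slope s.
  move=> as_ sz; have spq : p < s < q by rewrite (le_lt_trans pa)//= (le_lt_trans sz)// (lt_le_trans zb).
  have [zs|sz'] := leP z s.
    have -> : s = z by apply: le_anti; rewrite sz.
    apply: lt_le_trans (_ : c <= _); first by move: ce; rewrite ltr_norml => /andP[].
    apply: slope_ge => //; exists rz => // t /andP[t0 tr].
    by have := Hz (z + t); rewrite addrAC subrr add0r gtr0_norm// => /(_ tr); lra.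
  apply: lt_le_trans (_ : - e' <= _); first by rewrite /e'; lra.
  apply: slope_ge => //; exists (z - s); first by rewrite subr_gt0.
  move=> t /andP[t0 tz]; have := k1mono s (s + t) as_; rewrite /k1.
  have h1 : s <= s + t by rewrite lerDl ltW.
  have h2 : s + t <= z by lra.
  by move=> /(_ h1 h2); lra.
have ce' : c < e by move: ce; rewrite ltr_norml => /andP[].
pose e2 := (c + e) / 2.
have ce2' : c < e2 by rewrite /e2; lra.
have e2e : e2 < e by rewrite /e2; lra.
clearbody e2.
have ce2 : - e < c by move: ce; rewrite ltr_norml => /andP[].
pose x := Num.max ((a + z) / 2) (z - rz / 2).
have xz : x < z by rewrite gt_max; apply/andP; split; lra.
have ax : a < x by rewrite lt_max; apply/orP; left; lra.
have xr : `|x - z| < rz.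
  rewrite ltr0_norm ?subr_lt0// opprB.
  have : z - rz / 2 <= x by rewrite le_max lexx orbT.
  by lra.
have px : p < x by exact: le_lt_trans ax.
have zq : z < q by exact: lt_le_trans bq.
have hx := Hz x xr.
pose eps := (e2 - c) * (z - x) / (6 * e).
have eps0 : 0 < eps.
  by rewrite divr_gt0 ?mulr_gt0 ?subr_gt0.
have [W [U [oU NU Wb Wl Wstep]]] := Nnull eps eps0.
pose k2 s := h s - e2 * s + 3 * e * W s.
have Wlip s t : `|W s - W t| <= `|s - t|.
  wlog st : s t / s <= t => [H|].
    have [st|/ltW ts] := leP s t; first exact: H.
    by rewrite distrC (distrC s); exact: H.
  have /andP[h1 h2] := Wl s t st.
  by rewrite distrC ger0_norm ?subr_ge0// distrC ger0_norm ?subr_ge0// lerBlDl.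
have k2c s : p < s < q -> {for s, continuous k2}.
  move=> spq; apply: cvgD.
    apply: cvgB; first exact: upper_continuous.
    by apply: cvgMl_tmp; exact: cvg_id.
  apply: cvgMl_tmp; apply/cvgrPdist_lt => eta eta0; near=> t.
  apply: le_lt_trans (Wlip _ _) _.
  by near: t; exact: cvgr_dist_lt.
have [s /andP[xs sz] Hs] := segment_min px (ltW xz) zq k2c.
(* the minimum of k2 on [x, z] is at x: near the null set W supplies the slope,
   elsewhere slope >= e > e2 does *)
have sx : s = x.
  apply: le_anti; rewrite xs andbT leNgt; apply/negP => xs'.
  have as_ : a < s by exact: lt_trans xs'.
  have spq : p < s < q by rewrite (lt_trans px)//= (le_lt_trans sz).
  have sl := slope_gt s as_ sz.
  have [Ns|nNs] := pselect (`|slope s| < e).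
    have Us : U s by apply: NU.
    have /nbhs_ballP[r /= r0 Hr] : nbhs s U by exact: open_nbhs_nbhs.
    have [d d0 Hd] := h_upper spq (ltac:(lra) : 0 < e / 2).
    pose t := Num.min (s - x) (Num.min (d / 2) (r / 2)).
    have t0 : 0 < t by rewrite !lt_min subr_gt0 xs' !divr_gt0.
    have tx : t <= s - x by rewrite ge_min lexx.
    have td' : t < d by apply: le_lt_trans (_ : t <= d / 2) (_ : d / 2 < d); [|by rewrite ltr_pdivrMr// ltr_pMr// ltr1n];
      rewrite !ge_min lexx orbT.
    have tr : t <= r / 2 by rewrite !ge_min lexx !orbT.
    have xst : x <= s - t by rewrite lerBrDr -lerBrDl.
    have stz : x <= s - t <= z by rewrite xst (le_trans _ sz)// gerBl ltW.
    have Wst : W s = W (s - t) + t.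
      rewrite (Wstep (s - t) s); [by rewrite subKr|exact: lt_le_trans xst|by rewrite lerBlDr lerDl ltW|by case/andP: spq|].
      move=> u /=; rewrite in_itv/= => /andP[u1 u2]; apply: Hr.
      by rewrite /ball/= ltr_distlC; apply/andP; split; lra.
    have := Hs (s - t) stz.
    rewrite /k2 Wst.
    have := Hd (- t); rewrite normrN gtr0_norm// => /(_ td') h1 h2.
    have h3 : - slope s * t < e * t by rewrite ltr_pM2r// ltrNl.
    have h4 : e2 * t < e * t by rewrite ltr_pM2r.
    have h5 : 0 < e * t by rewrite mulr_gt0.
    move: h1 h2 h3 h4 h5; move: (W (s - t)) (h s) (h (s - t)) (slope s).
    by clear; move=> *; lra.
  have es : e <= slope s.
    rewrite leNgt; apply/negP => se; apply: nNs.
    by rewrite ltr_norml sl.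
  have [d d0 Hd] := h_upper spq (ltac:(by rewrite divr_gt0// subr_gt0) : 0 < (e - e2) / 2).
  pose t := Num.min (s - x) (d / 2).
  have t0 : 0 < t by rewrite !lt_min subr_gt0 xs' !divr_gt0.
  have tx : t <= s - x by rewrite ge_min lexx.
  have td' : t < d by apply: le_lt_trans (_ : t <= d / 2) (_ : d / 2 < d); [|by rewrite ltr_pdivrMr// ltr_pMr// ltr1n];
      rewrite !ge_min lexx orbT.
  have xst : x <= s - t by rewrite lerBrDr -lerBrDl.
    have stz : x <= s - t <= z by rewrite xst (le_trans _ sz)// gerBl ltW.
  have Wst : W (s - t) <= W s.
    by have /andP[] := Wl (s - t) s (ltac:(by rewrite lerBlDr lerDl ltW)).
  have := Hs (s - t) stz.
  rewrite /k2.
  have := Hd (- t); rewrite normrN gtr0_norm// => /(_ td') h1 h2.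
  have h3 : e * t <= slope s * t by rewrite ler_pM2r.
  have h4 : 3 * e * W (s - t) <= 3 * e * W s by rewrite ler_wpM2l ?mulr_ge0 ?(ltW e0')//; have /andP[] := Wb z.
  have h5 : 0 < (e - e2) * t by rewrite mulr_gt0// subr_gt0.
  move: h1 h2 h3 h4 h5; move: (3 * e * W (s - t)) (3 * e * W s) (h s) (h (s - t)) (slope s).
  by clear; move=> *; lra.
have xzz : x <= z <= z by rewrite (ltW xz) lexx.
have := Hs z xzz; rewrite sx /k2.
have Wz : 3 * e * W z <= 3 * e * eps.
  by rewrite ler_wpM2l ?mulr_ge0 ?(ltW e0')//; have /andP[] := Wb z.
have Wx : 0 <= 3 * e * W x by rewrite !mulr_ge0 ?(ltW e0')//; have /andP[] := Wb x.
have ee : 3 * e * eps = (e2 - c) * (z - x) / 2 by rewrite /eps; field; rewrite gt_eqF.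
have e2c : 0 < (e2 - c) * (z - x) by rewrite mulr_gt0 ?subr_gt0.
move: Wz Wx hx e2c; rewrite ee; move: (3 * e * W x) (3 * e * W z) (h x) (h z).
by clear; move=> *; lra.
Unshelve. all: by end_near. Qed.

End SupportedPoints.

(** The reflection of [left_monotone_absurd]. *)
Lemma right_monotone_absurd (h slope : R -> R) (p q e a b z : R) : 0 < e ->
  lsc_on h p q -> upper_slope h slope p q ->
  null_slopes slope p q e -> p <= a -> b <= q -> a < z < b -> supported h p q e z ->
  (forall s, a < s < b -> supported h p q e s -> forall t, 0 < t -> s + t < b ->
     h (s + t) <= h s + e / 2 * t) -> False.
Proof.
move=> e0 hl hu ns pa bq /andP[az zb] Zz HB.
have opp_bnd s : (- q < s < - p) = (p < - s < q) by rewrite ltrNl ltrNr andbC.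
have supp s : supported (h \o -%R) (- q) (- p) e s -> supported h p q e (- s).
  move=> [spq [c [ce [r r0 Hr]]]]; split; first by rewrite -opp_bnd.
  exists (- c); rewrite normrN; split => //; exists r => // t ts.
  have := Hr (- t); rewrite /= opprK.
  have -> : `|- t - s| = `|t - - s| by rewrite opprK -opprD normrN.
  by move=> /(_ ts); lra.
have supp' s : supported h p q e (- s) -> supported (h \o -%R) (- q) (- p) e s.
  move=> [spq [c [ce [r r0 Hr]]]]; split; first by rewrite opp_bnd.
  exists (- c); rewrite normrN; split => //; exists r => // t ts.
  have := Hr (- t); rewrite /=.
  have -> : `|- t - - s| = `|t - s| by rewrite opprK addrC distrC.
  by move=> /(_ ts); lra.
have lo : lsc_on (h \o -%R) (- q) (- p).
  move=> s; rewrite opp_bnd => spq w wh.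
  have c : - t @[t --> s] --> - s by apply: cvgN; exact: cvg_id.
  exact: (c _ (hl _ spq w wh)).
have uo : upper_slope (h \o -%R) (fun s => - slope (- s)) (- q) (- p).
  move=> s; rewrite opp_bnd => spq eta eta0; have [d d0 Hd] := hu _ spq eta eta0.
  exists d => // t td; have := Hd (- t); rewrite normrN => /(_ td) /=.
  by rewrite opprD mulrN mulNr.
apply: (left_monotone_absurd (a := - b) (b := - a) (z := - z) e0 lo uo).
- have := thin_opp ns; congr thin; apply/seteqP; split => s /=;
    by rewrite -opp_bnd normrN.
- by rewrite lerN2.
- by rewrite lerN2.
- by rewrite !ltrN2 zb.
- by apply: supp'; rewrite opprK.
- move=> s /andP[bs sa] /supp Zs t t0 ts /=.
  have est : - (s - t) = - s + t by rewrite opprB addrC.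
  have := HB (- s); rewrite ltrNr sa ltrNl bs => /(_ isT Zs t t0).
  by rewrite -est ltrNl => /(_ ts).
Qed.

(** The analogue, for minimal functions, of the Denjoy property of derivatives. Assume
    that the set in question is null. The minimum z is a supported point, so
    supported points exist. By the two preceding lemmas, every interval around a
    supported point contains supported points where the one-sided uniform bound
    A n fails, and others where its mirror image B n fails. As these failures are
    open conditions, [nested_game] gives a point at which A n and B n fail for all
    n. But every point has slope >= - e/4 or < - e/4, which implies A n or B n for
    large n. *)
Lemma denjoy (h slope : R -> R) (p q e z : R) : 0 < e ->
  lsc_on h p q -> upper_slope h slope p q -> p < z < q ->
  (forall s, p < s < q -> h z <= h s) ->
  (0 < lebesgue_measure [set s | (p < s < q)%R /\ (`|slope s| < e)%R])%E.
Proof.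
move=> e0 hl hu zpq hmin; rewrite lt0e measure_ge0 andbT; apply/eqP => N0.
have ns : null_slopes slope p q e by exact: null_thin.
have Zz : supported h p q e z.
  split => //; exists 0; rewrite normr0; split => //.
  move/andP: zpq => [pz zq].
  exists (Num.min (z - p) (q - z)); first by rewrite lt_min !subr_gt0 pz.
  move=> t; rewrite lt_min !ltr_norml => /andP[/andP[t1 _] /andP[_ t2]].
  by rewrite !mul0r !subr0; apply: hmin; apply/andP; split; lra.
pose ok (ab : R * R) := [/\ p < ab.1, ab.2 < q & exists2 s, ab.1 < s < ab.2 & supported h p q e s].
pose Pos := {ab : R * R | ok ab}.
pose O (a : Pos) := `](sval a).1, (sval a).2[%classic : set R.
pose K (a : Pos) := `[(sval a).1, (sval a).2]%classic : set R.
pose A (n : nat) s := forall t, 0 < t -> t < n.+1%:R^-1 -> p < s - t -> h (s - t) <= h s + e / 2 * t.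
pose B (n : nat) s := forall t, 0 < t -> t < n.+1%:R^-1 -> s + t < q -> h (s + t) <= h s + e / 2 * t.
have hc s : p < s < q -> {for s, continuous h} by exact: (upper_continuous hl hu).
have hcs s r : p < s + r < q -> h (t + r) @[t --> s] --> h (s + r).
  move=> spq; apply: (@continuous_comp _ _ _ (fun t => t + r) h); last exact: hc.
  by apply: cvgD; [exact: cvg_id|exact: cvg_cst].
(* failure of A n is an open condition, h being continuous *)
have notA n s : p < s < q -> ~ A n s -> \forall t \near s, ~ A n t.
  move=> spq /existsNP[r /not_implyP[r0 /not_implyP[rn /not_implyP[psr /negP]]]].
  rewrite -ltNge => hr.
  have srq : p < s - r < q by rewrite psr/=; move/andP: spq => [_]; lra.
  near=> t => /(_ r r0 rn) H.
  have : h t + e / 2 * r < h (t - r).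
    rewrite -subr_gt0; near: t.
    have c : h (t - r) - (h t + e / 2 * r) @[t --> s] --> h (s - r) - (h s + e / 2 * r).
      apply: cvgB; first exact: hcs.
      by apply: cvgD; [exact: hc|exact: cvg_cst].
    by apply: (cvgr_gt _ c); rewrite subr_gt0.
  rewrite ltNge => /negP; apply; apply: H.
  rewrite ltrBrDr; near: t; apply: lt_nbhsr; lra.
have notB n s : p < s < q -> ~ B n s -> \forall t \near s, ~ B n t.
  move=> spq /existsNP[r /not_implyP[r0 /not_implyP[rn /not_implyP[psr /negP]]]].
  rewrite -ltNge => hr.
  have srq : p < s + r < q by rewrite psr andbT; move/andP: spq => [+ _]; lra.
  near=> t => /(_ r r0 rn) H.
  have : h t + e / 2 * r < h (t + r).
    rewrite -subr_gt0; near: t.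
    have c : h (t + r) - (h t + e / 2 * r) @[t --> s] --> h (s + r) - (h s + e / 2 * r).
      apply: cvgB; first exact: hcs.
      by apply: cvgD; [exact: hc|exact: cvg_cst].
    by apply: (cvgr_gt _ c); rewrite subr_gt0.
  rewrite ltNge => /negP; apply; apply: H.
  rewrite -ltrBrDr; near: t; apply: lt_nbhsl; lra.
pose step (n : nat) (a b : Pos) := K b `<=` O a /\ forall s, O b s -> ~ A n s /\ ~ B n s.
have refine (a : Pos) (s : R) (V : set R) : O a s -> supported h p q e s -> nbhs s V ->
    exists b : Pos, K b `<=` O a /\ O b `<=` V.
  have [pa bq _] := svalP a; rewrite /O /= in_itv/= => /andP[as_ sb] Zs.
  move=> /nbhs_ballP[r /= r0 Hr].
  pose d := Num.min (r / 2) (Num.min ((s - (sval a).1) / 2) (((sval a).2 - s) / 2)).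
  have d0 : 0 < d by rewrite !lt_min !divr_gt0// subr_gt0.
  have dr : d <= r / 2 by rewrite ge_min lexx.
  have da : d <= (s - (sval a).1) / 2 by rewrite !ge_min lexx orbT.
  have db : d <= ((sval a).2 - s) / 2 by rewrite !ge_min lexx !orbT.
  have H : ok (s - d, s + d).
    split => /=; [lra|lra|exists s => //].
    by rewrite ltrBlDr ltrDl d0.
  exists (exist ok _ H); split => u; rewrite /K /O /= !in_itv/= => /andP[u1 u2].
    by apply/andP; split; lra.
  by apply: Hr; rewrite /ball/= ltr_distlC; apply/andP; split; lra.
have Opq a s : O a s -> p < s < q.
  have [pa bq _] := svalP a; rewrite /O /= in_itv/= => /andP[as_ sb].
  by apply/andP; split; lra.
have [stp|nstp] := pselect (forall n a, exists b, step n a b).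
  have HP : ok ((p + z) / 2, (z + q) / 2).
    by move/andP: zpq => [pz zq]; split => /=; [lra|lra|exists z => //; apply/andP; split; lra].
  have [||||||a [_ sa [s sO]]] := @nested_game R Pos K O step (exist ok _ HP).
  - exact: Rhausdorff.
  - by move=> a s; rewrite /O /K /= !in_itv/= => /andP[h1 h2]; rewrite !ltW.
  - by move=> a; have [_ _ [s sab _]] := svalP a; exists s; rewrite /O /= in_itv.
  - by move=> a; exact: segment_compact.
  - by move=> n a b [].
  - exact: stp.
  have spq := Opq _ _ (sO 0%N).
  have [sl|sl] := leP (- (e / 4)) (slope s).
    have [d d0 Hd] := hu s spq (e / 4) (ltac:(lra)).
    have [n nd] : exists n : nat, n.+1%:R^-1 < d.
      by have [n] := ltr_add_invr (lt_le_trans d0 (lexx d)); rewrite add0r; exists n.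
    have [+ _] := (sa n).2 s (sO n.+1); apply => t t0 tn _.
    have := Hd (- t); rewrite normrN gtr0_norm// => /(_ (lt_trans tn nd)) h1.
    have h2 : - (e / 4) * t <= slope s * t by rewrite ler_pM2r.
    by move: h1 h2; clear; move=> *; lra.
  have [d d0 Hd] := hu s spq (e / 4) (ltac:(lra)).
  have [n nd] : exists n : nat, n.+1%:R^-1 < d.
    by have [n] := ltr_add_invr (lt_le_trans d0 (lexx d)); rewrite add0r; exists n.
  have [_ +] := (sa n).2 s (sO n.+1); apply => t t0 tn _.
  have := Hd t; rewrite gtr0_norm// => /(_ (lt_trans tn nd)) h1.
  have h2 : slope s * t < - (e / 4) * t by rewrite ltr_pM2r.
  have h3 : 0 < e * t by rewrite mulr_gt0.
  by move: h1 h2 h3; clear; move=> *; lra.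
apply: nstp => n a.
(* on an interval shorter than 1 / (n + 1) the restriction t < 1 / (n + 1) in A n
   and B n is automatic *)
have [s0 s0a Zs0] : exists2 s, O a s & supported h p q e s.
  by have [_ _ [s sab Zs]] := svalP a; exists s; rewrite // /O /= in_itv.
have n0 : (0 : R) < n.+1%:R^-1 / 2 by rewrite divr_gt0 ?invr_gt0 ?ltr0n.
have [a1 [Ka1 Oa1]] := refine a s0 (ball s0 (n.+1%:R^-1 / 2)) s0a Zs0 (nbhsx_ballx _ _ n0).
have short s t : O a1 s -> O a1 t -> `|s - t| < n.+1%:R^-1.
  move=> /Oa1 + /Oa1; rewrite /ball/= => h1 h2.
  rewrite -(subrK s0 s) -addrA; apply: le_lt_trans (ler_normD _ _) _.
  by rewrite distrC [ltRHS]splitr ltrD.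
have Za1 : exists2 s, (sval a1).1 < s < (sval a1).2 & supported h p q e s.
  by have [] := svalP a1.
have pqa1 : p <= (sval a1).1 /\ (sval a1).2 <= q.
  by have [h1 h2 _] := svalP a1; split; exact: ltW.
have inO s : (sval a1).1 < s < (sval a1).2 -> O a1 s by rewrite /O /= in_itv.
have [s1 s1a nA] : exists2 s, O a1 s /\ supported h p q e s & ~ A n s.
  apply: contrapT => H; have [z1 z1a Zz1] := Za1.
  apply: (left_monotone_absurd e0 hl hu ns pqa1.1 pqa1.2 z1a Zz1) => s sa Zs t t0 at_.
  have As : A n s by apply: contrapT => nAs; apply: H; exists s => //; split => //; exact: inO.
  have sta : (sval a1).1 < s - t < (sval a1).2.
    by rewrite at_/=; move/andP: sa => [_]; apply: lt_trans; rewrite ltrBlDr ltrDl.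
  apply: As => //; last by apply: le_lt_trans at_; case: pqa1.
  by have := short _ _ (inO _ sa) (inO _ sta); rewrite subKr gtr0_norm.
have [s1O Zs1] := s1a.
have s1pq := Opq _ _ s1O.
have [a2 [Ka2 Oa2]] := refine a1 s1 _ s1O Zs1 (notA n s1 s1pq nA).
have Za2 : exists2 s, (sval a2).1 < s < (sval a2).2 & supported h p q e s.
  by have [] := svalP a2.
have pqa2 : p <= (sval a2).1 /\ (sval a2).2 <= q.
  by have [h1 h2 _] := svalP a2; split; exact: ltW.
have inO2 s : (sval a2).1 < s < (sval a2).2 -> O a2 s by rewrite /O /= in_itv.
have OK2 s : O a2 s -> O a1 s.
  by move=> Os; apply: Ka2; move: Os; rewrite /O /K /= !in_itv/= => /andP[h1 h2]; rewrite !ltW.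
have OK1 s : O a1 s -> O a s.
  by move=> Os; apply: Ka1; move: Os; rewrite /O /K /= !in_itv/= => /andP[h1 h2]; rewrite !ltW.
have [s2 s2a nB] : exists2 s, O a2 s /\ supported h p q e s & ~ B n s.
  apply: contrapT => H; have [z1 z1a Zz1] := Za2.
  apply: (right_monotone_absurd e0 hl hu ns pqa2.1 pqa2.2 z1a Zz1) => s sa Zs t t0 tb.
  have Bs : B n s by apply: contrapT => nBs; apply: H; exists s => //; split => //; exact: inO2.
  have sta : (sval a2).1 < s + t < (sval a2).2.
    by rewrite tb andbT; move/andP: sa => [+ _]; move/lt_trans; apply; rewrite ltrDl.
  apply: Bs => //; last by apply: lt_le_trans tb _; case: pqa2.
  have := short _ _ (OK2 _ (inO2 _ sta)) (OK2 _ (inO2 _ sa)).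
  by rewrite addrAC subrr add0r gtr0_norm.
have [s2O Zs2] := s2a.
have [a3 [Ka3 Oa3]] := refine a2 s2 _ s2O Zs2 (notB n s2 (Opq _ _ s2O) nB).
exists a3; split; first by move=> u /Ka3 /OK2 /OK1.
move=> u Ou; split; last exact: Oa3.
apply: Oa2; apply: Ka3; move: Ou; rewrite /O /K /= !in_itv/= => /andP[h1 h2].
by rewrite !ltW.
Unshelve. all: by end_near. Qed.

End Denjoy.

(** * Homogeneous boxes and group linear maps *)

Section BoxGeometry.
Context {R : realType} {m n : nat} (G : carnotGroup R m n).
Local Notation E := 'rV[R]_n.
Local Notation "x ** y" := (cg_mul G x y) (at level 40, left associativity).
Local Notation dil := (dilation G).
Local Notation hb := (hbasis G).
Local Notation box := (box G).
Local Notation wprod := (wprod G).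

Lemma box_le r s x : 0 <= r -> r <= s -> box r x -> box s x.
Proof.
move=> r0 rs b j; apply: (le_trans (b j)).
by apply: lerXn2r => //; rewrite nnegrE// (le_trans r0).
Qed.

Lemma boxN r x : box r x -> box r (- x).
Proof. by move=> b j; rewrite mxE normrN. Qed.

Lemma norm_box_ge1 M x : 1 <= M -> `|x| <= M -> box M x.
Proof.
move=> M1 xM j; apply: (le_trans (coord_le_norm x j)); apply: (le_trans xM).
have /andP[d1 _] := cg_deg_bounds G j.
by rewrite -[leLHS]expr1; apply: ler_weXn2l.
Qed.

(** The quasi-triangle inequality. By dilation it reduces to the boundedness of the
    product on the unit ball. *)
Lemma box_mul : exists2 C : R, 1 <= C & forall r x y, 0 < r ->
  box r x -> box r y -> box (C * r) (x ** y).
Proof.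
have [K K0 Klip] := mul_lipschitz G 1.
exists (1 + 2 * K) => [|r x y r0 bx b_y]; first lra.
have rn0 : r != 0 by rewrite gt_eqF.
have unit_norm z : box r z -> `|dil r^-1 z| <= 1.
  move=> bz; apply: (box_norm (G := G)); first by rewrite ler01 lexx.
  by rewrite -(mulVf rn0); apply: box_dil => //; rewrite invr_ge0 ltW.
have nx := unit_norm x bx; have ny := unit_norm y b_y.
have b1 : box (1 + 2 * K) (dil r^-1 x ** dil r^-1 y).
  apply: norm_box_ge1; first lra.
  have := Klip _ _ 0 0 nx ny; rewrite !normr0 !subr0 gmulx0 subr0.
  move=> /(_ ler01 ler01) le1; apply: (le_trans le1).
  apply: (@le_trans _ _ (K * 2)); last lra.
  by rewrite ler_pM2l//; lra.
have := box_dil (ltW r0) b1.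
by rewrite dilM// !dilK// mulrC.
Qed.

Lemma box_near (e : R) : 0 < e -> exists2 d, 0 < d & forall x : E, `|x| < d -> box e x.
Proof.
move=> e0; have m0 : 0 < Num.min e 1 by rewrite lt_min e0 ltr01.
have m1 : Num.min e 1 <= 1 by rewrite ge_min lexx orbT.
exists (Num.min e 1 ^+ cg_step G) => [|x xd]; first exact: exprn_gt0.
apply: (@box_le (Num.min e 1)); [exact: ltW|by rewrite ge_min lexx|] => j.
apply: (le_trans (coord_le_norm x j)); apply: (le_trans (ltW xd)).
have /andP[_ d2] := cg_deg_bounds G j.
by apply: ler_wiXn2l => //; exact: ltW.
Qed.

Lemma cc_dist_near (e : R) : 0 < e -> exists2 d, 0 < d & forall x y : E,
  cc_dist G x y < d -> `|(- x) ** y| <= e.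
Proof.
move=> e0; have [C C0 Cb] := box_cc_dist G.
have m0 : 0 < Num.min e 1 by rewrite lt_min e0 ltr01.
have m1 : Num.min e 1 <= 1 by rewrite ge_min lexx orbT.
exists (Num.min e 1 / C) => [|x y /Cb]; first exact: divr_gt0.
rewrite mulrCA divff ?gt_eqF// mulr1 => /box_norm.
rewrite ltW//= => /(_ m1) le1; apply: (le_trans le1).
by rewrite ge_min lexx.
Qed.

Lemma cc_dist_gt0 x y : x <> y -> 0 < cc_dist G x y.
Proof.
move=> xy; rewrite ltNge; apply/negP => d0; apply: xy.
have nz : (- x) ** y = 0.
  apply/eqP; rewrite -normr_eq0; apply/negPn/negP => np.
  have np' : 0 < `|(- x) ** y| by rewrite lt_neqAle eq_sym np normr_ge0.
  have [d dp /(_ x y)] := cc_dist_near (divr_gt0 np' (ltr0n _ 2)).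
  move=> /(_ (le_lt_trans d0 dp)); lra.
by rewrite -(gmulxK G x y) nz gmulx0.
Qed.

Lemma dil_norm r (x : E) : 0 <= r <= 1 -> `|dil r x| <= r * `|x|.
Proof.
move=> /andP[r0 r1]; apply: norm_le_coord => [|j]; first exact: mulr_ge0.
rewrite mxE normrM; apply: ler_pM => //; last exact: coord_le_norm.
rewrite normrX ger0_norm//.
have /andP[d1 _] := cg_deg_bounds G j.
by rewrite -[leRHS]expr1; apply: ler_wiXn2l.
Qed.

(** The first layer is abelianized: dilating by r and dividing by r leaves the
    horizontal coordinates of the product unchanged, while the product becomes the
    sum as r tends to 0. *)
Lemma hcoord_mul x y j : cg_deg G j = 1%N -> (x ** y) 0 j = x 0 j + y 0 j.
Proof.
move=> dj; apply/eqP; rewrite -subr_eq0 -normr_le0; apply/ler_addgt0Pl => e e0.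
rewrite addr0.
pose N := `|x| + `|y| + 1.
have N0 : 0 < N by rewrite /N; have := normr_ge0 x; have := normr_ge0 y; lra.
have [d d0 dS] := mul_strict G (divr_gt0 e0 N0).
pose r := Num.min 1 (d / (2 * N)).
have r0 : 0 < r by rewrite lt_min ltr01 divr_gt0// mulr_gt0.
have r1 : r <= 1 by rewrite ge_min lexx.
have rN : r * N < d.
  apply: (@le_lt_trans _ _ (d / 2)); last lra.
  rewrite -ler_pdivlMr// ge_min; apply/orP; right.
  by rewrite invfM mulrA.
have small z : `|z| <= N -> `|dil r z| < d.
  move=> zN; apply: le_lt_trans rN; apply: (le_trans (dil_norm _ _)).
    by rewrite ltW.
  by rewrite ler_pM2l.
have xN : `|x| <= N by rewrite /N; have := normr_ge0 y; lra.
have yN : `|y| <= N by rewrite /N; have := normr_ge0 x; lra.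
have := dS _ _ 0 0 (small x xN) (small y yN); rewrite !normr0 !subr0 gmulx0 !subr0.
move=> /(_ d0 d0) le1.
have := le_trans (coord_le_norm _ j) le1.
rewrite -dilM ?gt_eqF// -dilD -dilB mxE dj expr1 !mxE normrM gtr0_norm//.
move=> le2.
rewrite -(ler_pM2l r0); apply: (le_trans le2).
have dd : `|dil r x| + `|dil r y| <= r * N.
  have hx : `|dil r x| <= r * `|x| by apply: dil_norm; rewrite ltW.
  have hy : `|dil r y| <= r * `|y| by apply: dil_norm; rewrite ltW.
  rewrite /N mulrDr mulrDr; lra.
apply: (le_trans (ler_wpM2l _ dd)); first by rewrite divr_ge0 ?ltW.
by rewrite mulrCA -mulrA mulVf ?gt_eqF// mulr1.
Qed.

Definition hidx (i : 'I_m) : 'I_n := widen_ord (cg_hdim_le G) i.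

Lemma deg_hidx i : cg_deg G (hidx i) = 1%N.
Proof. by apply/eqP; rewrite cg_hdim /=. Qed.

Lemma hcoord_group_linear i : group_linear G (fun x => x 0 (hidx i)).
Proof.
split=> [x y|r x r0]; first exact/hcoord_mul/deg_hidx.
by rewrite mxE deg_hidx expr1.
Qed.

Lemma hbE i j : hb i 0 (hidx j) = (i == j)%:R.
Proof.
by rewrite mxE eqxx /= eq_sym; congr (_%:R).
Qed.

Lemma hbZE t i j : (t *: hb i) 0 (hidx j) = t * (i == j)%:R.
Proof. by rewrite mxE hbE. Qed.

Lemma hb_deg i j : cg_deg G j != 1%N -> hb i 0 j = 0.
Proof.
move=> dj; rewrite mxE eqxx /=; case: eqVneq => // ij.
by move: dj; rewrite ij deg_hidx.
Qed.

Lemma hdim_gt0 : exists i : 'I_m, True.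
Proof.
have [//|noi] := pselect (exists i : 'I_m, True); exfalso.
have /eqP : layer (R := R) (cg_deg G) 1 != 0%VS.
  by apply: cg_layer_neq0; rewrite leqnn cg_step_gt0.
apply.
apply/eqP; rewrite -subv0; apply: (layer1_sub (G := G)) => i.
by exfalso; apply: noi; exists i.
Qed.

Section GroupLinear.
Variables (L : E -> R) (gL : group_linear G L).

Lemma group_linear0 : L 0 = 0.
Proof. by have := gL.1 0 0; rewrite gmulx0; move: (L 0) => l h; lra. Qed.

Lemma group_linearN x : L (- x) = - L x.
Proof. by have := gL.1 x (- x); rewrite gmulxN group_linear0; move: (L x) (L (- x)) => a b h; lra. Qed.

Lemma group_linear_hb t i : L (t *: hb i) = t * L (hb i).
Proof.
have pos s : 0 < s -> L (s *: hb i) = s * L (hb i).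
  by move=> s0; rewrite -dil_hbasis gL.2.
case: (ltgtP t 0) => [t0|/pos//|->]; last by rewrite scale0r group_linear0 mul0r.
have := pos (- t); rewrite oppr_gt0 scaleNr group_linearN mulNr => /(_ t0); exact: oppr_inj.
Qed.

Lemma group_linear_wprod w : L (wprod w) = \sum_(p <- w) p.2 * L (hb p.1).
Proof.
elim: w => [|p w IH]; first by rewrite big_nil group_linear0.
by rewrite big_cons -IH /= gL.1 group_linear_hb.
Qed.

Lemma group_linear_box : exists2 C : R, 0 < C & forall r x, 0 < r -> box r x -> `|L x| <= C * r.
Proof.
have [C C0 CP] := chow G.
pose M := \sum_i `|L (hb i)|.
have M0 : 0 <= M by apply: sumr_ge0.
exists ((M + 1) * C) => [|r x r0 /(CP _ _ r0)[w <- lw]]; first by rewrite mulr_gt0//; lra.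
rewrite group_linear_wprod; apply: (le_trans (ler_norm_sum _ _ _)).
apply: (@le_trans _ _ (\sum_(p <- w) (M + 1) * `|p.2|)).
  apply: ler_sum => p _; rewrite normrM mulrC ler_wpM2r//.
  apply: (@le_trans _ _ M); last lra.
  by rewrite /M (bigD1 p.1)//= lerDl sumr_ge0.
by rewrite -mulr_sumr -mulrA ler_wpM2l//; lra.
Qed.

(** L and the right-hand side are both group linear and agree on the letters X_i, and
    every point is the product of a word. In particular a group linear map is
    linear and kills the layers of degree at least 2. *)
Lemma group_linearE x : L x = \sum_i x 0 (hidx i) * L (hb i).
Proof.
have [C C0 CP] := chow G.
have x1 : box (1 + `|x|) x by apply: norm_box_ge1; have := normr_ge0 x; lra.
have r0 : 0 < 1 + `|x| by have := normr_ge0 x; lra.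
have [w <- _] := CP _ _ r0 x1.
elim: w => [|p w IH].
  by rewrite group_linear0 big1 => [|i _]; rewrite ?mxE ?mul0r.
rewrite /= gL.1 group_linear_hb IH.
under [RHS]eq_bigr => i _.
  rewrite (hcoord_mul _ _ (deg_hidx i)) hbZE mulrDl.
  over.
rewrite big_split /=; congr (_ + _); rewrite (bigD1 p.1)//= eqxx mulr1 big1 ?addr0// => i ni.
by rewrite eq_sym (negbTE ni) mulr0 mul0r.
Qed.

Lemma group_linear_lin a x y : L (a *: x + y) = a * L x + L y.
Proof.
rewrite !group_linearE mulr_sumr -big_split; apply: eq_bigr => i _ /=.
by rewrite !mxE mulrDl mulrA.
Qed.

Lemma group_linearZ a x : L (a *: x) = a * L x.
Proof. by rewrite -[a *: x]addr0 group_linear_lin group_linear0 addr0. Qed.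

Lemma group_linear_continuous : continuous L.
Proof.
move=> x; have -> : L = (fun x : E => \sum_i x 0 (hidx i) * L (hb i)).
  by apply/funext => y; exact: group_linearE.
apply: continuous_big => [y|i _ y]; first exact: add_continuous.
apply: (@continuous_comp _ _ _ (fun H : E => H 0 (hidx i)) (fun t : R => t * L (hb i))).
  exact: coord_continuous.
exact: mulrr_continuous.
Qed.

Lemma group_linear_norm x : `|L x| <= (\sum_i `|L (hb i)|) * `|x|.
Proof.
rewrite group_linearE mulr_suml; apply: (le_trans (ler_norm_sum _ _ _)).
by apply: ler_sum => i _; rewrite normrM mulrC ler_wpM2l// coord_le_norm.
Qed.

(** The estimate [group_linear_box] applied to x^-1 y, whose box has radius comparable
    to the distance. *)
Lemma group_linear_cc : exists2 C : R, 0 < C & forall x y, `|L x - L y| <= C * cc_dist G x y.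
Proof.
have [C C0 CL] := group_linear_box.
have [C' C'0 CP] := box_cc_dist G.
exists (C * C') => [|x y]; first exact: mulr_gt0.
apply/ler_addgt0Pl => e e0.
pose rho := cc_dist G x y + e / (C * C').
have rho_gt : cc_dist G x y < rho by rewrite ltrDl divr_gt0// mulr_gt0.
have rho0 : 0 < rho by apply: le_lt_trans rho_gt; exact: cc_dist_ge0.
have := CL _ _ (mulr_gt0 C'0 rho0) (CP _ _ _ rho_gt).
rewrite gL.1 group_linearN -normrN opprD opprK => le1; apply: (le_trans le1).
rewrite mulrA /rho mulrDr mulrCA divff ?mulr1 ?gt_eqF ?mulr_gt0//.
by rewrite addrC.
Qed.

End GroupLinear.
End BoxGeometry.

(** * Pansu differentials *)

Section PansuDerivatives.
Context {R : realType} {m n : nat} (G : carnotGroup R m n).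
Local Notation E := 'rV[R]_n.
Local Notation "x ** y" := (cg_mul G x y) (at level 40, left associativity).
Local Notation dil := (dilation G).
Local Notation hb := (hbasis G).
Local Notation box := (box G).
Local Notation ltrans := (ltrans G).

Lemma approx_is_derive (g : R -> R) (l : R) :
  (forall eta, 0 < eta -> exists2 d, 0 < d &
     forall t, `|t| < d -> `|g t - g 0 - l * t| <= eta * `|t|) ->
  is_derive (0 : R) (1 : R) g l.
Proof.
move=> gl.
have cv : (fun h : R => h^-1 *: ((g \o shift 0) (h *: (1 : R)) - g 0)) @ (0 : R)^' --> l.
  apply/cvgrPdist_le => e e0; have [d d0 dP] := gl _ e0.
  near=> t; rewrite /= addr0 /GRing.scale /= mulr1.
  have t0 : t != 0 by near: t; exact: nbhs_dnbhs_neq.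
  have td : `|t| < d by near: t; apply: dnbhs0_lt.
  have tp : 0 < `|t| by rewrite normr_gt0.
  rewrite -(ler_pM2r tp) -normrM mulrBl mulrAC mulVf// mul1r distrC.
  exact: dP.
apply: DeriveDef; first by apply/cvg_ex; exists l.
exact: cvg_lim cv.
Unshelve. all: by end_near. Qed.

Lemma local_min_derive0 (g : R -> R) (l d : R) : 0 < d ->
  (forall t, `|t| < d -> g 0 <= g t) -> is_derive (0 : R) (1 : R) g l -> l = 0.
Proof.
move=> d0 gmin gl; apply/eqP; rewrite -normr_le0; apply/ler_addgt0Pl => e e0.
rewrite addr0; have [r r0 rP] := is_derive_approx gl e0.
pose t := Num.min d r / 2.
have mdr : 0 < Num.min d r by rewrite lt_min d0 r0.
have [md mr] : Num.min d r <= d /\ Num.min d r <= r.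
  by split; rewrite ge_min lexx ?orbT.
have t0 : 0 < t by rewrite /t; lra.
have td : t < d by rewrite /t; lra.
have tr : t < r by rewrite /t; lra.
have nt : `|t| = t by rewrite gtr0_norm.
have := rP t; rewrite subr0 nt => /(_ tr); rewrite ler_norml => /andP[_ up].
have := rP (- t); rewrite subr0 normrN nt => /(_ tr); rewrite ler_norml => /andP[_ dn].
have g1 : g 0 <= g t by apply: gmin; rewrite nt.
have g2 : g 0 <= g (- t) by apply: gmin; rewrite normrN nt.
rewrite -(ler_pM2r t0) -{1}nt -normrM ler_norml.
move: up dn g1 g2; rewrite mulrN; clear; move: (g 0) (g t) (g (- t)) (l * t) (e * t).
by move=> a b c x y *; apply/andP; split; lra.
Qed.

(** Pansu differentiability with the differential as an argument, and with the distance
    replaced by the radius of boxes: by [cc_dist_box] the distance of h to 0 is at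
    most proportional to the radius of any box containing h. *)
Definition is_pansu (f : E -> R) (x : E) (L : E -> R) := group_linear G L /\
  forall eta, 0 < eta -> exists2 d, 0 < d & forall rho h, 0 < rho -> rho < d ->
    box rho h -> `|f (x ** h) - f x - L h| <= eta * rho.

Lemma pansu_differential f x : pansu_differentiable G f x -> exists L, is_pansu f x L.
Proof.
move=> [L gL /cvgrPdist_lt fL]; exists L; split => // eta eta0.
have [C C0 CP] := cc_dist_box G.
have /nbhs_ballP[d /= d0 dP] : nbhs (0 : E) (fun h => h != 0 ->
    `|0 - (f (x ** h) - f x - L h) / cc_dist G h 0| < eta / C) := fL _ (divr_gt0 eta0 C0).
exists (Num.min d 1) => [|rho h r0]; first by rewrite lt_min d0 ltr01.
rewrite lt_min => /andP[rd r1] bh.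
have [->|/eqP h0] := eqVneq h 0.
  by rewrite gmulx0 (group_linear0 gL) !subrr normr0 mulr_ge0// ltW.
have hd : ball (0 : E) d h.
  rewrite -ball_normE /ball_/= sub0r normrN; apply: le_lt_trans rd.
  by apply: box_norm bh; rewrite !ltW.
have := dP h hd; move/eqP: (h0) => h0' /(_ h0').
have cp := cc_dist_gt0 G h0.
rewrite sub0r normrN normrM normfV (gtr0_norm cp) ltr_pdivrMr// => /ltW le1.
apply: (le_trans le1).
have := CP _ h _ r0 (boxN bh); rewrite gmulxN => le2.
rewrite -mulrA ler_pM2l// mulrC ler_pdivrMr//; lra.
Qed.

(** Along a horizontal line the box of t X has radius comparable to |t|, so the Pansu
    remainder is o(t). *)
Lemma pansu_line f x L (X : E) : is_pansu f x L -> (forall j, cg_deg G j != 1%N -> X 0 j = 0) ->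
  is_derive (0 : R) (1 : R) (fun t : R => f (x ** (t *: X))) (L X).
Proof.
move=> [gL fL] hX; pose M := `|X| + 1.
have M0 : 0 < M by rewrite /M; have := normr_ge0 X; lra.
apply: approx_is_derive => eta eta0.
have [d d0 dP] := fL _ (divr_gt0 eta0 M0).
exists (d / M) => [|t td]; first exact: divr_gt0.
rewrite scale0r gmulx0.
have [->|t0] := eqVneq t 0; first by rewrite scale0r gmulx0 mulr0 !subrr normr0 mulr0.
have tp : 0 < `|t| by rewrite normr_gt0.
rewrite [L X * t]mulrC -(group_linearZ gL); apply: (le_trans (dP (M * `|t|) _ _ _ _)).
- exact: mulr_gt0.
- by rewrite mulrC -ltr_pdivlMr.
- move=> j; rewrite mxE normrM mulrC.
  have [dj|dj] := eqVneq (cg_deg G j) 1%N; last first.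
    by rewrite (hX _ dj) normr0 mul0r exprn_ge0// mulr_ge0// ltW.
  rewrite dj expr1 ler_pM2r//; apply: (le_trans (coord_le_norm _ _)).
  by rewrite /M; lra.
- by rewrite mulrA divfK ?gt_eqF.
Qed.

Lemma hgradient_pansu f x L i : is_pansu f x L -> hgradient G f x 0 i = L (hb i).
Proof.
move=> fL; rewrite mxE /hderive derive1E.
have D := pansu_line fL (hb_deg i); exact: derive_val.
Qed.

Lemma mul_continuous : continuous (fun p : E * E => p.1 ** p.2).
Proof. by move=> p; exact/differentiable_continuous/mul_differentiable. Qed.

Lemma mulr_continuous (x : E) : continuous (fun y : E => x ** y).
Proof.
move=> y; apply: (@continuous_comp _ _ _ (fun y : E => (x, y)) (fun p : E * E => p.1 ** p.2)).
  by apply: differentiable_continuous; apply: differentiable_pair.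
exact: mul_continuous.
Qed.

Lemma pansu_continuous f x L : is_pansu f x L -> {for x, continuous f}.
Proof.
move=> [gL fL]; apply/(@cvgrPdist_lt _ _ _ (nbhs x) (nbhs_filter x)) => e e0.
have [C C0 CL] := group_linear_box gL.
have [d d0 dP] := fL 1 ltr01.
pose rho := Num.min (d / 2) (e / (2 * (C + 1))).
have C1 : 0 < 2 * (C + 1) by lra.
have r0 : 0 < rho by rewrite lt_min !divr_gt0.
have rd : rho < d by rewrite /rho gt_min; apply/orP; left; lra.
have re : rho * (C + 1) < e.
  apply: (@le_lt_trans _ _ (e / 2)); last lra.
  rewrite -ler_pdivlMr; last lra.
  by rewrite ge_min; apply/orP; right; rewrite invfM mulrA.
have [b b0 bP] := box_near G r0.
have /(@cvgrPdist_lt _ _ _ (nbhs x) (nbhs_filter x)) /(_ _ b0) :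
  (fun y : E => (- x) ** y) @ nbhs x --> (- x) ** x by exact: mulr_continuous.
rewrite gmulNx; apply: (@filterS _ (nbhs x) (nbhs_filter x)) => y; rewrite sub0r normrN => /bP bh.
have := dP _ _ r0 rd bh; have := CL _ _ r0 bh; rewrite gmulxK (distrC (f x)).
move: (L _) (f y) (f x) re => l a c re l1 l2.
rewrite (_ : a - c = (a - c - l) + l); last by rewrite subrK.
by apply: le_lt_trans re; apply: (le_trans (ler_normD _ _)); lra.
Qed.

End PansuDerivatives.

(** * Penalized functions and their interior minima *)

Section PenalizedMinima.
Context {R : realType} {m n : nat} (G : carnotGroup R m n).
Local Notation E := 'rV[R]_n.
Local Notation "x ** y" := (cg_mul G x y) (at level 40, left associativity).
Local Notation dil := (dilation G).
Local Notation hb := (hbasis G).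
Local Notation box := (box G).
Local Notation ltrans := (ltrans G).

(** The unit sublevel set [unitK] of this penalty plays the role of the unit ball of a
    homogeneous norm. *)
Definition pen (H : E) : R := \sum_j H 0 j ^+ 2.
Definition dpen (H X : E) : R := \sum_j 2 * H 0 j * ltrans H X 0 j.
Definition unitK : set E := [set H | pen H <= 1].

Lemma pen0 : pen 0 = 0.
Proof. by rewrite /pen big1// => j _; rewrite mxE expr0n. Qed.

Lemma pen_coord (H : E) j : H 0 j ^+ 2 <= pen H.
Proof. by rewrite /pen (bigD1 j)//= lerDl sumr_ge0// => i _; exact: sqr_ge0. Qed.

Lemma unitK_norm (H : E) : unitK H -> `|H| <= 1.
Proof.
move=> HK; apply: norm_le_coord => // j.
rewrite -(@ler_pXn2r _ 2) ?nnegrE// expr1n real_normK ?num_real//.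
exact: le_trans (pen_coord H j) HK.
Qed.

Lemma pen_continuous : continuous pen.
Proof.
apply: continuous_big => [x|j _ H]; first exact: add_continuous.
apply: (@continuous_comp _ _ _ (fun H : E => H 0 j) (fun t : R => t ^+ 2)).
  exact: coord_continuous.
exact: exprn_continuous.
Qed.

Lemma pen_line H X : is_derive (0 : R) (1 : R) (fun t : R => pen (H ** (t *: X))) (dpen H X).
Proof.
have D := is_derive_ltrans G H X.
have Dj j : is_derive (0 : R) (1 : R) (fun t : R => (H ** (t *: X)) 0 j ^+ 2)
    (2 * H 0 j * ltrans H X 0 j).
  have Dc := is_derive_coord j D.
  have := is_deriveX 2 Dc; rewrite scale0r gmulx0 expr1 => Q.
  rewrite -[_ * ltrans H X 0 j]/(GRing.scale (2 * H 0 j) (ltrans H X 0 j : R^o)).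
  by apply: is_derive_ext Q => s; rewrite exprfctE.
rewrite /pen /dpen.
have -> : (fun t : R => \sum_j (H ** (t *: X)) 0 j ^+ 2) =
    \sum_j (fun t : R => (H ** (t *: X)) 0 j ^+ 2).
  by apply/funext => t; rewrite fct_sumE.
exact: is_derive_sum.
Qed.

Lemma dpen_lin H a X Y : dpen H (a *: X + Y) = a * dpen H X + dpen H Y.
Proof.
rewrite /dpen mulr_sumr -big_split; apply: eq_bigr => j _ /=.
by rewrite (ltrans_linear G H a X Y) !mxE; ring.
Qed.

Lemma dpenZ H a X : dpen H (a *: X) = a * dpen H X.
Proof.
rewrite /dpen mulr_sumr; apply: eq_bigr => j _.
by rewrite (linear_funZ (ltrans_linear G H)) mxE mulrCA.
Qed.

(** The bound does not depend on the scale r at which the penalty is used in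
    [penalized]: this is what makes the penalty cheap for the gradient. *)
Lemma dpen_bound : exists2 C : R, 0 < C & forall H i, unitK H -> `|dpen H (hb i)| <= C.
Proof.
have [K K0 KP] := hfields_bounded G.
exists (2 * K * n%:R + 1) => [|H i /unitK_norm H1].
  by rewrite ltr_wpDl// !mulr_ge0// ltW.
have B j : `|ltrans H (hb i) 0 j| <= K.
  apply: (le_trans (coord_le_norm _ _)).
  have := KP H (delta_mx 0 i) H1.
  rewrite (bigD1 i)//= mxE !eqxx scale1r big1 ?addr0; last first.
    by move=> k ki; rewrite mxE (negbTE ki) andbF scale0r.
  rewrite /unorm (bigD1 i)//= mxE !eqxx expr1n big1 ?addr0 ?sqrtr1 ?mulr1//.
  by move=> k ki; rewrite mxE (negbTE ki) andbF expr0n.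
apply: (@le_trans _ _ (\sum_(j < n) 2 * K)); last first.
  by rewrite sumr_const card_ord -mulr_natr; lra.
apply: (le_trans (ler_norm_sum _ _ _)); apply: ler_sum => j _.
rewrite 2!normrM (gtr0_norm (ltr0n R 2)) ler_pM ?mulr_ge0//.
have := le_trans (coord_le_norm H j) H1.
by move: (`|H 0 j|) => z; lra.
Qed.

Lemma unitK_compact : compact unitK.
Proof.
apply: (subclosed_compact _ (@cball_compact R n 1)) => [|H /unitK_norm//].
have -> : unitK = pen @^-1` [set t | t <= 1] by [].
apply: closed_comp; last exact: closed_le.
by move=> H _; exact: pen_continuous.
Qed.

Lemma unitK_interior H X : pen H < 1 ->
  exists2 d, 0 < d & forall t : R, `|t| < d -> unitK (H ** (t *: X)).
Proof.
move=> H1; have := is_derive_continuous (pen_line H X).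
have c0 : 0 < 1 - pen H by lra.
move=> /cvgrPdist_lt /(_ _ c0) /nbhs_ballP[d d0 dP].
exists d => // t td.
have /dP : ball (0 : R) d t by rewrite -ball_normE /ball_/= sub0r normrN.
rewrite /= scale0r gmulx0 /unitK/= distrC ltr_norml => /andP[_]; lra.
Qed.

Lemma unitK_box r H : 0 < r -> unitK H -> box r (dil r H).
Proof.
move=> r0 /unitK_norm /(norm_box G) /(box_dil (ltW r0)).
by rewrite mulr1.
Qed.

(** The function y |-> f(y) - L(y) + th r pen (dil_(1/r) (c^-1 y)), read in the
    coordinate H with y = c ** dil r H. Between the center and the boundary of
    [unitK] the penalty rises by th r, which exceeds the oscillation o(r) of f - L,
    while it changes horizontal derivatives by O(th) only. *)
Definition penalized (f L : E -> R) (c : E) (r th : R) (H : E) : R :=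
  f (c ** dil r H) - L (c ** dil r H) + th * r * pen H.

(** The horizontal line through H becomes, after dilation and translation, the
    horizontal line through y with direction r X. *)
Lemma penalized_line f L0 L c r th H (X : E) : 0 < r -> group_linear G L0 ->
  is_pansu G f (c ** dil r H) L -> (forall j, cg_deg G j != 1%N -> X 0 j = 0) ->
  is_derive (0 : R) (1 : R) (fun t : R => penalized f L0 c r th (H ** (t *: X)))
    (r * (L X - L0 X) + th * r * dpen H X).
Proof.
move=> r0 gL0 fL hX.
have rX j : cg_deg G j != 1%N -> (r *: X) 0 j = 0 by move=> /hX; rewrite mxE => ->; rewrite mulr0.
have D1 := pansu_line fL rX.
have D2 := pen_line H X.
have drX : dil r X = r *: X.
  apply/rowP => j; rewrite !mxE; have [->|/hX ->] := eqVneq (cg_deg G j) 1%N.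
    by rewrite expr1.
  by rewrite !mulr0.
have pt t : c ** dil r (H ** (t *: X)) = c ** dil r H ** (t *: (r *: X)).
  by rewrite dilM ?gt_eqF// gmulA dilZ drX.
have D3 : is_derive (0 : R) (1 : R)
    (fun t : R => L0 (c ** dil r H) + t * (r * L0 X)) (r * L0 X).
  have h1 := is_derive_cst (L0 (c ** dil r H)) (0 : R) (1 : R).
  have h2 := is_derive_scale (r * L0 X : R^o) (0 : R).
  by have := is_deriveD h1 h2; rewrite add0r; apply: is_derive_ext => s.
have h4 := is_deriveZ (th * r) D2.
have := is_deriveD (is_deriveB D1 D3) h4.
rewrite (group_linearZ fL.1) -mulrBr; apply: is_derive_ext => s.
rewrite /penalized pt !fctE; congr (_ - _ + _).
rewrite (gL0.1 (c ** dil r H)); congr (_ + _).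
by rewrite !(group_linearZ gL0).
Qed.

Lemma penalized_critical f L0 L c r th H (X : E) d : 0 < r -> group_linear G L0 ->
  is_pansu G f (c ** dil r H) L -> (forall j, cg_deg G j != 1%N -> X 0 j = 0) ->
  0 < d -> (forall t, `|t| < d ->
    penalized f L0 c r th H <= penalized f L0 c r th (H ** (t *: X))) ->
  L X - L0 X = - (th * dpen H X).
Proof.
move=> r0 gL0 fL hX d0 Hmin; have D := penalized_line th r0 gL0 fL hX.
have := local_min_derive0 d0 _ D; rewrite scale0r gmulx0 => /(_ Hmin) e0.
apply: (mulfI (lt0r_neq0 r0)); apply/eqP; rewrite -subr_eq0 -[eqbRHS]e0; apply/eqP.
by rewrite mulrN opprK mulrCA mulrA.
Qed.

Lemma penalized_continuous f L0 c r th : group_linear G L0 ->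
  (forall H, unitK H -> exists L, is_pansu G f (c ** dil r H) L) ->
  {within unitK, continuous (penalized f L0 c r th)}.
Proof.
move=> gL0 fK; apply: continuous_in_subspaceT => H; rewrite inE => HK.
have cpt : {for H, continuous (fun H : E => c ** dil r H)}.
  apply: (@continuous_comp _ _ _ (dil r) (fun y => c ** y)).
    exact/linear_fun_continuous/dil_linear.
  exact: mulr_continuous.
have [L fL] := fK _ HK.
have c1 : {for H, continuous (fun H => f (c ** dil r H))}.
  by apply: (continuous_comp cpt); exact: pansu_continuous fL.
have c2 : {for H, continuous (fun H => L0 (c ** dil r H))}.
  by apply: (continuous_comp cpt); exact: (group_linear_continuous gL0).
have c3 : {for H, continuous (fun H => th * r * pen H)}.
  apply: (@continuous_comp _ _ _ pen (fun t : R => th * r * t)).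
    exact: pen_continuous.
  exact: mulrl_continuous.
exact: (continuousD (continuousB c1 c2) c3).
Qed.

Lemma open_box (D : set E) a : open D -> D a ->
  exists2 d, 0 < d & forall rho h, 0 < rho -> rho < d -> box rho h -> D (a ** h).
Proof.
move=> oD Da; have : nbhs (a ** 0) D by rewrite gmulx0; exact: open_nbhs_nbhs.
move=> /mulr_continuous /nbhs_ballP[d d0 dP].
exists (Num.min d 1) => [|rho h r0]; first by rewrite lt_min d0 ltr01.
rewrite lt_min => /andP[rd r1] bh; apply: (dP h).
rewrite -ball_normE /ball_/= sub0r normrN; apply: le_lt_trans rd.
by apply: box_norm bh; rewrite !ltW.
Qed.

End PenalizedMinima.

(** * Preimages of open sets under the gradient are not porous *)

Section NotPorous.
Context {R : realType} {m n : nat} (G : carnotGroup R m n).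
Local Notation E := 'rV[R]_n.
Local Notation "x ** y" := (cg_mul G x y) (at level 40, left associativity).
Local Notation dil := (dilation G).
Local Notation hb := (hbasis G).
Local Notation box := (box G).
Local Notation cc := (cc_dist G).
Variables (D : set E) (f : E -> R).
Hypothesis openD : open D.
Hypothesis pansuf : forall x, D x -> pansu_differentiable G f x.

Lemma pansu_oscillation a L eta M : is_pansu G f a L -> 0 < eta -> 0 < M ->
  exists2 d, 0 < d & forall rho h, 0 < rho -> rho < d -> box (M * rho) h ->
    `|f (a ** h) - L (a ** h) - (f a - L a)| <= eta * rho.
Proof.
move=> fL e0 M0; have [d d0 dP] := fL.2 _ (divr_gt0 e0 M0).
exists (d / M) => [|rho h r0 rd bh]; first exact: divr_gt0.
have := dP _ _ (mulr_gt0 M0 r0) _ bh.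
rewrite mulrA divfK ?gt_eqF// mulrC -ltr_pdivlMr// rd => /(_ isT).
by rewrite fL.1.1; move: (f _) (L a) (L h) (f a) => u v w z; rewrite (_ : u - z - w = u - (v + w) - (z - v)); last ring.
Qed.

(** Every ball whose radius is a fixed fraction of its distance to a contains, when it
    is close enough to a, points where the gradient is almost that of f at a.
    Minimize the penalized function with center x over the box of radius
    c1 d(x, a), which lies in the ball. At distance comparable to rho = d(x, a)
    from a, the function f - L0 oscillates by at most eta rho, which is smaller
    than the rise th c1 rho of the penalty; so the minimum is interior, and the
    gradient there differs from that at a by at most th Cp. *)
Lemma gradient_recurrence a lam eps : D a -> 0 < lam -> 0 < eps ->
  exists2 d, 0 < d & forall x, 0 < cc x a -> cc x a < d ->
    exists y, [/\ D y, cc x y < lam * cc x a & `|hgradient G f y - hgradient G f a| < eps].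
Proof.
move=> Da lam0 eps0.
have [L0 fL0] := pansu_differential (pansuf Da).
have [Cm Cm1 CmP] := box_mul G; have [Cb Cb0 CbP] := box_cc_dist G.
have [Cc Cc0 CcP] := cc_dist_box G; have [Cp Cp0 CpP] := dpen_bound G.
have Cm0 : 0 < Cm by lra.
pose th := eps / (2 * Cp); have th0 : 0 < th by rewrite divr_gt0// mulr_gt0.
pose c1 := lam / (2 * Cc); have c10 : 0 < c1 by rewrite divr_gt0// mulr_gt0.
pose N := 2 * Cb + c1; have N0 : 0 < N by rewrite addr_gt0// mulr_gt0.
pose M := Cm * N; have M0 : 0 < M by exact: mulr_gt0.
pose eta := th * c1 / 4; have eta0 : 0 < eta by rewrite divr_gt0// mulr_gt0.
have [d1 d10 d1P] := pansu_oscillation fL0 eta0 M0.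
have [d2 d20 d2P] := open_box G openD Da.
exists (Num.min d1 (d2 / M)) => [|x rho0]; first by rewrite lt_min d10 divr_gt0.
rewrite lt_min ltr_pdivlMr//; set rho := cc x a in rho0 * => /andP[rd1 rd2].
pose r := c1 * rho; have r0 : 0 < r by exact: mulr_gt0.
pose h := - ((- x) ** a).
have xE : x = a ** h by rewrite /h oppM opprK gmulxK.
have bh : box (2 * Cb * rho) h.
  apply: boxN; rewrite -mulrA mulrCA; apply: CbP.
  by rewrite -[cc x a]/rho; lra.
have inbox H : unitK H -> box (M * rho) (h ** dil r H).
  move=> HK; rewrite -mulrA; apply: CmP; first exact: mulr_gt0.
    apply: box_le bh; first by rewrite mulr_ge0 ?mulr_ge0// ltW.
    by rewrite ler_pM2r// lerDl ltW.
  apply: (box_le _ _ (unitK_box G r0 HK)); first exact: ltW.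
  by rewrite /r ler_pM2r// lerDr mulr_ge0 ?ltW.
have xdE H : x ** dil r H = a ** (h ** dil r H) by rewrite gmulA -xE.
have xD H : unitK H -> D (x ** dil r H).
  by move=> /inbox HK; rewrite xdE; apply: d2P HK; rewrite ?mulr_gt0// mulrC.
have osc H : unitK H ->
    `|f (x ** dil r H) - L0 (x ** dil r H) - (f a - L0 a)| <= eta * rho.
  by move=> /inbox HK; rewrite xdE; apply: d1P HK.
have K0 : unitK (0 : E) by rewrite /unitK/= pen0 ler01.
have [Hs] := EVT_min_rV (ex_intro _ (0 : E) K0) (@unitK_compact R n)
  (penalized_continuous (th := th) fL0.1 (fun H HK => pansu_differential (pansuf (xD H HK)))).
rewrite inE => HsK Hmin.
have Hmin' H : unitK H -> penalized G f L0 x r th Hs <= penalized G f L0 x r th H.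
  by move=> HK; apply: Hmin; rewrite inE.
have Hs1 : pen Hs < 1.
  rewrite lt_neqAle; apply/andP; split; last exact: HsK.
  apply/eqP => p1; have := Hmin' _ K0; have := osc _ HsK; have := osc _ K0.
  rewrite /penalized p1 pen0 mulr0 mulr1 addr0 !ler_norml.
  have : th * r = 4 * (eta * rho) by rewrite /eta /r; field.
  have : 0 < eta * rho by exact: mulr_gt0.
  move: (eta * rho) (th * r) (f (x ** _)) (L0 (x ** _)) (f (x ** _)) (L0 (x ** _)) (f a) (L0 a).
  by clear; move=> e t u1 v1 u2 v2 u v *; lra.
exists (x ** dil r Hs); split; first exact: xD.
  apply: (le_lt_trans (CcP _ x _ r0 (unitK_box G r0 HsK))).
  have -> : Cc * r = lam * rho / 2 by rewrite /r /c1; field; rewrite gt_eqF.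
  by have := mulr_gt0 lam0 rho0; lra.
have [L fL] := pansu_differential (pansuf (xD _ HsK)).
apply: (@le_lt_trans _ _ (eps / 2)); last lra.
apply: norm_le_coord => [|i]; first lra.
have subE (u v : 'rV[R]_m) : (u - v) 0 i = u 0 i - v 0 i by rewrite !mxE.
rewrite subE (hgradient_pansu i fL) (hgradient_pansu i fL0).
have [d d0 dP] := unitK_interior G (hb i) Hs1.
rewrite (penalized_critical r0 fL0.1 fL (hb_deg i) d0 (fun t td => Hmin' _ (dP t td))).
rewrite normrN normrM (gtr0_norm th0).
apply: (le_trans (ler_wpM2l (ltW th0) (CpP _ i HsK))).
have -> : th * Cp = eps / 2 by rewrite /th; field; rewrite gt_eqF.
exact: lexx.
Qed.

Lemma gradient_preimage_not_porous (U : set 'rV[R]_m) a : open U ->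
  D a -> U (hgradient G f a) ->
  ~ porous_at cc (D `&` hgradient G f @^-1` U) a.
Proof.
move=> oU Da Ua [lam [/andP[lam0 lam1] [x [xa xcvg xball]]]].
have [eps eps0 epsP] := open_norm_ball oU Ua.
have [d d0 dP] := gradient_recurrence Da lam0 eps0.
move/cvgrPdist_lt: xcvg => /(_ _ d0) [k _ /(_ k (leqnn k))] /=.
rewrite sub0r normrN ger0_norm ?cc_dist_ge0// => kd.
have [y [Dy ly gy]] := dP _ (cc_dist_gt0 G (xa k)) kd.
have : (mball cc (x k) (lam * cc (x k) a) `&` (D `&` hgradient G f @^-1` U)) y.
  by split => //; split => //; exact: epsP.
by rewrite xball.
Qed.

End NotPorous.

(** * Minima over the fibres of a function *)

Section FibreSlopes.
Context {R : realType} {n : nat}.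
Local Notation E := 'rV[R]_n.
Variables (K : set E) (Phi Lam slope : E -> R) (mv : E -> R -> E) (p q e : R) (z : E).

Definition fibre_min (H : E) := K H /\ forall H', K H' -> Lam H' = Lam H -> Phi H <= Phi H'.

Hypothesis compK : compact K.
Hypothesis contPhi : {within K, continuous Phi}.
Hypothesis contLam : continuous Lam.
Hypothesis fibre_neq0 : forall s, p < s < q -> exists2 H, K H & Lam H = s.
Hypothesis mv0 : forall H, mv H 0 = H.
Hypothesis mv_Lam : forall H t, Lam (mv H t) = Lam H + t.
Hypothesis mv_K : forall H, p < Lam H < q -> fibre_min H ->
  exists2 d, 0 < d & forall t, `|t| < d -> K (mv H t).
Hypothesis mv_slope : forall H, p < Lam H < q -> fibre_min H ->
  is_derive (0 : R) (1 : R) (fun t : R => Phi (mv H t)) (slope H).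

(** Phi is continuous on K only, so that preimages of closed sets are closed relative
    to K. *)
Lemma sublevel_closed w : closed [set H | K H /\ Phi H <= w].
Proof.
have clK : closed K by apply: compact_closed => //; exact: norm_hausdorff.
move=> H clH; have KH : K H.
  by apply: clK; apply: closure_subset clH => x [].
split => //; rewrite leNgt; apply/negP => wH.
have /(_ H KH) /cvgrPdist_lt cH := (subspace_continuousP _ _).1 contPhi.
have gap : 0 < Phi H - w by rewrite subr_gt0.
have := cH _ gap; rewrite near_withinE => nH.
have [H' [[KH' wH'] /(_ KH')]] := clH _ nH.
by rewrite /= ltr_norml => /andP[_]; rewrite ltrD2l ltrN2 ltNge wH'.
Qed.

Lemma fibre_min_exists s : p < s < q -> exists2 H, fibre_min H & Lam H = s.
Proof.
move=> psq; have [H0 KH0 LH0] := fibre_neq0 psq.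
pose F := [set H | K H /\ Lam H = s].
have clF : closed F.
  apply: closedI; first by apply: compact_closed => //; exact: norm_hausdorff.
  have -> : (fun H => Lam H = s) = Lam @^-1` [set t | t = s] by [].
  apply: closed_comp => [H _|]; first exact: contLam.
  exact: closed_eq.
have FK : F `<=` K by move=> H [].
have [H + Hmin] := EVT_min_rV (ex_intro F H0 (conj KH0 LH0))
  (subclosed_compact clF compK FK) (continuous_subspaceW FK contPhi).
rewrite inE => -[KH LH]; exists H => //; split => // H' KH' LH'.
by apply: Hmin; rewrite inE; split => //; rewrite LH'.
Qed.

(** The function h(s) = min of Phi over the fibre Lam = s satisfies the hypotheses of
    [denjoy]. It is lower semicontinuous because the sublevel sets of Phi are
    compact and so are their images under Lam. Moving a minimizer transversally to
    the fibres gives competitors for the neighboring fibres, hence the upper first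
    order approximation of h, with slope the derivative of Phi in the transversal
    direction. *)
Lemma fibre_slopes : 0 < e -> K z -> (forall H, K H -> Phi z <= Phi H) -> p < Lam z < q ->
  (0 < lebesgue_measure
    (Lam @` [set H | [/\ fibre_min H, (p < Lam H < q)%R & (`|slope H| < e)%R]]))%E.
Proof.
move=> e0 Kz zmin pzq.
have : forall s, exists H, p < s < q -> fibre_min H /\ Lam H = s.
  move=> s; have [psq|nps] := boolP (p < s < q); last by exists 0.
  by have [H h1 h2] := fibre_min_exists psq; exists H.
move=> /choice[sel selP].
have lsc : lsc_on (Phi \o sel) p q.
  move=> s psq w wlt.
  have cB : compact [set H | K H /\ Phi H <= w].
    by apply: (subclosed_compact (sublevel_closed (w:=w)) compK) => H [].
  have clI : closed (Lam @` [set H | K H /\ Phi H <= w]).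
    apply: compact_closed; first exact: norm_hausdorff.
    by apply: continuous_compact cB; exact: continuous_subspaceT.
  have ns : ~ (Lam @` [set H | K H /\ Phi H <= w]) s.
    move=> [H [KH wH] LH]; have [[_ fm] Ls] := selP _ psq.
    by have := fm H KH; rewrite Ls => /(_ LH); move: wlt => /= /lt_le_trans wl /wl; lra.
  have nC : \forall t \near s, ~ (Lam @` [set H | K H /\ Phi H <= w]) t.
    by have := closed_openC clI; rewrite openE => /(_ s ns).
  have nI : \forall t \near s, p < t < q.
    have /andP[ps sq] := psq.
    near=> t; apply/andP; split; near: t; [exact: lt_nbhsr|exact: lt_nbhsl].
  near=> t; rewrite /= ltNge; apply/negP => htw.
  have ptq : p < t < q by near: t.
  have [[Kt _] Lt] := selP _ ptq.
  have : ~ (Lam @` [set H | K H /\ Phi H <= w]) t by near: t.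
  by apply; exists (sel t).
have up : upper_slope (Phi \o sel) (slope \o sel) p q.
  move=> s psq eta eta0; have [fs Ls] := selP _ psq.
  have pLq : p < Lam (sel s) < q by rewrite Ls.
  have [d1 d10 d1P] := mv_K pLq fs.
  have [d2 d20 d2P] := is_derive_approx (mv_slope pLq fs) eta0.
  have /andP[ps sq] := psq.
  exists (Num.min (Num.min d1 d2) (Num.min (s - p) (q - s))) => [|t].
    by rewrite !lt_min d10 d20 !subr_gt0 ps sq.
  rewrite !lt_min => /andP[/andP[t1 t2] /andP[t3 t4]].
  have := d2P t; rewrite subr0 mv0 => /(_ t2); rewrite ler_norml => /andP[_ ub].
  have pstq : p < s + t < q.
    by move: t3 t4; rewrite !ltr_norml => /andP[? ?] /andP[? ?]; apply/andP; split; lra.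
  have [[_ ft] Lt] := selP _ pstq.
  have := ft _ (d1P t t1); rewrite Lt mv_Lam Ls => /(_ erefl) /= le1.
  by move: le1 ub; move: (Phi _) (Phi _) (Phi _) (slope _ * t) (eta * `|t|) => *; lra.
have zm s : p < s < q -> (Phi \o sel) (Lam z) <= (Phi \o sel) s.
  move=> psq; have [[Ks _] _] := selP _ psq; have [[_ fz] Lz] := selP _ pzq.
  by apply: (@le_trans _ _ (Phi z)); [apply: fz|apply: zmin].
apply: (lt_le_trans (denjoy e0 lsc up pzq zm)).
apply: lebesgue_outer_le => s /= [psq se]; have [fs Ls] := selP _ psq.
by exists (sel s) => //; split => //; rewrite Ls.
Unshelve. all: by end_near. Qed.

End FibreSlopes.

(** * Positive measure of the image under a group linear map *)

Section ImageMeasure.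
Context {R : realType} {m n : nat} (G : carnotGroup R m n).
Local Notation E := 'rV[R]_n.
Local Notation "x ** y" := (cg_mul G x y) (at level 40, left associativity).
Local Notation dil := (dilation G).
Local Notation hb := (hbasis G).
Local Notation box := (box G).
Variables (D : set E) (f : E -> R).
Hypothesis openD : open D.
Hypothesis pansuf : forall x, D x -> pansu_differentiable G f x.

Lemma pen_hb (c : R) i : pen (c *: hb i) = c ^+ 2.
Proof.
rewrite /pen (bigD1 (hidx G i))//= hbZE eqxx mulr1 big1 ?addr0// => j ji.
by rewrite mxE mxE eqxx (negbTE ji) mulr0 expr0n.
Qed.

(** Such combinations are horizontal; those in the kernel of L move points inside
    their fibre. *)
Lemma hb_combination_deg (a b : R) i j k : cg_deg G k != 1%N ->
  (a *: hb i + b *: hb j) 0 k = 0.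
Proof.
have combE (u v : E) : (a *: u + b *: v) 0 k = a * u 0 k + b * v 0 k by rewrite !mxE.
by move=> dk; rewrite combE !hb_deg// !mulr0 addr0.
Qed.

(** Minimize the penalized function with center a over the fibres of
    Lam H = L (a ** dil r H) in [unitK]. For values close to L a, the minimum over
    the fibre is interior, because the fibre meets the region pen <= 1/4. Then the
    derivatives in the horizontal directions of ker L vanish, and with l = L X_i0
    one finds g_j(y) - g_j(a) = (L X_j) slope - th dpen H X_j for all j. So the
    gradient at y is close to that at a as soon as |slope| < e, and [fibre_slopes]
    shows that this happens for a set of values of L of positive measure. *)
Lemma image_measure_gt0 (U : set 'rV[R]_m) (L : E -> R) a : open U ->
  D a -> U (hgradient G f a) -> group_linear G L -> (exists x, L x <> 0) ->
  (0 < lebesgue_measure (L @` (D `&` hgradient G f @^-1` U)))%E.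
Proof.
move=> oU Da Ua gL [x0 Lx0].
have [i0 li0] : exists i0, L (hb i0) != 0.
  have [//|nL] := pselect (exists i0, L (hb i0) != 0); exfalso; apply: Lx0.
  rewrite (group_linearE gL) big1// => i _.
  have [->|li] := eqVneq (L (hb i)) 0; first by rewrite mulr0.
  by exfalso; apply: nL; exists i.
pose l := L (hb i0); have al : 0 < `|l| by rewrite normr_gt0.
pose B := \sum_i `|L (hb i)|.
have lB i : `|L (hb i)| <= B by rewrite /B (bigD1 i)//= lerDl sumr_ge0.
have B0 : 0 < B by apply: lt_le_trans (lB i0).
have [eps eps0 epsP] := open_norm_ball oU Ua.
have [L0 fL0] := pansu_differential (pansuf Da).
have [Cp Cp0 CpP] := dpen_bound G.
pose th := eps / (4 * Cp); have th0 : 0 < th by rewrite divr_gt0// mulr_gt0.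
pose e := eps / (4 * B); have e0 : 0 < e by rewrite divr_gt0// mulr_gt0.
pose beta := `|l| / (2 * (B + 1)).
have B1 : 0 < 2 * (B + 1) by lra.
have beta0 : 0 < beta by rewrite divr_gt0.
have beta1 : beta <= 1 / 2.
  by rewrite ler_pdivrMr//; have := lB i0; rewrite -/l; lra.
have Bbeta : B * beta < `|l| / 2.
  rewrite (_ : B * beta = `|l| / 2 * (B / (B + 1))); last by rewrite /beta; field; lra.
  by rewrite gtr_pMr ?divr_gt0// ltr_pdivrMr; lra.
(* eta is small compared with th beta^2, where beta bounds the distance of the global
   minimum z to the center: this keeps Lam z inside ]p, q[ *)
pose eta := th * beta ^+ 2 / 4.
have b20 : 0 < beta ^+ 2 by exact: exprn_gt0.
have eta0 : 0 < eta by rewrite divr_gt0// mulr_gt0.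
have [d1 d10 d1P] := pansu_oscillation fL0 eta0 ltr01.
have [d2 d20 d2P] := open_box G openD Da.
pose r := Num.min d1 d2 / 2.
have m0 : 0 < Num.min d1 d2 by rewrite lt_min d10.
have r0 : 0 < r by exact: divr_gt0.
have [rd1 rd2] : r < d1 /\ r < d2.
  have : Num.min d1 d2 <= d1 /\ Num.min d1 d2 <= d2 by split; rewrite ge_min lexx ?orbT.
  by move: m0; rewrite /r; move: (Num.min _ _) => w w0 [h1 h2]; split; lra.
have rn0 : r != 0 by rewrite gt_eqF.
have xD H : unitK H -> D (a ** dil r H).
  by move=> HK; apply: d2P (unitK_box G r0 HK).
pose c0 := f a - L0 a.
have osc H : unitK H -> `|f (a ** dil r H) - L0 (a ** dil r H) - c0| <= eta * r.
  by move=> HK; apply: d1P rd1 _ => //; rewrite mul1r; exact: unitK_box.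
pose Phi := penalized G f L0 a r th.
have Phi_ge H : unitK H -> c0 - eta * r + th * r * pen H <= Phi H.
  move=> /osc; rewrite ler_norml /Phi /penalized => /andP[+ _].
  by rewrite lerD2r; clear; move: (f _ - _) (c0) (eta * r) => x y w; lra.
have Phi_le H : unitK H -> Phi H <= c0 + eta * r + th * r * pen H.
  move=> /osc; rewrite ler_norml /Phi /penalized => /andP[_].
  by rewrite lerD2r; clear; move: (f _ - _) (c0) (eta * r) => x y w; lra.
have K0 : unitK (0 : E) by rewrite /unitK/= pen0 ler01.
have contPhi : {within unitK, continuous Phi}.
  exact: penalized_continuous fL0.1 (fun H HK => pansu_differential (pansuf (xD H HK))).
have [z] := EVT_min_rV (ex_intro _ (0 : E) K0) (@unitK_compact R n) contPhi.
rewrite inE => zK zmin0.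
have zmin H : unitK H -> Phi z <= Phi H by move=> HK; apply: zmin0; rewrite inE.
have thr : 0 < th * r by exact: mulr_gt0.
have penz : pen z <= beta ^+ 2.
  have := le_trans (Phi_ge _ zK) (le_trans (zmin _ K0) (Phi_le _ K0)).
  rewrite pen0 mulr0 addr0 => h1.
  rewrite -(ler_pM2l thr).
  have : eta * r = th * r * beta ^+ 2 / 4 by rewrite /eta; field.
  have : 0 < th * r * beta ^+ 2 by exact: mulr_gt0.
  move: h1; move: (th * r * beta ^+ 2) (th * r * pen z) (eta * r) (c0).
  by clear; move=> x y w c *; lra.
have nz : `|z| <= beta.
  apply: norm_le_coord => [|j]; first exact: ltW.
  rewrite -(@ler_pXn2r _ 2) ?nnegrE// ?real_normK ?num_real ?(ltW beta0)//.
  exact: le_trans (pen_coord z j) penz.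
pose Lam H := L (a ** dil r H).
have LamE H : Lam H = L a + r * L H by rewrite /Lam gL.1 gL.2.
pose tau := r * (`|l| / 2).
pose p := L a - tau; pose q := L a + tau.
have Lamz : p < Lam z < q.
  have : `|L z| < `|l| / 2.
    apply: le_lt_trans Bbeta; apply: (le_trans (group_linear_norm gL z)).
    by rewrite -/B ler_pM2l.
  rewrite LamE /p /q /tau ltr_norml => /andP[h1 h2].
  have h3 : r * - (`|l| / 2) < r * L z by rewrite ltr_pM2l.
  have h4 : r * L z < r * (`|l| / 2) by rewrite ltr_pM2l.
  by move: h3 h4; rewrite mulrN; move: (r * _) (r * _) => u v *; apply/andP; split; lra.
have fibre s : p < s < q -> exists2 H, unitK H /\ pen H <= 4^-1 & Lam H = s.
  move=> psq; pose c := (s - L a) / (r * l).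
  have cl : `|c| <= 2^-1.
    rewrite /c normrM normfV normrM (gtr0_norm r0) ler_pdivrMr ?mulr_gt0//.
    move: psq; rewrite ler_norml /p /q /tau.
    rewrite (_ : 2^-1 * (r * `|l|) = r * (`|l| / 2)); last by ring.
    by move: (r * _) => w /andP[? ?]; apply/andP; split; lra.
  have pc : pen (c *: hb i0) <= 4^-1.
    rewrite pen_hb -real_normK ?num_real//.
    rewrite (_ : 4^-1 = 2^-1 ^+ 2); last by field.
    by rewrite ler_pXn2r// nnegrE// invr_ge0.
  exists (c *: hb i0); first by split => //; rewrite /unitK/=; lra.
  rewrite LamE (group_linear_hb gL) /c -/l; field.
  by rewrite rn0 li0.
have interior H : p < Lam H < q -> fibre_min unitK Phi Lam H -> pen H < 1.
  move=> /fibre[H0 [H0K pH0] LH0] [HK Hmin]; rewrite ltNge; apply/negP => H1.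
  have := le_trans (Phi_ge _ HK) (le_trans (Hmin _ H0K LH0) (Phi_le _ H0K)).
  have h1 : th * r * pen H >= th * r by rewrite ler_peMr// ltW.
  have h2 : th * r * pen H0 <= th * r * 4^-1 by rewrite ler_pM2l.
  have h3 : eta * r <= th * r * 16^-1.
    rewrite (_ : eta * r = th * r * (beta ^+ 2 / 4)); last by rewrite /eta; field.
    rewrite ler_pM2l//.
    have : beta ^+ 2 <= (1 / 2) ^+ 2 by rewrite ler_pXn2r// nnegrE// ltW.
    by rewrite (_ : (1 / 2 : R) ^+ 2 = 4^-1); [move: (beta ^+ 2) => w *; lra|field].
  move: h1 h2 h3 thr; move: (th * r * pen H) (th * r * pen H0) (th * r) (eta * r) (c0).
  by clear; move=> x y t w c *; lra.
pose g := hgradient G f.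
(* the normalization makes Lam grow at unit speed along v *)
pose v := (r * l)^-1 *: hb i0.
pose slope H := (g (a ** dil r H) 0 i0 - g a 0 i0) / l + th * dpen G H (hb i0) / l.
have dv j : cg_deg G j != 1%N -> v 0 j = 0 by move=> dj; rewrite mxE hb_deg// mulr0.
have mvL H t : Lam (H ** (t *: v)) = Lam H + t.
  rewrite !LamE gL.1 /v scalerA (group_linear_hb gL) -/l; field.
  by rewrite rn0 li0.
have mvK H : p < Lam H < q -> fibre_min unitK Phi Lam H ->
    exists2 d, 0 < d & forall t : R, `|t| < d -> unitK (H ** (t *: v)).
  by move=> pH fH; apply: unitK_interior; exact: interior.
have mvS H : p < Lam H < q -> fibre_min unitK Phi Lam H ->
    is_derive (0 : R) (1 : R) (fun t : R => Phi (H ** (t *: v))) (slope H).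
  move=> pH [HK _]; have [Ly fLy] := pansu_differential (pansuf (xD _ HK)).
  have := penalized_line th r0 fL0.1 fLy dv.
  rewrite /slope /g (hgradient_pansu _ fLy) (hgradient_pansu _ fL0) /v.
  rewrite (group_linearZ fLy.1) (group_linearZ fL0.1) dpenZ.
  move=> dPhi; apply: is_derive_eq; field.
  by rewrite rn0 li0.
have mv0 (H : E) : H ** ((0 : R) *: v) = H by rewrite scale0r gmulx0.
have contLam : continuous Lam.
  have -> : Lam = (fun=> L a) + ( *%R r \o L) by apply/funext => H; rewrite LamE.
  move=> H; apply: continuousD; first exact: cst_continuous.
  apply: continuous_comp; first exact: (group_linear_continuous gL).
  exact: mulrl_continuous.
have fibre' s : p < s < q -> exists2 H, unitK H & Lam H = s.
  by move=> /fibre[H [HK _] LH]; exists H.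
have := fibre_slopes (mv := fun H t => H ** (t *: v)) (@unitK_compact R n)
  contPhi contLam fibre' mv0 mvL mvK mvS e0 zK zmin Lamz.
move=> pos; apply: (lt_le_trans pos); apply: lebesgue_outer_le.
move=> _ [H [fH pH sH] <-]; have [HK Hmin] := fH.
exists (a ** dil r H) => //; split; first exact: xD.
have eps2 : 0 <= eps / 2 by rewrite divr_ge0 ?(ltW eps0).
apply: epsP; apply: (@le_lt_trans _ _ (eps / 2)).
  2: by rewrite ltr_pdivrMr// ltr_pMr// ltr1n.
apply: (norm_le_coord eps2) => j.
have subE (u w : 'rV[R]_m) : (u - w) 0 j = u 0 j - w 0 j by rewrite !mxE.
rewrite subE.
have [Ly fLy] := pansu_differential (pansuf (xD _ HK)).
(* the projection of X_j to ker L along X_i0 *)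
pose X : E := 1 *: hb j + (- (L (hb j) / l)) *: hb i0.
have [d d0 dP] := unitK_interior G X (interior _ pH fH).
have LX : L X = 0.
  rewrite /X (group_linear_lin gL) (group_linearZ gL) -/l mul1r; field.
  exact: li0.
have Xmin t : `|t| < d -> Phi H <= Phi (H ** (t *: X)).
  move=> td; apply: Hmin; first exact: dP.
  by rewrite !LamE gL.1 (group_linearZ gL) LX mulr0 addr0.
have := penalized_critical r0 fL0.1 fLy (@hb_combination_deg _ _ _ _) d0 Xmin.
rewrite /X (group_linear_lin fLy.1) (group_linear_lin fL0.1) dpen_lin !mul1r.
rewrite (group_linearZ fLy.1) (group_linearZ fL0.1) dpenZ => crit.
move: sH; rewrite /slope /g !(hgradient_pansu _ fLy) !(hgradient_pansu _ fL0).
set sl := (X in `|X|) => sH.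
have -> : Ly (hb j) - L0 (hb j) = L (hb j) * sl - th * dpen G H (hb j).
  rewrite /sl; move: crit; rewrite -/l; move: li0; rewrite -/l.
  move: (Ly (hb j)) (L0 (hb j)) (Ly (hb i0)) (L0 (hb i0)) (dpen G H (hb j))
    (dpen G H (hb i0)) (L (hb j)) (l) => a1 a2 a3 a4 q1 q2 lj w w0 crit.
  have -> : a1 - a2 = (a1 + - (lj / w) * a3 - (a2 + - (lj / w) * a4)) + lj / w * (a3 - a4) by ring.
  by rewrite crit; field.
apply: (le_trans (ler_normB _ _)); rewrite normrM (normrM th) (gtr0_norm th0).
have h1 : `|L (hb j)| * `|sl| <= B * e by apply: ler_pM => //; exact: ltW.
have h2 : th * `|dpen G H (hb j)| <= th * Cp by rewrite ler_pM2l//; exact: CpP.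
apply: (le_trans (lerD h1 h2)).
rewrite (_ : B * e + th * Cp = eps / 2); first exact: lexx.
by rewrite /e /th; field; rewrite !gt_eqF.
Qed.

End ImageMeasure.

(** * Hausdorff measure and Lipschitz images *)

Section HausdorffLipschitz.
Context {R : realType} {M : Type} (d : M -> M -> R) (L : M -> R) (C : R).
Hypothesis C0 : 0 < C.
Hypothesis L_lip : forall x y, `|L x - L y| <= C * d x y.

(** The images of the covering sets need not be measurable, so the countable
    subadditivity of the outer measure is what is needed. *)
Lemma lebesgue_outer_sigma_subadditive (A : (set R)^nat) :
  (lebesgue_measure (\bigcup_k A k) <= \sum_(0 <= k <oo) lebesgue_measure (A k))%E.
Proof. exact: (outer_measure_sigma_subadditive (wlength idfun)^*%mu). Qed.

Lemma mdiam_ge0 A : (0 <= mdiam d A)%E.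
Proof. by apply: ereal_sup_ubound; left. Qed.

(** The image of a set of diameter w lies in a segment of length C w. *)
Lemma image_measure_le_mdiam A : (mdiam d A <= 1)%E ->
  (lebesgue_measure (L @` A) <= C%:E * mdiam d A)%E.
Proof.
move=> dA1; have dfin : mdiam d A \is a fin_num.
  by rewrite ge0_fin_numE ?mdiam_ge0//; apply: le_lt_trans dA1 (ltry _).
rewrite -(fineK dfin); set w := fine _.
have w0 : 0 <= w by rewrite fine_ge0// mdiam_ge0.
have dw x y : A x -> A y -> d x y <= w.
  move=> Ax Ay; rewrite -lee_fin fineK//; apply: ereal_sup_ubound; right.
  by exists x => //; exists y.
have Cw0 : 0 <= C * w by rewrite mulr_ge0// ltW.
have [A0|/set0P[x0 Ax0]] := eqVneq A set0.
  by rewrite A0 image_set0 measure0 -EFinM lee_fin.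
have osc x y : A x -> A y -> L y - C * w <= L x.
  move=> Ax Ay; have := L_lip y x; rewrite ler_norml => /andP[_].
  have := dw y x Ay Ax; rewrite -(ler_pM2l C0); move: (C * _) (C * _) => u v; lra.
have lb : has_inf (L @` A).
  split; first by exists (L x0); exists x0.
  by exists (L x0 - C * w) => _ [y Ay <-]; exact: osc.
pose i := inf (L @` A).
apply: (@le_trans _ _ (lebesgue_measure (`[i, i + C * w]%classic : set R))).
  apply: lebesgue_outer_le => _ [y Ay <-]; rewrite /= in_itv/=; apply/andP; split.
    by apply: inf_lbound; [exact: lb.2|exists y].
  rewrite -lerBlDr; apply: lb_le_inf; first exact: lb.1.
  by move=> _ [x Ax <-]; exact: osc.
rewrite lebesgue_measure_segment ?lerDl//.
by rewrite addrAC subrr add0r EFinM.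
Qed.

Lemma hausdorff1_gt0 S : (0 < lebesgue_measure (L @` S))%E -> (0 < hausdorff1 d S)%E.
Proof.
move=> LS; have b0 : (0 < C^-1%:E * lebesgue_measure (L @` S))%E.
  by rewrite mule_gt0// lte_fin invr_gt0.
apply: (lt_le_trans b0); apply: (@le_trans _ _ (hausdorff1_pre d 1 S)); last first.
  by apply: ereal_sup_ubound; exists 1 => //=.
apply: le_ereal_inf_tmp => _ [A [SA A1 ->]].
rewrite -[leRHS]mul1e (_ : 1%E = (C^-1 * C)%:E); last by rewrite mulVf ?gt_eqF.
rewrite EFinM -muleA.
rewrite lee_pmul2l ?lte_fin ?invr_gt0//.
rewrite -nneseriesZl; last by move=> k _; exact: mdiam_ge0.
apply: (@le_trans _ _ (lebesgue_measure (\bigcup_k (L @` A k)))).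
  by apply: lebesgue_outer_le => _ [x /SA[k _ Ak] <-]; exists k => //; exists x.
apply: (le_trans (lebesgue_outer_sigma_subadditive _)).
apply: lee_nneseries => [k _ _|k _]; first exact: measure_ge0.
exact: image_measure_le_mdiam.
Qed.

End HausdorffLipschitz.

(** * Preimages of open sets under the gradient are not sigma-porous *)

Section NotSigmaPorous.
Context {R : realType} {m n : nat} (G : carnotGroup R m n).
Local Notation E := 'rV[R]_n.
Local Notation "x ** y" := (cg_mul G x y) (at level 40, left associativity).
Local Notation hb := (hbasis G).
Local Notation box := (box G).
Local Notation cc := (cc_dist G).
Variables (D : set E) (f : E -> R).
Hypothesis openD : open D.
Hypothesis pansuf : forall x, D x -> pansu_differentiable G f x.
Local Notation g := (hgradient G f).

(** Porosity passes to any set in which P is dense, with a smaller constant: a point of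
    S in the smaller ball would have points of P nearby, and these would lie in the
    larger ball by the quasi-triangle inequality. *)
Lemma lporous_dense (P S : set E) l a : 0 < l < 1 ->
  (forall y e, S y -> 0 < e -> exists2 w, P w & `|w - y| < e) ->
  lporous_at cc P l a -> porous_at cc S a.
Proof.
move=> /andP[l0 l1] dense [x [xa xcvg xball]].
have [Cm Cm1 CmP] := box_mul G; have [Cb Cb0 CbP] := box_cc_dist G.
have [Cc Cc0 CcP] := cc_dist_box G.
have Cm0 : 0 < Cm by lra.
pose C := Cc * (Cm * Cb); have C0 : 0 < C by rewrite !mulr_gt0.
pose l' := l / (1 + C); have C1 : 0 < 1 + C by lra.
have l'0 : 0 < l' by rewrite divr_gt0.
have l'l : C * l' < l.
  rewrite /l' mulrCA gtr_pMr// ltr_pdivrMr//; lra.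
exists l'; split.
  by rewrite l'0 /= ltr_pdivrMr//; lra.
exists x; split => // k; apply/seteqP; split => // y [/= By Sy].
pose rho := cc (x k) a; have dk : 0 < rho by exact: cc_dist_gt0.
move: By; rewrite -/rho => By.
have r0 : 0 < Cb * (l' * rho) by apply: mulr_gt0 => //; exact: mulr_gt0.
have [e e0 eP] := box_near G r0.
have /(@cvgrPdist_lt _ _ _ (nbhs y) (nbhs_filter y)) /(_ _ e0) :
  (fun w : E => (- y) ** w) @ nbhs y --> (- y) ** y by exact: mulr_continuous.
rewrite gmulNx => /nbhs_ballP[e' e'0 e'P].
have [w Pw wy] := dense y e' Sy e'0.
have bw : box (Cb * (l' * rho)) ((- y) ** w).
  apply: eP; have /e'P : ball y e' w by rewrite -ball_normE /ball_/= distrC.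
  by rewrite /= sub0r normrN.
have := CmP _ _ _ r0 (CbP _ _ _ By) bw.
rewrite -gmulA gmulxK => bxw.
have : cc (x k) w < l * rho.
  have := CcP _ (x k) _ (mulr_gt0 Cm0 r0) bxw.
  rewrite gmulxK => /le_lt_trans; apply.
  rewrite (_ : Cc * _ = C * l' * rho); last by rewrite /C; ring.
  by rewrite ltr_pM2r.
move=> xw; have : (mball cc (x k) (l * cc (x k) a) `&` P) w by split.
by rewrite xball.
Qed.

(** A position of the game: a closed ball in D, and a ball of values that the gradient
    takes somewhere in it. The preimage of the second ball in the first one, called
    a slab, is not porous at any of its points. *)
Record position := Position {
  ctr : E ; rad : R ; val : 'rV[R]_m ; tol : R ;
  rad_gt0 : 0 < rad ;
  tol_gt0 : 0 < tol ;
  position_sub : forall w, `|w - ctr| <= rad -> D w ;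
  position_neq0 : exists2 y, `|y - ctr| < rad & `|g y - val| < tol }.

Definition slab (a : position) : set E :=
  [set y | `|y - ctr a| < rad a /\ `|g y - val a| < tol a].

(** Otherwise P would be dense in the slab of a and contain a point of it. The slab
    would then be porous at this point by [lporous_dense], contrary to
    [gradient_preimage_not_porous]. *)
Lemma avoid_porous (P : set E) (a : position) : porous cc P ->
  exists2 y, slab a y & exists s rho, [/\ 0 < s, 0 < rho &
    forall w, `|w - y| < s -> `|g w - g y| < rho -> ~ P w].
Proof.
move=> [l [l01 porP]]; apply: contrapT => noy.
have dense y s : slab a y -> 0 < s -> exists2 w, P w & `|w - y| < s /\ slab a w.
  move=> ay s0; have [ya gya] := ay.
  apply: contrapT => now; apply: noy; exists y => //.
  exists (Num.min s (rad a - `|y - ctr a|)), (tol a - `|g y - val a|).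
  split => [||w]; [by rewrite lt_min s0 subr_gt0|by rewrite subr_gt0|].
  rewrite lt_min => /andP[ws wr] wt Pw; apply: now.
  exists w; [exact: Pw|split; [exact: ws|split]].
    rewrite -(subrKA y); apply: (le_lt_trans (ler_normD _ _)).
    by rewrite -ltrBrDr.
  rewrite -(subrKA (g y)); apply: (le_lt_trans (ler_normD _ _)).
  by rewrite -ltrBrDr.
have [y ya gya] := position_neq0 a.
have [z Pz [_ za]] := dense y 1 (conj ya gya) ltr01.
have Da : open (D `&` [set w | `|w - ctr a| < rad a]).
  apply: openI => //; have := ball_open (ctr a) (rad a).
  by congr open; apply/seteqP; split => w; rewrite -ball_normE /ball_/= distrC.
have oV : open [set v | `|v - val a| < tol a].
  have := ball_open (val a) (tol a).
  by congr open; apply/seteqP; split => w; rewrite -ball_normE /ball_/= distrC.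
have slabE : slab a = (D `&` [set w | `|w - ctr a| < rad a]) `&` g @^-1` [set v | `|v - val a| < tol a].
  apply/seteqP; split => w [h1 h2]; split => //; last by case: h1.
  by split => //; apply: (position_sub (p := a)); exact: ltW.
have := @gradient_preimage_not_porous R m n G _ f Da _ _ z oV.
rewrite -slabE; apply.
- by move=> x [Dx _]; exact: pansuf.
- by move: za; rewrite slabE => -[].
- by case: za.
- apply: lporous_dense (porP _ Pz); first exact: l01.
  by move=> w e wa e0; have [v Pv [vw _]] := dense w e wa e0; exists v.
Qed.

(** The gradient is not continuous, so that convergence of points of slabs says nothing
    about their gradients. Difference quotients with a fixed step are continuous
    and do pass to the limit. *)
Definition dquot (t : R) (y : E) (i : 'I_m) : R := (f (y ** (t *: hb i)) - f y) / t.

Lemma dquot_cvg y i e : D y -> 0 < e ->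
  exists2 d, 0 < d & forall t, 0 < t -> t < d -> `|dquot t y i - g y 0 i| < e.
Proof.
move=> Dy e0; have [L fL] := pansu_differential (pansuf Dy).
have [d d0 dP] := is_derive_approx (pansu_line fL (hb_deg i)) (divr_gt0 e0 (ltr0n R 2)).
exists d => // t t0 td; rewrite (hgradient_pansu _ fL).
have := dP t; rewrite subr0 (gtr0_norm t0) scale0r gmulx0 => /(_ td) le1.
have : `|dquot t y i - L (hb i)| <= e / 2.
  rewrite -(ler_pM2r t0) -[X in _ * X <= _](gtr0_norm t0) -normrM mulrBl /dquot.
  by rewrite divfK ?gt_eqF.
by lra.
Qed.

Lemma dquot_near t y i e : D y -> D (y ** (t *: hb i)) -> 0 < e ->
  \forall w \near y, `|dquot t w i - dquot t y i| < e.
Proof.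
move=> Dy Dyt e0; have [L fL] := pansu_differential (pansuf Dy).
have [L' fL'] := pansu_differential (pansuf Dyt).
have c2 : {for y, continuous (fun w => f (w ** (t *: hb i)))}.
  apply: (@continuous_comp _ _ _ (fun w : E => w ** (t *: hb i)) f); last exact: pansu_continuous fL'.
  apply: (@continuous_comp _ _ _ (fun w : E => (w, t *: hb i)) (fun p : E * E => p.1 ** p.2)).
    by apply: differentiable_continuous; apply: differentiable_pair.
  exact/differentiable_continuous/mul_differentiable.
have c3 : {for y, continuous (fun w => dquot t w i)}.
  apply: (@continuous_comp _ _ _ (fun w => f (w ** (t *: hb i)) - f w) (fun u : R => u / t)).
    exact: (continuousB c2 (pansu_continuous fL)).
  exact: mulrr_continuous.
move: c3 => /(@cvgrPdist_lt _ _ _ (nbhs y) (nbhs_filter y)) /(_ _ e0).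
by apply: (@filterS _ (nbhs y) (nbhs_filter y)) => w; rewrite distrC.
Qed.

Definition kball (a : position) : set E := [set y | `|y - ctr a| <= rad a].
Definition oball (a : position) : set E := [set y | `|y - ctr a| < rad a].

Lemma kball_compact a : compact (kball a).
Proof.
have -> : kball a = (fun x => x + ctr a) @` cball (n := n) (rad a).
  apply/seteqP; split => [y ya|_ [x xr <-]]; last by rewrite /kball/= addrK.
  by exists (y - ctr a); rewrite ?subrK.
apply: continuous_compact; last exact: cball_compact.
apply: continuous_subspaceT => x.
apply: (@continuousD R E E id (fun=> ctr a)); [exact: cvg_id|exact: cst_continuous].
Qed.

(** The j-th move avoids P_j. It also fixes a step t < 1 / (j + 1) for which the
    difference quotients are close to [val a] on the whole new ball; at the point
    common to all balls, the gradient is then a limit of quotients lying in the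
    balls of values. *)
Definition game_step (P : nat -> set E) (j : nat) (a b : position) : Prop :=
  [/\ kball b `<=` oball a,
      forall v, `|v - val b| <= tol b -> `|v - val a| < tol a,
      exists t, [/\ 0 < t, t < j.+1%:R^-1 &
        forall w i, kball b w -> `|dquot t w i - val a 0 i| <= tol a]
    & slab b `&` P j = set0].

(** The quotients at y converge to the gradient at y, which is in the open ball of
    values of a; after fixing the step, continuity extends the estimate to a ball
    around y. *)
Lemma game_step_exists P j a : porous cc (P j) -> exists b, game_step P j a b.
Proof.
move=> porP; have [y [ya gya] [s [rho [s0 rho0 avoid]]]] := avoid_porous a porP.
have Dy : D y by apply: (position_sub (p := a)); exact: ltW.
pose e := tol a - `|g y - val a|; have e0 : 0 < e by rewrite subr_gt0.
have /choice[d dP] : forall i, exists d, 0 < d /\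
    forall t, 0 < t -> t < d -> `|dquot t y i - g y 0 i| < e / 2.
  by move=> i; have [d d0 dP] := dquot_cvg i Dy (divr_gt0 e0 (ltr0n _ 2)); exists d.
have [d1 d10 d1P] : exists2 d1, 0 < d1 & forall h, `|h| < d1 -> D (y ** h).
  have [d0 d00 d0P] := open_box G openD Dy.
  have d02 : 0 < d0 / 2 by exact: divr_gt0.
  have [d1 d10 d1P] := box_near G d02.
  exists d1 => // h hd; apply: d0P d02 _ (d1P _ hd).
  by rewrite ltr_pdivrMr// ltr_pMr// ltr1n.
have [t [t0 tj tP]] : exists t, [/\ 0 < t, t < j.+1%:R^-1 &
    forall i, D (y ** (t *: hb i)) /\ `|dquot t y i - g y 0 i| < e / 2].
  have N0 i : 0 < `|hb i| + 1 by rewrite ltr_wpDl.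
  have nt : \forall t \near (0 : R)^'+, forall i, t < d i /\ t < d1 / (`|hb i| + 1).
    apply: filter_forall => i.
    near=> t; split; near: t; apply: nbhs_right_lt; last exact: divr_gt0.
    by case: (dP i).
  near ((0 : R)^'+) => t; exists t.
  have t0 : 0 < t by near: t; exact: nbhs_right_gt.
  have tP : forall i, t < d i /\ t < d1 / (`|hb i| + 1) by near: t.
  have tj : t < j.+1%:R^-1 by near: t; apply: nbhs_right_lt; rewrite invr_gt0.
  split; [exact: t0|exact: tj|move=> i].
  have [td tn] := tP i; split; last by have [_] := dP i; apply.
  apply: d1P; rewrite normrZ (gtr0_norm t0).
  move: tn; rewrite ltr_pdivlMr//; apply: le_lt_trans.
  by rewrite ler_pM2l// lerDl.
have : \forall w \near y, forall i, `|dquot t w i - dquot t y i| < e / 2.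
  apply: (filter_forall (nbhs_filter y)) => i.
  by apply: dquot_near => //; [case: (tP i)|exact: divr_gt0].
move=> /nbhs_ballP[r r0 rP].
pose s' := Num.min (Num.min (r / 2) s) ((rad a - `|y - ctr a|) / 2).
have rad0 : 0 < rad a - `|y - ctr a| by rewrite subr_gt0.
have s'0 : 0 < s' by rewrite !lt_min s0 !divr_gt0.
have s's : s' <= s by rewrite /s' !ge_min lexx ?orbT.
have s'r : s' < r.
  by apply: (@le_lt_trans _ _ (r / 2)); [rewrite /s' !ge_min lexx|move: r0 => /= r0; lra].
have s'rad : s' < rad a - `|y - ctr a|.
  apply: (@le_lt_trans _ _ ((rad a - `|y - ctr a|) / 2)); last lra.
  by rewrite /s' ge_min lexx orbT.
pose rho' := Num.min rho (e / 2).
have rho'0 : 0 < rho' by rewrite lt_min rho0 divr_gt0.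
have inside w : `|w - y| <= s' -> `|w - ctr a| < rad a.
  by move=> wy; have := ler_normD (w - y) (y - ctr a); rewrite subrKA; lra.
have sub w : `|w - y| <= s' -> D w.
  by move=> /inside wr; apply: (position_sub (p := a)); exact: ltW.
have neq0 : exists2 x, `|x - y| < s' & `|g x - g y| < rho'.
  by exists y; rewrite subrr normr0.
exists (Position s'0 rho'0 sub neq0); split => /=.
- by move=> w; exact: inside.
- move=> v vy; have : rho' <= e / 2 by rewrite /rho' ge_min lexx orbT.
  by have := ler_normD (v - g y) (g y - val a); rewrite subrKA /e; move: e0; rewrite /e; lra.
- exists t; split => // w i wy.
  have h1 : `|dquot t w i - dquot t y i| < e / 2.
    by apply: rP; rewrite -ball_normE /ball_/= distrC; exact: le_lt_trans s'r.
  have [_ h2] := tP i.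
  have h3 : `|g y 0 i - val a 0 i| <= `|g y - val a|.
    have -> : g y 0 i - val a 0 i = (g y - val a) 0 i by rewrite !mxE.
    exact: coord_le_norm.
  rewrite (_ : dquot t w i - val a 0 i = (dquot t w i - dquot t y i) +
    (dquot t y i - g y 0 i) + (g y 0 i - val a 0 i)); last by ring.
  apply: (le_trans (ler_normD _ _)).
  have := ler_normD (dquot t w i - dquot t y i) (dquot t y i - g y 0 i).
  by move: h1 h2 h3; rewrite /e; lra.
- apply/seteqP; split => // w [[/= wy gw] Pw]; apply: (avoid w) => //.
    exact: lt_le_trans s's.
  by apply: (lt_le_trans gw); rewrite /rho' ge_min lexx.
Unshelve. all: by end_near. Qed.

(** Playing the game against the sequence P produces a point x of all balls whose
    gradient is in all balls of values. So x lies in all slabs, hence in the given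
    set, and in none of the P_k. *)
Lemma gradient_preimage_not_sigma_porous (U : set 'rV[R]_m) (T : set E) y0 :
  open T -> open U -> T y0 -> D y0 -> U (g y0) ->
  ~ sigma_porous cc (T `&` (D `&` g @^-1` U)).
Proof.
move=> oT oU Ty0 Dy0 Uy0 [P [porP SP]].
have [r r0 rP] := open_norm_ball (openI openD oT) (conj Dy0 Ty0).
have [e e0 eP] := open_norm_ball oU Uy0.
have rad0 : 0 < r / 2 by exact: divr_gt0.
have inball w : `|w - y0| <= r / 2 -> (D `&` T) w.
  move=> wy; apply: rP; apply: (le_lt_trans wy).
  by rewrite ltr_pdivrMr// ltr_pMr// ltr1n.
have sub w : `|w - y0| <= r / 2 -> D w by move=> /inball[].
have neq0 : exists2 y, `|y - y0| < r / 2 & `|g y - g y0| < e.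
  by exists y0; rewrite subrr normr0.
have O_sub_K a : oball a `<=` kball a by move=> y /ltW.
have O_neq0 a : oball a !=set0 by exists (ctr a); rewrite /oball/= subrr normr0 rad_gt0.
have step_sub j a b : game_step P j a b -> kball b `<=` oball a by case.
have [a [a0 step [x xO]]] := nested_game (Position rad0 e0 sub neq0)
  (@norm_hausdorff R E) O_sub_K O_neq0 kball_compact step_sub
  (fun j a => game_step_exists a (porP j)).
have Dx : D x by apply: (position_sub (p := a 0%N)); apply: ltW; exact: xO.
(* the closed balls of values decrease *)
have nest j k v : (j <= k)%N -> `|v - val (a k)| <= tol (a k) -> `|v - val (a j)| <= tol (a j).
  elim: k => [|k IH]; first by rewrite leqn0 => /eqP->.
  rewrite leq_eqVlt => /orP[/eqP->//|jk] vk; apply: (IH jk).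
  by have [_ /(_ _ vk) /ltW] := step k.
have close j : `|g x - val (a j)| <= tol (a j).
  apply: norm_le_coord => [|i]; first exact/ltW/tol_gt0.
  rewrite leNgt; apply/negP => far.
  have subE (u w : 'rV[R]_m) : (u - w) 0 i = u 0 i - w 0 i by rewrite !mxE.
  rewrite subE in far.
  have gap : 0 < `|g x 0 i - val (a j) 0 i| - tol (a j) by rewrite subr_gt0.
  have [d d0 dP] := dquot_cvg i Dx gap.
  have [N jN Nd] : exists2 N, (j <= N)%N & N.+1%:R^-1 < d.
    have /cvgrPdist_lt /(_ _ d0) [k _ kd] := @cvg_harmonic R.
    exists (maxn j k); first exact: leq_maxl.
    by have := kd _ (leq_maxr j k); rewrite /= sub0r normrN gtr0_norm ?invr_gt0.
  have [_ _ [t [t0 tN tP]] _] := step N.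
  have tN' k : `|dquot t x k - val (a N) 0 k| <= tol (a N).
    by apply: tP; apply: ltW; exact: xO.
  have close_t : `|dquot t x i - val (a j) 0 i| <= tol (a j).
    pose w : 'rV[R]_m := \row_i dquot t x i.
    have wN : `|w - val (a N)| <= tol (a N).
      apply: norm_le_coord => [|k]; first exact/ltW/tol_gt0.
      by rewrite 2!mxE [(- val _) _ _]mxE; exact: tN'.
    have := le_trans (coord_le_norm _ i) (nest _ _ _ jN wN).
    by rewrite subE mxE.
  have := dP t t0 (lt_trans tN Nd).
  have := ler_distD (dquot t x i) (g x 0 i) (val (a j) 0 i).
  by rewrite (distrC (g x 0 i) (dquot t x i)); lra.
have inslab j : slab (a j) x.
  split; first exact: xO.
  by have [_ /(_ _ (close j.+1))] := step j.
have Sx : (T `&` (D `&` g @^-1` U)) x.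
  have := inslab 0%N; rewrite a0 => -[/= xy gx]; have [_ Tx] := inball _ (ltW xy).
  by split => //; split => //; exact: eP.
move: Sx; rewrite SP => -[k _ Pk]; have [_ _ _ avoid] := step k.
have : (slab (a k.+1) `&` P k) x by split => //; exact: inslab.
by rewrite avoid.
Qed.

End NotSigmaPorous.

(** * Porosity and size of gradient preimages *)

Unset Implicit Arguments.

(* [lebesgue_measure] is defined on all subsets of R, as the Lebesgue outer
   measure; it is applied below without asserting that the image is
   measurable. *)
Theorem theorem5p2 (R : realType) (m n : nat) (G : carnotGroup R m n)
    (D : set 'rV[R]_n) (f : 'rV[R]_n -> R) (U : set 'rV[R]_m)
    (openD : open D)
    (pansuf : forall x, D x -> pansu_differentiable G f x)
    (openU : open U)
    (nonempty : (D `&` hgradient G f @^-1` U) !=set0) :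
  let S := D `&` hgradient G f @^-1` U in
  [/\ forall x, S x -> ~ porous_at (cc_dist G) S x,
      forall T : set 'rV[R]_n, open T -> (T `&` S) !=set0 ->
        (forall L : 'rV[R]_n -> R, group_linear G L -> (exists x, L x <> 0) ->
           (0 < lebesgue_measure (L @` (T `&` S)))%E)
        /\ (0 < hausdorff1 (cc_dist G) (T `&` S))%E
    & forall T : set 'rV[R]_n, open T -> (T `&` S) !=set0 ->
        ~ sigma_porous (cc_dist G) (T `&` S)].
Proof.
move=> S; split => [x [Dx Ux]|T oT [x0 [Tx0 [Dx0 Ux0]]]|T oT [x0 [Tx0 [Dx0 Ux0]]]].
- exact: gradient_preimage_not_porous.
- have oTD : open (T `&` D) by exact: openI.
  have pansuTD x : (T `&` D) x -> pansu_differentiable G f x by move=> [_ /pansuf].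
  have image_gt0 L : group_linear G L -> (exists x, L x <> 0) ->
      (0 < lebesgue_measure (L @` (T `&` S)))%E.
    by rewrite /S setIA; exact: (image_measure_gt0 oTD pansuTD openU (conj Tx0 Dx0)).
  split => //.
  have [i _] := hdim_gt0 G.
  have gLi := hcoord_group_linear G i.
  have [C C0 lipC] := group_linear_cc gLi.
  apply: (hausdorff1_gt0 C0 lipC); apply: image_gt0 => //.
  by exists (hbasis G i); rewrite hbE eqxx; apply/eqP; exact: oner_neq0.
- exact: gradient_preimage_not_sigma_porous Tx0 Dx0 Ux0.
Qed.
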